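(* Let $F$ be an algebraically closed field of characteristic $p>0$. Let $G$ and $H$ be finite $p$-solvable groups with Sylow $p$-subgroups $P$ and $P'$ respectively, and suppose $FG\cong FH$ as $F$-algebras. Then $P$ is abelian if and only if $P'$ is abelian, and in this case $P\cong P'$. *)

(* Defs.v *)
From HB Require Import structures.
From mathcomp Require Import all_boot all_order all_algebra all_fingroup all_solvable.
Set Implicit Arguments. Unset Strict Implicit. Unset Printing Implicit Defensive.
Import GRing.Theory.

Section PSol.
Local Open Scope group_scope.
Definition p_series_step (p : nat) (gT : finGroupType) (A B : {group gT}) : bool :=
  (A <| B) && (p.-group (B / A) || p^'.-group (B / A)).

Definition p_solvable (p : nat) (gT : finGroupType) (G : {set gT}) : Prop :=
  exists s : seq {group gT},
    path (@p_series_step p gT) 1%G s /\ (last 1%G s :  {set gT}) = G.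

End PSol.

Local Open Scope ring_scope.

(* The group algebra F[gT] of a finite group gT: the F-vector space
   {ffun gT -> F} (coefficient functions sum_g a(g) g) with convolution product. *)
Definition galg_mul (F : fieldType) (gT : finGroupType) (a b : {ffun gT -> F})
  : {ffun gT -> F} :=
  [ffun x => \sum_(y : gT) a y * b (y^-1 * x)%g].

Definition galg_one (F : fieldType) (gT : finGroupType) : {ffun gT -> F} :=
  [ffun x => ((x == 1%g)%:R : F)].

Definition galg_scale (F : fieldType) (gT : finGroupType) (k : F) (a : {ffun gT -> F})
  : {ffun gT -> F} :=
  [ffun x => k * a x].

Definition galg_iso (F : fieldType) (gT hT : finGroupType)
  (f : {ffun gT -> F} -> {ffun hT -> F}) : Prop :=
  [/\ bijective f,
      (forall (k : F) (a b : {ffun gT -> F}), f (galg_scale k a + b) = galg_scale k (f a) + f b),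
      f (galg_one F gT) = galg_one F hT &
      (forall a b, f (galg_mul a b) = galg_mul (f a) (f b))].

Definition galg_isomorphic (F : fieldType) (gT hT : finGroupType) : Prop :=
  exists f : {ffun gT -> F} -> {ffun hT -> F}, galg_iso f.

(* Main.v *)
(* Let [J(G) = I(P) F[G]], where [I(P)] is the augmentation ideal of [F[P]].
   A central idempotent of augmentation 1 is 1 as soon as [O_p'(G) = 1], so an
   augmented isomorphism identifies the principal blocks, and one may replace
   [G] by [G / O_p'(G)]; then [P] is normal in [G], being abelian.
   If [K] is a Hall p'-subgroup of [G], [F[G]] is the sum of [F[K]] and the
   nilpotent ideal [J(G)]; comparing dimensions, [F[H]] is likewise the sum of
   [F[K']] and a nilpotent ideal, which forces [P'] to be normal in [H]. Both
   [J(G)] and [J(H)] are then the largest nilpotent ideals.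

   [P'] is abelian for two reasons. First, [I(P')] commutes modulo [I(P')^3]:
   otherwise a functional on [I(P')^2 / I(P')^3] with a nonsymmetric bilinear form
   and matrices [t_i, D_i] with [[D_i, t_j] = delta_ij] yield a representation
   of [F[H]] over [F[e]/(e^3)]; any subspace stable under its coefficients is
   acted on with [[X, Y] = 1] up to idempotents, so its dimension vanishes in [F].
   But [J(G)] acts through commuting matrices normalized by a p'-group, which
   leaves stable a subspace whose dimension is nonzero in [F]. Second, in [F[G]]
   every element of [J^n] that commutes with [F[G]] modulo [J^(n+1)] and with [J]
   modulo [J^(n+2)] is central modulo [J^(n+1)]; this is invariant under
   isomorphism and, by descending along the filtration of [F[H]], it makes the
   [K']-invariants of [F[P']] central, which forces [P'] to be abelian.

   Finally [dim J^n = |K| dim I(P)^n], and the Hilbert series of [I(P)^n] is the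
   product of the [(1 - X^q) / (1 - X)] over the invariants [q] of [P], which
   determines these invariants. *)

Require Import Defs.
From HB Require Import structures.
From Stdlib Require Import Classical_Prop.
From mathcomp Require Import all_boot all_order all_algebra all_fingroup all_solvable all_field.
From mathcomp.real_closed Require Import mxtens.
From mathcomp Require Import zify ring.
Set Implicit Arguments. Unset Strict Implicit. Unset Printing Implicit Defensive.
Import GroupScope.

(** * Cores and Hall subgroups of p-solvable groups *)

Section PSolvable.
Variable p : nat.
Implicit Types gT : finGroupType.

(** The isomorphism sees neither [P] nor [F[P]], only the powers of J, and J need not be commutative
    for abelian [P], since [K] acts on [P]. Commutativity of [P] must therefore be replaced by
    consequences stated in terms of J and its powers.

    Truncation at e^3 is what detects a commutator modulo I^3: if the constant term kills J, the
    e^2-coefficient of a product of two elements of J is the product of their e-coefficients. The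
    contradiction is a trace: [X, Y] = 1 is impossible in a dimension that is nonzero in F.

    The two reasons are linked: once I(P') commutes modulo its cube, bracketing with I(P') raises
    degrees by two, and this is the depth at which the second property tests an element. The
    K'-invariants of I(P')^n therefore satisfy its hypotheses.

    The normality of P' rests on a rigidity: F[K'] maps isomorphically onto the quotient by the
    nilpotent ideal, so elements of K' that are conjugate in H are already conjugate in K'. A
    p-group permuting a K'-class, whose order is prime to p, then has a fixed point. The same fixed
    point turns central K'-invariants into central elements of P'. *)

Lemma p_solvableS gT (G M : {group gT}) :
  M \subset G -> p_solvable p G -> p_solvable p M.
Proof.
move=> sMG [s [ps ls]]; exists [seq (X :&: M)%G | X <- s]; split; last first.
  have -> : 1%G = (1 :&: M)%G by apply/val_inj; rewrite /= (setIidPl (sub1G _)).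
  by rewrite (last_map (fun X : {group gT} => (X :&: M)%G)) /= ls; apply/setIidPr.
have : path (@p_series_step p gT) (1 :&: M)%G [seq (X :&: M)%G | X <- s].
  elim: s 1%G {ls} ps => //= B s IHs A /andP[/andP[nAB pAB] ps].
  rewrite IHs // andbT /p_series_step; have [sAB nA] := andP nAB.
  have nAM : B :&: M \subset 'N(A) by rewrite subIset // nA.
  have -> : (A :&: M <| B :&: M)%g.
    by rewrite /normal setSI //= normsI // subIset // normG orbT.
  have := second_isog nAM; rewrite setIA (setIidPl sAB) => isoM /=.
  rewrite !(isog_pgroup _ isoM).
  by case/orP: pAB => piB; rewrite !(pgroupS (quotientS _ (subsetIl B M)) piB) ?orbT.
by congr path; apply/val_inj; rewrite /= (setIidPl (sub1G _)).
Qed.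

Lemma p_solvable_quotient gT (G N : {group gT}) : p_solvable p G -> p_solvable p (G / N).
Proof.
case=> s [ps ls]; exists [seq (X / N)%G | X <- s]; split; last first.
  have -> : 1%G = (1 / N)%G by apply/val_inj; rewrite /= quotient1.
  by rewrite (last_map (fun X : {group gT} => (X / N)%G)) /= ls.
have : path (@p_series_step p _) (1 / N)%G [seq (X / N)%G | X <- s].
  elim: s 1%G {ls} ps => //= B s IHs A /andP[/andP[nAB pAB] ps].
  rewrite IHs // andbT /p_series_step; have [sAB nA] := andP nAB.
  rewrite quotient_normal //=.
  have pi_quo pi : pi.-group (B / A) -> pi.-group (B / N / (A / N)).
    have nAX : B :&: 'N(N) \subset 'N(A) by rewrite subIset ?nA.
    rewrite /pgroup [#|_ / _ / _|]card_quotient ?quotient_norms //= -(quotientInorm N B).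
    move/pnat_dvd; apply; apply: dvdn_trans (cardSg (quotientS A (subsetIl B 'N(N)))).
    by rewrite card_quotient //= index_quotient // subIset // subsetIr.
  by case/orP: pAB => piB; rewrite !(pi_quo _ piB) ?orbT.
by congr path; apply/val_inj; rewrite /= quotient1.
Qed.

Lemma p_solvable_pcore gT (G : {group gT}) : p_solvable p G -> G :!=: 1 ->
  'O_p(G) != 1 \/ 'O_p^'(G) != 1.
Proof.
case=> s [ps <-] {G}.
(* The series is only subnormal, but [O_pi(A)] is characteristic in [A], hence normal in the next
   term: the cores increase along the series. *)
have mono pi (A : {group gT}) s' : path (@p_series_step p gT) A s' ->
    'O_pi(A) \subset 'O_pi(last A s').
  elim: s' A => //= B s' IHs A /andP[/andP[nAB _] ps'].
  apply: subset_trans (IHs _ ps'); apply: pcore_max (pcore_pgroup _ _) _.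
  exact: gFnormal_trans.
have [A defA] : {A : {group gT} | A = 1%G} by exists 1%G.
rewrite -defA in ps *; have {defA} : A :=: 1 by rewrite defA.
elim: s A ps => [|B s IHs] A /=; first by move=> _ -> /eqP.
move=> /andP[/andP[nAB pAB] ps] A1.
have [B1|ntB] := eqVneq (B : {set gT}) 1; first exact: IHs ps B1.
have isoB : B \isog B / A by rewrite A1; apply: quotient1_isog.
move=> _; case/orP: pAB; rewrite -(isog_pgroup _ isoB) => piB; [left | right];
  apply: contraNneq ntB => O1; rewrite -subG1 -O1 (subset_trans _ (mono _ _ _ ps)) //;
  exact: pcore_max.
Qed.

(** This is the Hall-Higman lemma. Otherwise some normal subgroup [M] of [G] satisfies [Z < M <= C],
    with [M / Z] a p-group or a p'-group. In the first case [M] is a normal p-subgroup, hence inside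
    [Q]. In the second [Z] is central in [M], so a complement of [Z] is normal in [M] and lies in
    the trivial p'-core. *)
Lemma p_solvable_cent_pcore gT (G : {group gT}) : p_solvable p G ->
  'O_p^'(G) = 1 -> 'C_G('O_p(G)) \subset 'O_p(G).
Proof.
move=> solG O1; set Q := 'O_p(G); set C := 'C_G(Q).
have nsQG : Q <| G by apply: pcore_normal.
have nsCG : C <| G by rewrite /C norm_normalI ?norms_cent ?normal_norm.
have nsZG : (C :&: Q)%G <| G by rewrite normalI.
set Z := (C :&: Q)%G in nsZG *.
have nsZC : Z <| C.
  by rewrite /Z /normal subsetIl normsI ?normG // (subset_trans (normal_sub nsCG)) ?normal_norm.
have pZ : p.-group Z by rewrite (pgroupS (subsetIr _ _)) ?pcore_pgroup.
apply/idPn=> nCQ; have ntCZ : C / Z != 1.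
  by rewrite -subG1 quotient_sub1 ?normal_norm //= subsetI subxx.
have solCZ : p_solvable p (C / Z).
  by apply: p_solvable_quotient; apply: p_solvableS solG; apply: normal_sub.
have lift pi : 'O_pi(C / Z) != 1 -> exists M : {group gT},
    [/\ M <| G, Z \proper M, M \subset C & pi.-group (M / Z)].
  move=> ntO; have nsO : 'O_pi(C / Z) <| G / Z.
    by rewrite gFnormal_trans ?quotient_normal.
  have [M defM sZM nsMG] := inv_quotientN nsZG nsO.
  exists M; split=> //; last by rewrite -defM pcore_pgroup.
    rewrite properEneq sZM andbT; apply: contraNneq ntO => defZ.
    by rewrite defM -defZ trivg_quotient.
  rewrite -(quotientSGK _ (subsetIl C Q)) -?defM ?pcore_sub //.
  by rewrite (subset_trans (normal_sub nsMG)) ?normal_norm.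
case/(p_solvable_pcore solCZ): ntCZ => /lift[M [nsMG ltZM sMC piMZ]].
  have nZM : M \subset 'N(Z) by rewrite (subset_trans (normal_sub nsMG)) ?normal_norm.
  have pM : p.-group M by rewrite -(pquotient_pgroup pZ).
  by case/andP: ltZM => _ /negP[]; rewrite subsetI sMC pcore_max.
have sZM := proper_sub ltZM.
have nsZM : Z <| M by apply: normalS sZM (normal_sub nsMG) nsZG.
have hallZ : Hall M Z.
  rewrite /Hall sZM (pnat_coprime pZ) //.
  by rewrite -card_quotient ?normal_norm.
have /splitsP[K /complP[tiZK defM]] := SchurZassenhaus_split hallZ nsZM.
have cZK : K \subset 'C(Z).
  rewrite centsC (subset_trans (subsetIr C Q)) // centsC.
  by rewrite (subset_trans _ (subset_trans sMC (subsetIr _ _))) // -defM mulG_subr.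
have nsKM : K <| M.
  rewrite /normal -{1}defM mulG_subr -defM mul_subG ?normG //.
  by rewrite cents_norm // centsC.
have p'K : p^'.-group K.
  rewrite /pgroup; have -> : #|K| = #|M / Z|.
    rewrite -defM quotientMidl; apply: card_isog; apply: quotient_isog => //.
    exact: cents_norm.
  exact: piMZ.
case/andP: ltZM => _ /negP[]; rewrite -{1}defM mul_subG //.
have -> : K :=: 1; last exact: sub1G.
apply/trivgP; rewrite -O1 (subset_trans (pcore_max p'K nsKM)) //.
by rewrite pcore_max ?pcore_pgroup ?gFnormal_trans.
Qed.

(** An abelian [P] centralizes ['O_p(G)], which contains its own centralizer. *)
Lemma p_solvable_abelian_Sylow gT (G P : {group gT}) : p_solvable p G ->
  'O_p^'(G) = 1 -> p.-Sylow(G) P -> abelian P -> P <| G.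
Proof.
move=> solG O1 sylP abP; have sQP : 'O_p(G) \subset P by rewrite pcore_sub_Hall.
have -> : P :=: 'O_p(G); last exact: pcore_normal.
apply/eqP; rewrite eqEsubset sQP andbT.
apply: subset_trans (p_solvable_cent_pcore solG O1).
by rewrite subsetI (pHall_sub sylP) (subset_trans abP) ?centS.
Qed.

(** Induction through the quotient by a nontrivial core [N]. The preimage [L] of a Hall subgroup of
    [G / N] works if [N] is a p'-group; if [N] is a p-group, a complement of [N] in [L] does. *)
Lemma p_solvable_Hall gT (G : {group gT}) : p_solvable p G ->
  exists K : {group gT}, p^'.-Hall(G) K.
Proof.
have [m] := ubnP #|G|; elim: m => // m IHm in gT G * => /ltnSE-leGm solG.
have [G1|ntG] := eqVneq (G : {set gT}) 1.
  by exists G; rewrite G1 pHallE subxx cards1 part_p'nat ?pnatNK ?pnat1.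
have HallN pi : pi =i (p : nat_pred) \/ pi =i p^' -> 'O_pi(G) != 1 ->
    exists K : {group gT}, p^'.-Hall(G) K.
  set N := 'O_pi(G) => pi_p ntN.
  have nsNG : N <| G by apply: pcore_normal.
  have [Kb hallKb] : exists Kb : {group coset_of N}, p^'.-Hall(G / N) Kb.
    apply: IHm; last exact: p_solvable_quotient.
    by rewrite (leq_trans _ leGm) ?ltn_quotient ?normal_sub.
  have [L defL sNL sLG] := inv_quotientS nsNG (pHall_sub hallKb).
  have nsNL : N <| L by rewrite (normalS _ _ nsNG).
  have iGL : (p : nat_pred).-nat #|G : L|.
    case/and3P: hallKb => _ _; rewrite defL /= index_quotient_eq ?(subset_trans _ (normal_norm nsNG)) ?subsetIl //.
      by rewrite (eq_pnat _ (negnK _)).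
    by rewrite (subset_trans _ sNL) ?subsetIr.
  have p'LN : p^'.-group (L / N) by rewrite -defL (pHall_pgroup hallKb).
  case: pi_p => pi_p.
    have pN : p.-group N by rewrite -(eq_pgroup _ pi_p) pcore_pgroup.
    have hallN : Hall L N.
      by rewrite /Hall sNL (pnat_coprime pN) // -card_quotient ?normal_norm.
    have /splitsP[K /complP[tiNK defK]] := SchurZassenhaus_split hallN nsNL.
    have oK : #|K| = #|L / N|.
      rewrite -defK quotientMidl; apply: card_isog; apply: quotient_isog => //.
      by rewrite (subset_trans _ (normal_norm nsNL)) // -defK mulG_subr.
    have sKL : K \subset L by rewrite -defK mulG_subr.
    exists K; rewrite /pHall (subset_trans sKL) // /pgroup oK [_.-nat _]p'LN /=.
    rewrite (eq_pnat _ (negnK _)) -(Lagrange_index sLG sKL) pnatM iGL /=.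
    by rewrite -divgS // -defK TI_cardMg // mulnK ?cardG_gt0.
  exists L; rewrite /pHall sLG (eq_pnat _ (negnK _)) iGL andbT /=.
  have p'N : p^'.-group N by rewrite -(eq_pgroup _ pi_p) pcore_pgroup.
  by rewrite -(pquotient_pgroup p'N) ?normal_norm.
by case: (p_solvable_pcore solG ntG) => /HallN; apply; [left | right].
Qed.

End PSolvable.

(** The conjugates of [C] cover [N]. There are at most [#|N : C|] of them and they share the
    identity, so they have at most [#|N| - #|N : C|] nontrivial elements, which forces index 1. *)
Lemma conj_cover_group gT (C N : {group gT}) : C \subset N ->
  (forall n, n \in N -> exists2 m, m \in N & n ^ m \in C) -> C :=: N.
Proof.
move=> sCN coverN; apply/eqP; rewrite eqEcard sCN /=.
have leN : #|N^#| <= #|N : C| * #|C^#|.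
  have sN : N^# \subset cover (C^# :^: N).
    apply/subsetP=> n /setD1P[n1 Nn]; have [m Nm Cnm] := coverN n Nn.
    apply/bigcupP; exists (C^# :^ m^-1); first by apply: imset_f; rewrite groupV.
    by rewrite mem_conjgV 2!inE Cnm andbT -(conj1g m) (inj_eq (conjg_inj m)).
  apply: leq_trans (subset_leq_card sN) _; apply: leq_trans (leq_card_cover _) _.
  rewrite (eq_bigr (fun=> #|C^#|)) => [|_ /imsetP[m _ ->]]; last by rewrite cardJg.
  rewrite sum_nat_const leq_mul2r; apply/orP; right.
  rewrite card_conjugates; apply: dvdn_leq; first exact: indexg_gt0.
  apply: indexgS; rewrite subsetI sCN.
  by apply/subsetP=> c Cc; rewrite inE conjD1g conjGid.
have := Lagrange sCN; have := cardG_gt0 C; have := indexg_gt0 N C.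
have cardD1 (X : {group gT}) : #|X| = #|X^#|.+1 by rewrite (cardsD1 1 X) group1.
move: leN; rewrite (cardD1 N) (cardD1 C).
set i := #|N : C|; case: i => [|[|i]] //=; first by rewrite muln1 => _ _ _ [->].
move=> le_N _ _ defN; exfalso; move: le_N; rewrite -ltnS -defN.
by rewrite mulSn addSn ltnS mulnS leqNgt; apply/negP; rewrite negbK; apply/leP; lia.
Qed.

(** Group algebras are attached to whole types; this identity lets statements about [[set: _]] be
    applied to quotient groups. *)
Lemma setT_quotient (gT : finGroupType) (N : {group gT}) : N <| [set: gT] ->
  [set: coset_of N] = ([set: gT] / N)%g.
Proof.
move=> nN; apply/setP=> x; rewrite inE; case: (cosetP x) => y Ny ->.
by rewrite mem_quotient ?inE.
Qed.

(** * The group algebra and its subspaces *)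

Import GRing.Theory.
Local Open Scope ring_scope.

(** An alias convertible to the function space of the statement, so that a given isomorphism applies
    to it directly, while its ring product is convolution. *)
Definition GA (F : fieldType) (gT : finGroupType) : Type := {ffun gT -> F}.
HB.instance Definition _ (F : fieldType) (gT : finGroupType) :=
  Vector.copy (GA F gT) {ffun gT -> F^o}.

Section GroupAlgebra.
Variables (F : fieldType) (gT : finGroupType).
Local Notation A := (GA F gT).
Implicit Types (a b c : A) (g h x y : gT).

Fact galg_mulA : associative (@galg_mul F gT).
Proof.
move=> a b c; apply/ffunP=> x; rewrite !ffunE.
under eq_bigr do rewrite ffunE mulr_sumr.
under [RHS]eq_bigr do rewrite ffunE mulr_suml.
rewrite [RHS]exchange_big /=; apply: eq_bigr => y _.
rewrite [RHS](reindex_inj (mulgI y)) /=; apply: eq_bigr => z _.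
by rewrite mulKg invMg !mulgA mulrA.
Qed.

Fact galg_mul1 : left_id (galg_one F gT) (@galg_mul F gT).
Proof.
move=> a; apply/ffunP=> x; rewrite !ffunE (bigD1 1%g) //= ffunE eqxx mul1r.
by rewrite invg1 mul1g big1 ?addr0 // => y /negPf y1; rewrite ffunE y1 mul0r.
Qed.

Fact galg_mulr1 : right_id (galg_one F gT) (@galg_mul F gT).
Proof.
move=> a; apply/ffunP=> x; rewrite !ffunE (bigD1 x) //= ffunE mulVg eqxx mulr1.
rewrite big1 ?addr0 // => y /negPf yx; rewrite ffunE -eq_mulVg1 yx.
by rewrite mulr0.
Qed.

Fact galg_mulDl : left_distributive (@galg_mul F gT) +%R.
Proof.
move=> a b c; apply/ffunP=> x; rewrite !ffunE -big_split /=.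
by apply: eq_bigr => y _; rewrite ffunE mulrDl.
Qed.

Fact galg_mulDr : right_distributive (@galg_mul F gT) +%R.
Proof.
move=> a b c; apply/ffunP=> x; rewrite !ffunE -big_split /=.
by apply: eq_bigr => y _; rewrite ffunE mulrDr.
Qed.

Fact galg_one_neq0 : galg_one F gT != 0.
Proof.
by apply/eqP=> /ffunP/(_ 1%g) /eqP; rewrite !ffunE eqxx oner_eq0.
Qed.

HB.instance Definition _ := GRing.Zmodule_isNzRing.Build A
  galg_mulA galg_mul1 galg_mulr1 galg_mulDl galg_mulDr galg_one_neq0.

Lemma galgZE (k : F) a x : (k *: a) x = k * a x.
Proof. by rewrite ffunE. Qed.

Fact galg_scaleAl (k : F) a b : k *: (a * b) = (k *: a) * b.
Proof.
apply/ffunP=> x; rewrite galgZE !ffunE mulr_sumr.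
by apply: eq_bigr => y _; rewrite galgZE mulrA.
Qed.

HB.instance Definition _ := GRing.Lmodule_isLalgebra.Build F A galg_scaleAl.

Fact galg_scaleAr (k : F) a b : k *: (a * b) = a * (k *: b).
Proof.
apply/ffunP=> x; rewrite galgZE !ffunE mulr_sumr.
by apply: eq_bigr => y _; rewrite galgZE mulrCA.
Qed.

HB.instance Definition _ := GRing.Lalgebra_isAlgebra.Build F A galg_scaleAr.
HB.instance Definition _ := Algebra_isFalgebra.Build F A.

Lemma galgM a b x : (a * b) x = \sum_y a y * b (y^-1 * x)%g.
Proof. by rewrite ffunE. Qed.

Lemma galg1 x : (1 : A) x = (x == 1%g)%:R.
Proof. by rewrite ffunE. Qed.

Definition ginj g : A := [ffun x => (x == g)%:R].

Lemma ginjE g x : ginj g x = (x == g)%:R.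
Proof. by rewrite ffunE. Qed.

Lemma ginj1 : ginj 1 = 1.
Proof. by apply/ffunP=> x; rewrite !ffunE. Qed.

Lemma ginj_mulE g a x : (ginj g * a) x = a (g^-1 * x)%g.
Proof.
rewrite galgM (bigD1 g) //= ginjE eqxx mul1r big1 ?addr0 // => y /negPf yg.
by rewrite ginjE yg mul0r.
Qed.

Lemma mul_ginjE g a x : (a * ginj g) x = a (x * g^-1)%g.
Proof.
rewrite galgM (bigD1 (x * g^-1)%g) //= ginjE invMg invgK mulgKV eqxx mulr1.
rewrite big1 ?addr0 // => y; rewrite ginjE => /negPf yx.
by rewrite -(inj_eq (mulgI y)) mulKVg -(inj_eq (mulIg g^-1%g)) mulgK eq_sym yx mulr0.
Qed.

Lemma ginjM g h : ginj (g * h) = ginj g * ginj h.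
Proof.
apply/ffunP=> x; rewrite ginj_mulE !ginjE eq_sym.
by rewrite (can2_eq (mulKg g) (mulKVg g)) eq_sym.
Qed.

Lemma galg_sum a : a = \sum_g a g *: ginj g.
Proof.
apply/ffunP=> x; rewrite sum_ffunE (bigD1 x) //= galgZE ginjE eqxx mulr1.
by rewrite big1 ?addr0 // => y yx; rewrite galgZE ginjE eq_sym (negPf yx) mulr0.
Qed.

Lemma dim_galg : \dim {:A} = #|gT|.
Proof. by rewrite dimvf /dim /= muln1. Qed.

End GroupAlgebra.
Arguments ginj F {gT} g.

Section LinearExtension.
Variables (F : fieldType) (gT : finGroupType).
Local Notation A := (GA F gT).

Definition gext (V : lmodType F) (phi : gT -> V) (a : A) : V :=
  \sum_g a g *: phi g.

Section Lmod.
Variables (V : lmodType F) (phi : gT -> V).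

Fact gext_is_linear : linear (gext phi).
Proof.
move=> k a b; rewrite /gext scaler_sumr -big_split /=; apply: eq_bigr => g _.
by rewrite scalerA -scalerDl ffunE galgZE.
Qed.
HB.instance Definition _ := GRing.isSemilinear.Build F A V _ (gext phi)
  (GRing.semilinear_linear gext_is_linear).

Lemma gext_inj g : gext phi (ginj F g) = phi g.
Proof.
rewrite /gext (bigD1 g) //= ginjE eqxx scale1r big1 ?addr0 // => h hg.
by rewrite ginjE (negPf hg) scale0r.
Qed.

Lemma gext1 : gext phi 1 = phi 1%g.
Proof. by rewrite -ginj1 gext_inj. Qed.

End Lmod.

Lemma linear_galg_eq (V : lmodType F) (f1 f2 : {linear A -> V}) :
  (forall g, f1 (ginj F g) = f2 (ginj F g)) -> f1 =1 f2.
Proof.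
move=> eqf a; rewrite [a]galg_sum !linear_sum; apply: eq_bigr => g _.
by rewrite !linearZ /= eqf.
Qed.

Lemma linear_galg_in (V : vectType F) (U : {vspace V}) (f : {linear A -> V}) :
  (forall g, f (ginj F g) \in U) -> forall a, f a \in U.
Proof.
move=> Uf a; rewrite [a]galg_sum linear_sum memv_suml // => g _.
by rewrite linearZ /= memvZ.
Qed.

Lemma bilinear_galg_eq (V : lmodType F) (f1 f2 : A -> A -> V) :
  (forall a, linear (f1 a)) -> (forall b, linear (f1^~ b)) ->
  (forall a, linear (f2 a)) -> (forall b, linear (f2^~ b)) ->
  (forall g h, f1 (ginj F g) (ginj F h) = f2 (ginj F g) (ginj F h)) ->
  forall a b, f1 a b = f2 a b.
Proof.
move=> l1 r1 l2 r2 eqf a b.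
have lin (f : A -> V) : linear f -> forall c, f c = \sum_g c g *: f (ginj F g).
  move=> fl c; pose fm := GRing.isSemilinear.Build F A V _ f (GRing.semilinear_linear fl).
  pose fL : {linear A -> V} := HB.pack f fm.
  rewrite {1}[c]galg_sum -[f]/(fL : _ -> _) linear_sum; apply: eq_bigr => g _.
  by rewrite linearZ.
rewrite (lin _ (r1 b)) (lin _ (r2 b)); apply: eq_bigr => g _; congr (_ *: _).
by rewrite (lin _ (l1 _)) (lin _ (l2 _)); apply: eq_bigr => h _; rewrite eqf.
Qed.

Lemma gextM (B : algType F) (phi : gT -> B) :
  {morph phi : g h / (g * h)%g >-> g * h} -> {morph gext phi : a b / a * b}.
Proof.
move=> phiM; apply: bilinear_galg_eq => [a k b c|b k a c|a k b c|b k a c|g h].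
- by rewrite mulrDr -scalerAr linearP.
- by rewrite mulrDl -scalerAl linearP.
- by rewrite linearP mulrDr scalerAr.
- by rewrite linearP mulrDl scalerAl.
- by rewrite -ginjM !gext_inj phiM.
Qed.

End LinearExtension.

Section Subspaces.
Variables (F : fieldType) (gT : finGroupType).
Local Notation A := (GA F gT).
Implicit Types (S : {set gT}) (a b : A).

Definition gspan S : {vspace A} := <<[seq ginj F g | g in S]>>%VS.

Lemma ginj_gspan S g : g \in S -> ginj F g \in gspan S.
Proof. by move=> Sg; apply: memv_span; apply: image_f. Qed.

Lemma gspanP S a : reflect (forall x, x \notin S -> a x = 0) (a \in gspan S).
Proof.
apply: (iffP idP) => [|a0].
  move=> /coord_span-> x Sx; rewrite sum_ffunE big1 // => i _.
  rewrite galgZE;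
  have /imageP[g Sg ->] : (image_tuple (ginj F) (mem S))`_i \in image_tuple (ginj F) (mem S).
    by rewrite mem_nth // size_tuple.
  by rewrite ginjE; case: eqP => [xg|_]; [rewrite xg Sg in Sx | rewrite mulr0].
rewrite [a]galg_sum memv_suml // => g _.
by have [Sg|/a0->] := boolP (g \in S); rewrite ?scale0r ?mem0v // memvZ ?ginj_gspan.
Qed.

Lemma dim_gspan S : \dim (gspan S) = #|S|.
Proof.
suff /eqP-> : free [seq ginj F g | g in S] by rewrite size_image.
apply/freeP=> k k0 i; have /ffunP/(_ (enum_val i)) := k0.
rewrite sum_ffunE (bigD1 i) //= big1 => [|j ji].
  by rewrite addr0 galgZE nth_image ginjE eqxx mulr1 ffunE.
by rewrite galgZE nth_image ginjE (inj_eq enum_val_inj) eq_sym (negPf ji) mulr0.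
Qed.

Lemma gspanT : gspan setT = fullv.
Proof. by apply/vspaceP=> a; rewrite memvf; apply/gspanP=> x; rewrite inE. Qed.

Lemma gspan1 (P : {group gT}) : 1 \in gspan P.
Proof. by rewrite -ginj1 ginj_gspan. Qed.

Lemma gspanS S1 S2 : S1 \subset S2 -> (gspan S1 <= gspan S2)%VS.
Proof.
move=> /subsetP S12; apply/subvP=> a /gspanP aS; apply/gspanP=> x.
by move=> xS2; apply: aS; apply: contra xS2; apply: S12.
Qed.

Lemma gspan_ind S (U : {vspace A}) :
  (forall g, g \in S -> ginj F g \in U) -> (gspan S <= U)%VS.
Proof.
by move=> SU; apply/span_subvP=> _ /imageP[g Sg ->]; apply: SU.
Qed.

Lemma prodv_span (B : falgType F) (X Y : seq B) (W : {vspace B}) :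
  (forall x y, x \in X -> y \in Y -> x * y \in W) -> (<<X>> * <<Y>> <= W)%VS.
Proof.
move=> XY; apply/prodvP=> u v uX vY.
rewrite (coord_span (uX : u \in <<in_tuple X>>%VS)).
rewrite (coord_span (vY : v \in <<in_tuple Y>>%VS)).
rewrite mulr_suml memv_suml // => i _; rewrite mulr_sumr memv_suml // => j _.
by rewrite -scalerAl -scalerAr !memvZ // XY // mem_nth.
Qed.

Lemma gspanM S1 S2 S3 : (S1 * S2 \subset S3)%g -> (gspan S1 * gspan S2 <= gspan S3)%VS.
Proof.
move=> /subsetP S123; apply: prodv_span => _ _ /imageP[g Sg ->] /imageP[h Sh ->].
by rewrite -ginjM ginj_gspan // S123 // mem_mulg.
Qed.

Lemma gspan_mul (P : {group gT}) : {in gspan P &, forall a b, a * b \in gspan P}.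
Proof. by move=> a b Pa Pb; apply: subvP (memv_mul Pa Pb); rewrite gspanM ?mulGid. Qed.

(** For a group [S] this is the augmentation ideal of [F[S]]. Like [gspan], it lives inside the
    single algebra [F[G]], so that it can be multiplied by elements outside [F[S]]. *)
Definition augv S : {vspace A} := <<[seq ginj F g - 1 | g in S]>>%VS.

Lemma mem_augv S g : g \in S -> ginj F g - 1 \in augv S.
Proof. by move=> Sg; apply: memv_span; apply/imageP; exists g. Qed.

Lemma augv_sub S (U : {vspace A}) :
  (forall g, g \in S -> ginj F g - 1 \in U) -> (augv S <= U)%VS.
Proof. by move=> SU; apply/span_subvP=> _ /imageP[g Sg ->]; apply: SU. Qed.

Lemma augv_gspan (P : {group gT}) : (augv P <= gspan P)%VS.
Proof. by apply: augv_sub => g Pg; rewrite memvB ?gspan1 ?ginj_gspan. Qed.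

Lemma augvMr (P : {group gT}) : (augv P * gspan P <= augv P)%VS.
Proof.
apply: prodv_span => _ _ /imageP[h Ph ->] /imageP[g Pg ->].
have -> : (ginj F h - 1) * ginj F g = (ginj F (h * g)%g - 1) - (ginj F g - 1).
  by rewrite mulrBl mul1r -ginjM opprB addrA subrK.
by rewrite memvB ?mem_augv ?groupM.
Qed.

Lemma gspan_augv (P : {group gT}) : gspan P = (1 + augv P)%VS.
Proof.
apply/eqP; rewrite eqEsubv; apply/andP; split.
  apply: gspan_ind => g Pg; rewrite -[ginj F g](subrK 1) addrC.
  by rewrite memv_add ?mem_augv // memv_line.
by rewrite subv_add augv_gspan -memvE gspan1.
Qed.

End Subspaces.

(** * Nilpotent ideals and p'-subgroups *)

Lemma eigenvalue_closedField (F : closedFieldType) n (M : 'M[F]_n) :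
  (0 < n)%N -> exists a, eigenvalue M a.
Proof.
move=> n0; have /closed_rootP[a rAa] : size (char_poly M) != 1.
  by rewrite size_char_poly; case: n n0 M.
by exists a; rewrite eigenvalue_root_char.
Qed.

Lemma mxtrace_nilpotent (F : closedFieldType) m (M : 'M[F]_m.+1) n :
  M ^+ n = 0 -> \tr M = 0.
Proof.
move=> Mn0; have [s defM] := closed_field_poly_normal (char_poly M).
rewrite (monicP (char_poly_monic M)) scale1r in defM.
have s0 : s = nseq (size s) 0.
  apply/all_pred1P/allP=> a sa; have : eigenvalue M a.
    by rewrite eigenvalue_root_char defM root_prod_XsubC.
  case/eigenvalueP=> v vM v0; apply/eqP.
  have vMk k : v *m (M ^+ k) = a ^+ k *: v.
    elim: k => [|k IHk]; first by rewrite expr0 mulmx1 scale1r.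
    by rewrite exprSr -mulmxE mulmxA IHk -scalemxAl vM scalerA exprSr.
  have /esym/eqP := vMk n; rewrite Mn0 mulmx0 scaler_eq0 (negPf v0) orbF.
  by rewrite expf_eq0 => /andP[_ /eqP].
have ss : size s = m.+1.
  by apply/succn_inj; rewrite -(size_char_poly M) defM size_prod_XsubC.
have := char_poly_trace M isT; rewrite defM s0 big_nseq subr0 ss.
rewrite iter_mulr_1 coefXn ltn_eqF // => /esym/eqP.
by rewrite oppr_eq0 => /eqP.
Qed.

Section NilpotentIdeals.
Variable F : closedFieldType.

Definition nilp_ideal (B : falgType F) (U : {vspace B}) :=
  [/\ (fullv * U <= U)%VS, (U * fullv <= U)%VS & exists n, (U ^+ n = 0)%VS].

Lemma memv_exp (B : falgType F) (U : {vspace B}) u n : u \in U -> u ^+ n \in (U ^+ n)%VS.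
Proof.
move=> Uu; elim: n => [|n IHn]; first by rewrite expr0 expv0 memv_line.
by rewrite exprS expvSl memv_mul.
Qed.

Variable gT : finGroupType.
Local Notation A := (GA F gT).
Implicit Types (L : {group gT}) (a : A).

(* The trace of right multiplication by [a] on the group algebra of [L] is
   [#|L| * a 1], and it vanishes when [a] is nilpotent. *)
Lemma gspan_nilpotent L a n : #|L|%:R != 0 :> F -> a \in gspan F L ->
  a ^+ n = 0 -> a 1%g = 0.
Proof.
move=> L0 La an0; pose x i : gT := @enum_val _ (mem L) i.
have [m defL] : exists m, #|L| = m.+1 by exists #|L|.-1; rewrite prednK ?cardG_gt0.
pose y (i : 'I_m.+1) := x (cast_ord (esym defL) i).
have yL i : y i \in L by apply: enum_valP.
have yinj : injective y by move=> i j /enum_val_inj/cast_ord_inj.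
pose M b : 'M[F]_m.+1 := \matrix_(i, j) (b : A) ((y i)^-1 * y j)%g.
have MX k : a ^+ k \in gspan F L /\ M (a ^+ k) = M a ^+ k.
  elim: k => [|k [Lk IHk]].
    rewrite !expr0 gspan1; split=> //; apply/matrixP=> i j; rewrite !mxE galg1.
    by rewrite -eq_mulVg1 (inj_eq yinj).
  split; first by rewrite exprS gspan_mul.
  rewrite !exprS -IHk; apply/matrixP=> i j; rewrite !mxE galgM.
  rewrite (bigID (mem L)) /= [X in _ + X]big1 ?addr0 => [|h Lh]; last first.
    by rewrite (gspanP _ _ La) ?mul0r.
  rewrite (reindex (fun l => (y i)^-1 * y l)%g) /=; last first.
    exists (fun h => cast_ord defL (enum_rank_in (group1 L) (y i * h)%g)).
      move=> l _; rewrite mulKVg /y; apply: (can_inj (cast_ordK (esym defL))).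
      by rewrite cast_ordK enum_valK_in.
    move=> h; rewrite inE => Lh; rewrite /y cast_ordK /x enum_rankK_in ?groupM ?yL //.
    by rewrite mulKg.
  apply: eq_big => [l|l _]; first by rewrite groupM ?groupV ?yL.
  by rewrite !mxE invMg invgK mulgA mulgK.
have : \tr (M a) = 0.
  by apply: (@mxtrace_nilpotent _ _ _ n); rewrite -(MX n).2 an0; apply/matrixP=> i j; rewrite !mxE ffunE.
rewrite /mxtrace; under eq_bigr do rewrite mxE mulVg.
rewrite sumr_const card_ord -defL -mulr_natl => /eqP.
by rewrite mulf_eq0 (negPf L0) => /eqP.
Qed.

(** The coefficient at [x] of an element of the intersection is the coefficient at 1 of its
    translate by [x^-1], which lies again in [F[L]] and in [U], hence is nilpotent. *)
Lemma nilp_ideal_cap_gspan L (U : {vspace A}) : #|L|%:R != 0 :> F ->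
  nilp_ideal U -> (gspan F L :&: U = 0)%VS.
Proof.
move=> L0 [_ Ur [n Un]]; apply/eqP; rewrite -subv0; apply/subvP=> a.
rewrite memv_cap memv0 => /andP[La Ua]; apply/eqP/ffunP=> x; rewrite [RHS]ffunE.
have [Lx|/(gspanP _ _ La)//] := boolP (x \in L).
have := mul_ginjE x^-1 a 1%g; rewrite invgK mul1g => <-.
apply: (@gspan_nilpotent L _ n L0).
  by rewrite gspan_mul ?ginj_gspan ?groupV.
apply/eqP; rewrite -memv0 -Un memv_exp //.
by apply: subvP Ur _ _; rewrite memv_mul ?memvf.
Qed.

End NilpotentIdeals.

(** * Nilpotency of the augmentation ideal of a p-group *)

Section SubspacePowers.
Variable F : fieldType.

Lemma expv_addv_ideal (B : falgType F) (S U V : {vspace B}) n :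
  (V <= S -> S * U <= U -> U * S <= U -> U <= S -> 1 <= S -> S * S <= S -> (U + V) ^+ n <= U + V ^+ n)%VS.
Proof.
move=> VS SU US US' S1 SS.
have VnS m : (V ^+ m <= S)%VS.
  elim: m => [|m IHm]; first by rewrite expv0.
  by rewrite expvSl (subv_trans _ SS) // prodvS.
elim: n => [|n IHn]; first by rewrite !expv0 addvSr.
rewrite expvSl (subv_trans (prodvSr _ IHn)) // prodvDl !prodvDr !subv_add.
apply/andP; split; apply/andP; split.
- by rewrite (subv_trans _ (addvSl _ _)) // (subv_trans _ US) // prodvSr.
- by rewrite (subv_trans _ (addvSl _ _)) // (subv_trans _ US) // prodvSr.
- by rewrite (subv_trans _ (addvSl _ _)) // (subv_trans _ SU) // prodvSl.
- by rewrite -expvSl addvSr.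
Qed.

Lemma expv_normal (B : falgType F) (U S : {vspace B}) n :
  (S * U <= U * S -> S * U ^+ n <= U ^+ n * S)%VS.
Proof.
move=> SU; elim: n => [|n IHn]; first by rewrite expv0 prodv1 prod1v.
rewrite expvSr prodvA (subv_trans (prodvSl _ IHn)) // -!prodvA.
by rewrite prodvSr.
Qed.

Lemma expv_prod_normal (B : falgType F) (U S : {vspace B}) n :
  (S * U <= U * S -> S * S <= S -> (U * S) ^+ n.+1 <= U ^+ n.+1 * S)%VS.
Proof.
move=> SU SS; elim: n => [|n IHn]; first by rewrite !expv1.
rewrite [(_ ^+ n.+2)%VS]expvSl (subv_trans (prodvSr _ IHn)) //.
rewrite [(U ^+ n.+2)%VS]expvSl -!prodvA prodvSr // prodvA.
rewrite (subv_trans (prodvSl _ (expv_normal n.+1 SU))) // -prodvA.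
by rewrite prodvSr.
Qed.
End SubspacePowers.

Section Basis.
Variables (F : fieldType) (p : nat) (gT : finGroupType).
Hypothesis charFp : p \in [pchar F].
Local Notation A := (GA F gT).
Implicit Types P M : {group gT}.

Lemma ginjX g n : ginj F (g ^+ n : gT)%g = ginj F g ^+ n.
Proof. by elim: n => [|n IHn]; rewrite ?expr0 ?ginj1 // expgS exprS ginjM IHn. Qed.

Lemma ginj_subX_pchar g : (ginj F g - 1) ^+ p = ginj F (g ^+ p : gT)%g - 1.
Proof.
have charA : p \in [pchar A].
  have := charFp; rewrite !inE => /andP[-> /eqP p0] /=.
  by rewrite -scaler_nat p0 scale0r.
have -> : (ginj F g - 1) ^+ p = pFrobenius_aut charA (ginj F g - 1) by [].
rewrite pFrobenius_autB_comm ?pFrobenius_aut1 ?pFrobenius_autE ?ginjX //.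
exact: commr1.
Qed.

Lemma augv_normal P M : M \subset 'N(P) ->
  (gspan F M * augv F P <= augv F P * gspan F M)%VS.
Proof.
move=> nPM; apply: prodv_span => _ _ /imageP[g Mg ->] /imageP[h Ph ->].
have -> : ginj F g * (ginj F h - 1) = (ginj F (h ^ g^-1)%g - 1) * ginj F g.
  by rewrite mulrBr mulr1 mulrBl mul1r -!ginjM conjgE invgK mulgA mulgKV.
by rewrite memv_mul ?ginj_gspan // mem_augv // memJ_norm // groupV (subsetP nPM).
Qed.

Lemma gspan_id P : (gspan F P * gspan F P = gspan F P)%VS.
Proof.
apply: subv_anti; rewrite gspanM ?mulGid //=; apply/subvP=> a Pa.
by rewrite -[a]mulr1 memv_mul ?gspan1.
Qed.

Lemma augvM P M : (P \subset M -> augv F P * gspan F M <= augv F M)%VS.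
Proof.
move=> sPM; rewrite (subv_trans _ (augvMr F M)) // prodvSl //.
by apply: augv_sub => g Pg; rewrite mem_augv ?(subsetP sPM).
Qed.

(* If [M] is normal of index [p] in [P] and [x] generates [P] modulo [M], then
   [augv P] is [augv M * gspan P] plus the commutative ideal of [<[x]>], whose
   [p]-th power lies in [augv M * gspan P] since [x ^+ p \in M]. *)
Lemma augv_nilpotent P : p.-group P -> exists n, (augv F P ^+ n = 0)%VS.
Proof.
move: {2}_.+1 (ltnSn #|P|) => m; elim: m P => // m IHm P Pm pP.
have [P1|ntP] := eqVneq (P : {set gT}) 1%g.
  exists 1; apply/eqP; rewrite expv1 -subv0; apply: augv_sub => g.
  by rewrite P1 => /set1gP->; rewrite ginj1 subrr mem0v.
have [M maxM _] : {M : {group gT} | maximal M P & 1%G \subset M}.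
  by apply: maxgroup_exists; rewrite /= proper1G.
have nMP := p_maximal_normal pP maxM; have iMP := p_maximal_index pP maxM.
have [sMP nnMP] := andP nMP; have ltMP := maxgroupp maxM.
have [n nM] : exists n, (augv F M ^+ n = 0)%VS.
  apply: IHm; last exact: pgroupS pP.
  by rewrite -ltnS (leq_trans _ Pm) // ltnS proper_card.
have [_ [x Px M'x]] := properP ltMP.
have xpM : (x ^+ p)%g \in M.
  have nMx : x \in 'N(M) by apply: subsetP Px.
  apply: coset_idr; rewrite ?groupX // morphX //= -iMP -card_quotient //.
  by rewrite expg_cardG // mem_quotient.
have defP : <[x]> \subset P by rewrite cycle_subG.
set S := gspan F P; set U := (augv F M * S)%VS.
pose C := <[x]>%G; pose X : A := ginj F x - 1.
set V := (<[X]> * gspan F C)%VS.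
have US : (U <= S)%VS by rewrite (subv_trans (augvM sMP)) ?augv_gspan.
have CS : (gspan F C <= S)%VS by rewrite gspanS.
have XS : X \in S by rewrite (subvP CS) // memvB ?gspan1 ?ginj_gspan ?cycle_id.
have VS : (V <= S)%VS by rewrite -[S]gspan_id prodvS // -memvE.
have SU : (S * U <= U)%VS.
  by rewrite prodvA (subv_trans (prodvSl _ (augv_normal nnMP))) // -prodvA gspan_id.
have US' : (U * S <= U)%VS by rewrite -prodvA gspan_id.
have xCC y : y \in gspan F C -> X * y = y * X.
  move=> Cy; suff : (gspan F C <= 'C[X])%VS by move/subvP/(_ y Cy)/cent1vP.
  apply: gspan_ind => g /cycleP[k ->]; apply/cent1vP.
  by rewrite mulrBl mulrBr mulr1 mul1r -!ginjM -expgS -expgSr.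
have IUV : (augv F P <= U + V)%VS.
  apply: augv_sub => g Pg.
  have [m0 Mm [k defg]] : exists2 m0, m0 \in M & exists k, g = (m0 * x ^+ k)%g.
    have : g \in (M * <[x]>)%g.
      by rewrite (mulg_normal_maximal nMP maxM) ?cycle_subG.
    by case/mulsgP=> m0 _ Mm /cycleP[k ->] ->; exists m0 => //; exists k.
  have -> : ginj F g - 1 = (ginj F m0 - 1) * ginj F (x ^+ k)%g + (ginj F (x ^+ k)%g - 1).
    by rewrite mulrBl mul1r -ginjM -defg addrA subrK.
  rewrite memv_add //.
    by rewrite memv_mul ?mem_augv // ginj_gspan // groupX.
  rewrite ginjX subrX1 memv_mul ?memv_line // memv_suml // => i _.
  by rewrite -ginjX ginj_gspan ?mem_cycle.
have Vp : (V ^+ p <= U)%VS.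
  have CX : (gspan F C * <[X]> <= <[X]> * gspan F C)%VS.
    apply/prodvP=> y _ Cy /vlineP[k ->]; rewrite -scalerAr -xCC // memvZ //.
    by rewrite memv_mul ?memv_line.
  have p_gt0 : (0 < p)%N by rewrite prime_gt0 // (pcharf_prime charFp).
  have := expv_prod_normal p.-1 CX; rewrite prednK // gspan_id subvv => /(_ isT).
  move/subv_trans; apply; rewrite expv_line /X ginj_subX_pchar prodvS //.
  by rewrite -memvE mem_augv.
(* The [p]-th power of [augv F P] lies in [U], and [U ^+ n.+1] lies in [augv F M ^+ n.+1 * S], which
   is zero. *)
exists (p * n.+1)%N; apply/eqP; rewrite -subv0 expvM.
have S1 : (1 <= S)%VS by rewrite -memvE gspan1.
have IpU : (augv F P ^+ p <= U)%VS.
  rewrite (subv_trans (expvS p IUV)) //.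
  rewrite (subv_trans (expv_addv_ideal p VS SU US' US S1 _)) ?gspan_id //.
  by rewrite subv_add subvv.
rewrite (subv_trans (expvS _ IpU)) //.
rewrite (subv_trans (expv_prod_normal n (augv_normal nnMP) _)) ?gspan_id //.
by rewrite expvSl nM prodv0 prod0v.
Qed.

End Basis.

(** * Algebra morphisms, quotient groups and the radical *)

Section AHomTheory.
Variables (F : fieldType) (B C : falgType F) (f : 'AHom(B, C)).

Lemma ahomM : {morph f : a b / a * b}. Proof. exact: rmorphM. Qed.
Lemma ahom1 : f 1 = 1. Proof. exact: rmorph1. Qed.

End AHomTheory.

Section ExtensionMorphism.
Variables (F : fieldType) (gT : finGroupType) (B : falgType F) (phi : gT -> B).
Hypotheses (phi1 : phi 1%g = 1) (phiM : {morph phi : g h / (g * h)%g >-> g * h}).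

Fact gext_is_ahom : ahom_in {:GA F gT} (linfun (gext phi)).
Proof.
apply/ahomP_tmp; split=> [|a b]; first by rewrite lfunE /= gext1.
by rewrite !lfunE /= gextM.
Qed.

Fact gext_key : unit. Proof. by []. Qed.
Definition gext_ahom : 'AHom(GA F gT, B) := locked_with gext_key (AHom gext_is_ahom).

Lemma gext_ahomE a : gext_ahom a = gext phi a.
Proof. by rewrite /gext_ahom locked_withE lfunE. Qed.

Lemma gext_ahom_inj g : gext_ahom (ginj F g) = phi g.
Proof. by rewrite gext_ahomE gext_inj. Qed.

End ExtensionMorphism.

Section Quotient.
Variables (F : fieldType) (gT : finGroupType) (N : {group gT}).
Hypothesis nN : N <| [set: gT].
Local Notation A := (GA F gT).

Let normN g : g \in 'N(N). Proof. by rewrite (subsetP (normal_norm nN)) ?inE. Qed.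

Fact coset1_ginj : ginj F (coset N 1) = 1.
Proof. by rewrite morph1 ginj1. Qed.

Fact cosetM_ginj : {morph (fun g => ginj F (coset N g)) : g h / (g * h)%g >-> g * h}.
Proof. by move=> g h; rewrite morphM // ginjM. Qed.

Definition gquo : 'AHom(A, GA F (coset_of N)) := gext_ahom coset1_ginj cosetM_ginj.

Lemma gquo_inj g : gquo (ginj F g) = ginj F (coset N g).
Proof. exact: gext_ahom_inj. Qed.

Definition gsec (b : GA F (coset_of N)) : A := gext (fun x : coset_of N => ginj F (repr x)) b.

Lemma gsecK b : gquo (gsec b) = b.
Proof.
have := @linear_galg_eq F (coset_of N) _ (gquo \o gext (fun x : coset_of N => ginj F (repr x))) idfun.
by apply=> x /=; rewrite gext_inj gquo_inj coset_reprK.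
Qed.

Lemma limg_gquo : (gquo @: fullv = fullv)%VS.
Proof.
by apply/vspaceP=> b; rewrite memvf -(gsecK b) memv_img ?memvf.
Qed.

(** An element of the kernel equals its difference with the lift of its image. On a group element
    [g] this difference is [g - n * g = - (n - 1) * g], where [n * g] is the representative of the
    coset of [g]. *)
Lemma gquo_ker a : gquo a = 0 -> a \in (augv F N * fullv)%VS.
Proof.
move=> qa0; have -> : a = a - gsec (gquo a) by rewrite qa0 /gsec linear0 subr0.
have := @linear_galg_in _ _ _ (augv F N * fullv)%VS
  (idfun \- (gext (fun x : coset_of N => ginj F (repr x)) \o gquo)).
apply=> g /=; rewrite gquo_inj gext_inj.
have /imsetP[n Nn ->] : repr (coset N g) \in ((mulg^~ g) @: N)%g.
  have := mem_repr_coset (coset N g); rewrite val_coset // => /rcosetP[n Nn ->].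
  by apply: imset_f.
rewrite ginjM -{1}[ginj F g]mul1r -mulrBl memv_mul ?memvf // -opprB memvN.
exact: mem_augv.
Qed.

End Quotient.

Arguments gquo F {gT N} nN.

Section RadicalPowers.
Variables (F : fieldType) (gT : finGroupType) (P : {group gT}).
Local Notation A := (GA F gT).

Definition gJ : {vspace A} := (augv F P * fullv)%VS.

Hypothesis nP : P <| [set: gT].

Lemma fullv_augv : (fullv * augv F P <= augv F P * fullv)%VS.
Proof. by rewrite -gspanT -[setT]/(gval [set: gT]%G) augv_normal ?normal_norm. Qed.

Lemma gJ_exp n : (gJ ^+ n.+1 = augv F P ^+ n.+1 * fullv)%VS.
Proof.
apply: subv_anti; rewrite expv_prod_normal ?subvf ?fullv_augv //=.
elim: n => [|n IHn]; first by rewrite !expv1.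
rewrite expvSl -prodvA (subv_trans (prodvSr _ IHn)) // [(gJ ^+ n.+2)%VS]expvSl.
apply: prodvSl; apply/subvP=> a Pa.
by rewrite -[a]mulr1 memv_mul ?memvf.
Qed.

End RadicalPowers.

Section Radical.
Variables (F : closedFieldType) (p : nat).
Hypothesis charFp : p \in [pchar F].

Lemma pchar_natr_neq0 n : (n%:R != 0 :> F) = ~~ (p %| n)%N.
Proof. by rewrite (dvdn_pcharf charFp). Qed.

Lemma nilp_ideal_img (B C : falgType F) (f : 'AHom(B, C)) (U : {vspace B}) :
  (f @: fullv = fullv)%VS -> nilp_ideal U -> nilp_ideal (f @: U).
Proof.
move=> fT [lU rU [n Un]]; split; try by rewrite -fT -aimgM limgS.
by exists n; rewrite -aimgX Un limg0.
Qed.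

Variable gT : finGroupType.
Local Notation A := (GA F gT).
Variable P : {group gT}.
Hypothesis nP : P <| [set: gT].

Lemma gJ_nilp : p.-group P -> nilp_ideal (gJ F P).
Proof.
move=> pP; split.
- by rewrite /gJ prodvA (subv_trans (prodvSl _ (fullv_augv F nP))) // -prodvA prodvSr ?subvf.
- by rewrite -prodvA prodvSr ?subvf.
have [n Pn] := augv_nilpotent charFp pP.
by exists n.+1; rewrite gJ_exp // expvSl Pn prodv0 prod0v.
Qed.

(** The image of [U] in [F[G / P]] is a nilpotent ideal of the group algebra of a p'-group, hence
    zero, and the kernel of the projection lies in [gJ F P]. *)
Lemma nilp_sub_gJ (U : {vspace A}) : ~~ (p %| #|[set: gT] : P|)%N ->
  nilp_ideal U -> (U <= gJ F P)%VS.
Proof.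
move=> p'P nU; have := nilp_ideal_img (limg_gquo F nP) nU.
move/(@nilp_ideal_cap_gspan _ _ [set: coset_of P]%G); rewrite pchar_natr_neq0.
have -> : #|[set: coset_of P]%G| = #|[set: gT] : P|.
  rewrite -card_quotient ?normal_norm //; apply: eq_card => x; rewrite inE.
  by case: (cosetP x) => y _ ->; rewrite mem_quotient ?inE.
move=> /(_ p'P); rewrite gspanT capfv => q0; apply/subvP=> a Ua.
apply: (gquo_ker (nN := nP)).
by apply/eqP; rewrite -memv0 -q0 memv_img.
Qed.

End Radical.

(** * Normality of a Sylow subgroup from a nilpotent ideal *)

Section ClassFunctions.
Variables (F : fieldType) (gT : finGroupType).
Local Notation A := (GA F gT).

(** Summing coefficients over a [K]-class is invariant under conjugation by [K], hence behaves as a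
    trace for products with [F[K]], even though [b] ranges over all of [F[G]]. *)
Lemma class_sumC (K : {group gT}) (n : gT) (a b : A) : a \in gspan F K ->
  \sum_(h in (n ^: K)%g) (a * b) h = \sum_(h in (n ^: K)%g) (b * a) h.
Proof.
move=> Ka; under eq_bigr do rewrite galgM.
under [RHS]eq_bigr => h _.
  rewrite galgM (reindex_inj (inj_comp (mulgI h) invg_inj)) /=.
  under eq_bigr => y _ do rewrite invMg invgK mulgKV mulrC. over.
rewrite exchange_big [RHS]exchange_big /=; apply: eq_bigr => y _.
have [Ky|/(gspanP _ _ Ka) a0] := boolP (y \in K); last by rewrite !big1 // => h _; rewrite a0 mul0r.
rewrite (reindex_inj (conjg_inj y^-1%g)) /=; apply: eq_big => [h|h _].
  by rewrite memJ_norm // groupV (subsetP (class_norm n K)).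
by rewrite conjgE invgK mulKg.
Qed.

End ClassFunctions.

Section NormalSylow.
Variables (F : closedFieldType) (p : nat).
Hypothesis charFp : p \in [pchar F].
Implicit Type gT : finGroupType.

(** Modulo [U], replace [x^-1] and [x] by [a] and [b] in [F[K]]. As [F[K]] meets [U] trivially,
    [b * a = 1] and [n ^ x = a * n * b] hold exactly, so that [n] and [n ^ x] have the same
    coefficient sum over the [K]-class of [n]. *)
Lemma nilp_ideal_conj gT (K : {group gT}) (U : {vspace GA F gT}) (n x : gT) :
  p^'.-group K -> nilp_ideal U -> (gspan F K + U = fullv)%VS ->
  n \in K -> (n ^ x)%g \in K -> (n ^ x \in n ^: K)%g.
Proof.
move=> p'K nU defA Kn Knx; have [lU rU _] := nU.
have lUm a u : u \in U -> a * u \in U by move=> Uu; rewrite (subvP lU) // memv_mul ?memvf.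
have rUm a u : u \in U -> u * a \in U by move=> Uu; rewrite (subvP rU) // memv_mul ?memvf.
have KU0 a : a \in gspan F K -> a \in U -> a = 0.
  move=> Ka Ua; apply/eqP; rewrite -memv0 -(@nilp_ideal_cap_gspan _ _ K U _ nU) ?memv_cap ?Ka //.
  by rewrite (pchar_natr_neq0 charFp) -p'natE ?(pcharf_prime charFp).
have /memv_addP[a Ka [u Uu defx]] : ginj F x^-1%g \in (gspan F K + U)%VS by rewrite defA memvf.
have /memv_addP[b Kb [v Uv defxV]] : ginj F x \in (gspan F K + U)%VS by rewrite defA memvf.
have ba1 : b * a = 1.
  apply/eqP; rewrite -subr_eq0; apply/eqP/KU0.
    by rewrite memvB ?gspan_mul ?gspan1.
  have -> : b * a - 1 = (b - ginj F x) * a + ginj F x * (a - ginj F x^-1%g).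
    by rewrite mulrBl mulrBr -ginjM mulgV ginj1 addrA subrK.
  rewrite memvD //; [apply: rUm | apply: lUm].
    by rewrite defxV opprD addrA subrr sub0r memvN.
  by rewrite defx opprD addrA subrr sub0r memvN.
have conjE : ginj F (n ^ x)%g = a * ginj F n * b.
  apply/eqP; rewrite -subr_eq0; apply/eqP/KU0.
    by rewrite memvB ?ginj_gspan // !gspan_mul ?ginj_gspan.
  have -> : ginj F (n ^ x)%g - a * ginj F n * b =
      ginj F x^-1%g * ginj F n * (ginj F x - b) + (ginj F x^-1%g - a) * (ginj F n * b).
    by rewrite mulrBr -!ginjM -mulgA -conjgE mulrBl !mulrA -!ginjM addrA subrK.
  rewrite memvD //; [apply: lUm | apply: rUm].
    by rewrite defxV addrAC subrr add0r.
  by rewrite defx addrAC subrr add0r.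
have : \sum_(h in (n ^: K)%g) (ginj F (n ^ x)%g : GA F gT) h = 1.
  rewrite conjE -mulrA class_sumC // -mulrA ba1 mulr1 (bigD1 n) ?class_refl //=.
  rewrite ginjE eqxx big1 ?addr0 // => h /andP[_ /negPf hn].
  by rewrite ginjE hn.
apply: contraPT => nKx; rewrite big1 => [/esym/eqP|h Kh]; first by rewrite oner_eq0.
by rewrite ginjE; case: eqP => // hnx; rewrite -hnx Kh in nKx.
Qed.

(** By induction [P * N] is normal for every nontrivial normal [N]. For [N = 'O_p(G)] this is [P]
    itself. For [N = 'O_p^'(G)] it remains to see that [P] centralizes [N]. *)
Lemma normal_Sylow gT (K P : {group gT}) (U : {vspace GA F gT}) :
  p_solvable p [set: gT] -> p^'.-group K -> nilp_ideal U ->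
  (gspan F K + U = fullv)%VS -> p.-Sylow([set: gT]) P -> P <| [set: gT].
Proof.
have p_pr := pcharf_prime charFp.
have [m] := ubnP #|gT|; elim: m => // m IHm in gT K P U * => /ltnSE-leGm.
move=> solG p'K nU defA sylP.
have quo (N : {group gT}) : N <| [set: gT] -> N :!=: 1%g -> P <*> N <| [set: gT].
  move=> nsN ntN.
  have defq := setT_quotient nsN.
  have : (P / N)%g <| [set: coset_of N].
    apply: (IHm _ (K / N)%G (P / N)%G (gquo F nsN @: U)%VS).
    - rewrite -cardsT defq (leq_trans _ leGm) // -cardsT ltn_quotient ?normal_sub //.
    - by rewrite defq; apply: p_solvable_quotient.
    - exact: quotient_pgroup.
    - exact: nilp_ideal_img (limg_gquo F nsN) nU.
    - apply/eqP; rewrite eqEsubv subvf -(limg_gquo F nsN) -defA limgD.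
      apply: addvS => //; rewrite limg_span; apply/span_subvP=> _ /mapP[_ /imageP[g Kg ->] ->].
      by rewrite gquo_inj ginj_gspan // mem_quotient.
    by rewrite defq quotient_pHall // (subset_trans _ (normal_norm nsN)) ?subsetT.
  have nNP : P \subset 'N(N) by rewrite (subset_trans _ (normal_norm nsN)) ?subsetT.
  by rewrite defq -cosetpre_normal quotientYK // quotientGK // joingC.
have [N1|ntN] := eqVneq ('O_p^'([set: gT])) 1%g; last first.
  have nsN : 'O_p^'([set: gT])%G <| [set: gT] := pcore_normal _ _.
  have p'N : p^'.-group 'O_p^'([set: gT])%G := pcore_pgroup _ _.
  have := quo _ nsN ntN; move: {ntN}('O_p^'(_))%G nsN p'N => N nsN p'N nsM.
  have nNG g : g \in 'N(N) by rewrite (subsetP (normal_norm nsN)) ?inE.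
  have nNA (X : {set gT}) : X \subset 'N(N) by apply/subsetP=> g _; apply: nNG.
  have pP : p.-group P := pHall_pgroup sylP.
  have sylPM : p.-Sylow(P <*> N) P.
    by apply: pHall_subl sylP; rewrite ?joing_subl ?subsetT.
  have defG1 := Frattini_arg nsM sylPM.
  set R := 'N_[set: gT](P) in defG1; have nsPR : P <| R by rewrite normalSG ?subsetT.
  have hallP : Hall R P.
    exact: pHall_Hall (pHall_subl (normal_sub nsPR) (subsetT R) sylP).
  have /splitsP[L /complP[tiPL defR]] := SchurZassenhaus_split hallP nsPR.
  have sLR : L \subset R by have := mulG_subr P L; rewrite defR.
  have nPL : L \subset 'N(P) by rewrite (subset_trans sLR) ?subsetIr.
  have defG : (N * L * P = [set: gT])%g.
    apply/eqP; rewrite eqEsubset subsetT -{1}defG1 /= norm_joinEl // (normC (nNA P)).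
    by rewrite -!mulgA mulSGid ?(normal_sub nsPR) // (normC nPL) defR subxx.
  have p'L : p^'.-group L.
    have /and3P[_ _] : p.-Sylow(R) P := pHall_subl (normal_sub nsPR) (subsetT R) sylP.
    by rewrite -divgS ?normal_sub // -defR TI_cardMg // mulKn ?cardG_gt0.
  (* [L] is a complement of [P] in its normalizer, so [K1] is a p'-subgroup containing [N], with
     [K1 * P] the whole group. As [K1] is at least as large as [K], comparing dimensions gives
     [F[K1] + U = F[G]] too. *)
  pose K1 := (N <*> L)%G; have defK1 : K1 :=: (N * L)%g by rewrite /K1 /= norm_joinEr.
  have p'K1 : p^'.-group K1.
    rewrite /pgroup defK1 (pnat_dvd (dvdn_cardMg _ _)) // pnatM.
    by apply/andP; split.
  have leK : (#|K| <= #|K1|)%N.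
    rewrite dvdn_leq ?cardG_gt0 //.
    rewrite -(Gauss_dvdl _ (p'nat_coprime p'K pP)).
    rewrite -TI_cardMg ?coprime_TIg ?(p'nat_coprime p'K1 pP) //.
    by rewrite defK1 defG cardSg ?subsetT.
  have defA1 : (gspan F K1 + U = fullv)%VS.
    apply/eqP; rewrite eqEdim subvf -defA (leq_trans (dimv_add_leqif _ _)) //.
    have cap0 : (gspan F K1 :&: U = 0)%VS.
      by apply: nilp_ideal_cap_gspan nU; rewrite (pchar_natr_neq0 charFp) -p'natE.
    by rewrite (dimv_disjoint_sum cap0) leq_add2r !dim_gspan.
  have sNK1 : N \subset K1 := joing_subl _ _.
  have conjK1 n x : n \in N -> (n ^ x \in n ^: K1)%g.
    move=> Nn; apply: (nilp_ideal_conj p'K1 nU defA1); rewrite (subsetP sNK1) //.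
    by rewrite memJ_norm.
  (* [P] permutes the [K1]-class of [n], whose order is prime to [p], so it centralizes some
     [n ^ k]. Writing [k = n1 * l] with [l] in [L], which normalizes [P], it centralizes [n ^ n1]:
     every element of [N] is conjugate in [N] into the centralizer. *)
  have cNP : 'C_N(P) :=: N.
    apply: (@conj_cover_group _ 'C_N(P)%G N); first exact: subsetIl.
    move=> n Nn; have clN : (n ^: K1)%g \subset N.
      by rewrite class_sub_norm.
    have actP : [acts P, on (n ^: K1)%g | 'J].
      apply/subsetP=> x Px; rewrite !inE /=; apply/subsetP=> c Kc; rewrite inE /=.
      have /imsetP[k K1k defc] := Kc; rewrite -(class_eqP Kc).
      by apply: conjK1; apply: subsetP clN _ Kc.
    have : (0 < #|'Fix_((n ^: K1)%g | 'J)(P)|)%N.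
      rewrite lt0n; apply/eqP=> fix0; have := pgroup_fix_mod pP actP.
      rewrite fix0 mod0n => /eqP; rewrite -/(dvdn p _) => p_cl.
      have : (p^').-nat #|(n ^: K1)%g|.
        by rewrite -index_cent1 (pnat_dvd _ p'K1) // dvdn_indexg.
      by rewrite p'natE // p_cl.
    case/card_gt0P=> c /setIP[/imsetP[k K1k ->]]; rewrite afixJ => cPnk.
    move: K1k; rewrite defK1 => /mulsgP[n1 l Nn1 Ll defk]; exists n1 => //.
    rewrite inE groupJ //=; move: cPnk; rewrite defk conjgM => cPnk.
    by rewrite -(memJ_norm _ (subsetP (cent_norm _) l _)) // ?(subsetP nPL).
  have sNR : N \subset R.
    by rewrite subsetI subsetT cents_norm // -cNP subsetIr.
  rewrite /normal subsetT /= -defG mul_subG ?normG // mul_subG //.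
  by rewrite (subset_trans sNR) ?subsetIr.
have [P1|ntP] := eqVneq ('O_p([set: gT])) 1%g.
  have [G1|/(p_solvable_pcore solG)[]] := eqVneq [set: gT] 1%g; try by move/eqP.
  have -> : P :=: [set: gT]; last exact: normal_refl.
  by apply/eqP; rewrite eqEsubset subsetT G1 sub1G.
have := quo _ (pcore_normal p _) ntP; rewrite (joing_idPl _) //.
by apply: pcore_sub_Hall.
Qed.

End NormalSylow.

(** * Isomorphisms, augmentation and the principal block *)

Definition ahom_iso (F : fieldType) (A B : falgType F) (f : 'AHom(A, B)) (f' : 'AHom(B, A)) :=
  cancel f f' /\ cancel f' f.

Section Isomorphisms.
Variable F : fieldType.
Implicit Types A B C : falgType F.

Lemma ahom_of_fun A B (f : A -> B) : linear f -> monoid_morphism f ->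
  {phi : 'AHom(A, B) | phi =1 f}.
Proof.
move=> fL fM.
pose fm := GRing.isSemilinear.Build F A B _ f (GRing.semilinear_linear fL).
pose fL' : {linear A -> B} := HB.pack f fm.
have fA : ahom_in {:A} (linfun fL').
  by apply/ahomP_tmp; split=> [|a b]; rewrite !lfunE /= ?fM.1 ?fM.2.
by exists (AHom fA) => a; rewrite lfunE.
Qed.

Lemma ahom_iso_sym A B (f : 'AHom(A, B)) f' : ahom_iso f f' -> ahom_iso f' f.
Proof. by case. Qed.

Lemma ahom_iso_limg A B (f : 'AHom(A, B)) f' : ahom_iso f f' -> (f @: fullv = fullv)%VS.
Proof.
by case=> _ f'K; apply/vspaceP=> b; rewrite memvf -(f'K b) memv_img ?memvf.
Qed.

Lemma ahom_iso_dim A B (f : 'AHom(A, B)) f' (U : {vspace A}) :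
  ahom_iso f f' -> \dim (f @: U) = \dim U.
Proof.
case=> fK _; apply: limg_dim_eq; apply/eqP; rewrite -subv0.
apply/subvP=> a; rewrite memv_cap memv_ker memv0 => /andP[_ /eqP fa0].
by rewrite -(fK a) fa0 linear0.
Qed.

Lemma galg_iso_ahom (gT hT : finGroupType) (f : {ffun gT -> F} -> {ffun hT -> F}) :
  galg_iso f ->
  exists phi : 'AHom(GA F gT, GA F hT), exists psi, ahom_iso phi psi.
Proof.
case=> -[g fK gK] fL f1 fM.
have scaleE (rT : finGroupType) (k : F) (a : GA F rT) : galg_scale k a = k *: a.
  by apply/ffunP=> x; rewrite [LHS]ffunE galgZE.
have [phi phiE] : {phi : 'AHom(GA F gT, GA F hT) | phi =1 f}.
  apply: ahom_of_fun; first by move=> k a b; rewrite -!scaleE fL.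
  by split=> [|a b]; [apply: f1 | apply: fM].
have [psi psiE] : {psi : 'AHom(GA F hT, GA F gT) | psi =1 g}.
  apply: ahom_of_fun => [k a b|].
    apply: (can_inj fK); rewrite gK.
    by have := fL k (g a) (g b); rewrite !scaleE !gK.
  split=> [|a b]; apply: (can_inj fK); first by rewrite gK f1.
  by rewrite gK; have := fM (g a) (g b); rewrite !gK.
by exists phi, psi; split=> a; rewrite phiE psiE ?fK ?gK.
Qed.

End Isomorphisms.

Section Augmentation.
Variable F : fieldType.
Implicit Types gT hT : finGroupType.

Definition gaug gT : GA F gT -> F^o := gext (fun=> 1 : F^o).

HB.instance Definition _ gT := GRing.Linear.on (@gaug gT).

Lemma gaugE gT (a : GA F gT) : gaug a = \sum_g a g.
Proof. by apply: eq_bigr => g _; rewrite [LHS]mulr1. Qed.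

Lemma gaug_inj gT (g : gT) : gaug (ginj F g) = 1.
Proof. exact: gext_inj. Qed.

Lemma gaug1 gT : gaug (1 : GA F gT) = 1.
Proof. exact: gext1. Qed.

Lemma gaugM gT : {morph @gaug gT : a b / a * b >-> a * b}.
Proof. by apply: gextM => g h; rewrite mulr1. Qed.

(** An isomorphism can change the augmentation, but [l g = gaug (f g)] is a linear character, and
    the automorphism [T1] sending [g] to [l(g)^-1 g] compensates for it. *)
Lemma ahom_iso_augmented gT hT (f : 'AHom(GA F gT, GA F hT)) f' : ahom_iso f f' ->
  exists phi : 'AHom(GA F gT, GA F hT), exists psi,
    ahom_iso phi psi /\ forall a, gaug (phi a) = gaug a.
Proof.
case=> fK f'K; pose l g : F := gaug (f (ginj F g)).
have lM g h : l (g * h)%g = l g * l h by rewrite /l ginjM ahomM gaugM.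
have l1 : l 1%g = 1 by rewrite /l ginj1 ahom1 gaug1.
have lV g : l g * l g^-1%g = 1 by rewrite -lM mulgV.
have lV' g : l g^-1%g * l g = 1 by rewrite -lM mulVg.
pose t1 (g : gT) : GA F gT := l g^-1%g *: ginj F g.
pose t2 (g : gT) : GA F gT := l g *: ginj F g.
have t11 : t1 1%g = 1 by rewrite /t1 invg1 l1 scale1r ginj1.
have t21 : t2 1%g = 1 by rewrite /t2 l1 scale1r ginj1.
have t1M : {morph t1 : g h / (g * h)%g >-> g * h}.
  move=> g h; rewrite /t1 invMg lM ginjM -scalerAl -scalerAr scalerA.
  by congr (_ *: _); rewrite mulrC.
have t2M : {morph t2 : g h / (g * h)%g >-> g * h}.
  by move=> g h; rewrite /t2 lM ginjM -scalerAl -scalerAr scalerA.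
pose T1 := gext_ahom t11 t1M; pose T2 := gext_ahom t21 t2M.
have T12 : cancel T1 T2.
  move=> a; have := @linear_galg_eq F gT _ (T2 \o T1) idfun.
  apply=> g /=; rewrite gext_ahom_inj /t1 linearZ /= gext_ahom_inj /t2.
  by rewrite scalerA lV' scale1r.
have T21 : cancel T2 T1.
  move=> a; have := @linear_galg_eq F gT _ (T1 \o T2) idfun.
  apply=> g /=; rewrite gext_ahom_inj /t2 linearZ /= gext_ahom_inj /t1.
  by rewrite scalerA lV scale1r.
exists (f \o T1)%AF, (T2 \o f')%AF.
split; first by split=> a; rewrite !comp_lfunE /= ?fK ?T12 ?T21 ?f'K.
move=> a; rewrite comp_lfunE.
have := @linear_galg_eq F gT _ (@gaug hT \o (f \o T1)) (@gaug gT); apply=> g /=.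
rewrite gext_ahom_inj /t1 linearZ /= gaug_inj linearZ /=.
by rewrite -[gaug _]/(l g) [LHS]lV'.
Qed.

End Augmentation.

Section PrincipalBlock.
Variables (F : closedFieldType) (p : nat).
Hypothesis charFp : p \in [pchar F].
Implicit Types gT hT : finGroupType.

(** Each orbit contributes its size times a value of [f], and without fixed points all sizes are
    divisible by [p]. *)
Lemma sum_pgroup_act0 gT (Q : {group gT}) (S : {set gT}) (f : gT -> F) :
  p.-group Q -> [acts Q, on S | 'J] -> {in Q & S, forall q y, f (y ^ q)%g = f y} ->
  ('Fix_(S | 'J)(Q) = set0)%g -> \sum_(y in S) f y = 0.
Proof.
move=> pQ actQ fQ fix0.
rewrite (set_partition_big _ (orbit_partition actQ)) /=.
apply: big1 => _ /imsetP[y Sy ->].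
rewrite (eq_bigr (fun=> f y)) => [|_ /imsetP[q Qq ->]]; last by rewrite /= fQ.
rewrite sumr_const -mulr_natr; set n := #|_|.
suff /eqP-> : n%:R == 0 :> F by rewrite mulr0.
rewrite -(dvdn_pcharf charFp).
have pn : p.-nat n by rewrite /n card_orbit (pnat_dvd _ pQ) // dvdn_indexg.
have [[|k] nE] := p_natP pn; last by rewrite nE expnS dvdn_mulr.
have : (y \in 'Fix_(S | 'J)(Q))%g by rewrite inE Sy; apply/orbit1P/card_orbit1.
by rewrite fix0 inE.
Qed.

Lemma gquoE gT (N : {group gT}) (nN : N <| [set: gT]) (a : GA F gT) x :
  gquo F nN a x = \sum_(g | coset N g == x) a g.
Proof.
rewrite gext_ahomE /gext sum_ffunE [RHS]big_mkcond /=; apply: eq_bigr => g _.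
by rewrite galgZE ginjE eq_sym; case: eqP; rewrite ?mulr1 ?mulr0.
Qed.

Lemma gaug_quo gT (N : {group gT}) (nN : N <| [set: gT]) (a : GA F gT) :
  gaug (gquo F nN a) = gaug a.
Proof.
have := @linear_galg_eq F gT _ (@gaug F _ \o gquo F nN) (@gaug F gT); apply=> g /=.
by rewrite gquo_inj !gaug_inj.
Qed.

Lemma central_class gT (z : GA F gT) g x : (forall a, z * a = a * z) ->
  z (x ^ g)%g = z x.
Proof.
move=> cz; have := cz (ginj F g^-1%g) => /ffunP/(_ (g^-1 * x)%g).
rewrite ginj_mulE mul_ginjE !invgK mulKVg => <-.
by rewrite conjgE mulgA.
Qed.

(* A central element is constant on the orbits of [Q := 'O_p(G)] acting by
   conjugation on a coset of [Q]; as ['C_G(Q) \subset Q], the only coset with a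
   fixed point is [Q] itself, so the image of the element in [F[G / Q]] is a
   scalar, while the kernel of [F[G] -> F[G / Q]] is nilpotent. *)
Lemma central_idempotent_eq1 gT (z : GA F gT) :
  p_solvable p [set: gT] -> ('O_p^'([set: gT]) = 1)%g ->
  (forall a, z * a = a * z) -> z * z = z -> gaug z = 1 -> z = 1.
Proof.
move=> solG O1 cz zz z1; pose Q := 'O_p([set: gT])%G.
have nQ : Q <| [set: gT] by apply: pcore_normal.
have pQ : p.-group Q by apply: pcore_pgroup.
have nQG g : g \in 'N(Q) by rewrite (subsetP (normal_norm nQ)) ?inE.
have qz : gquo F nQ z = 1.
  have qz0 x : x != 1%g -> gquo F nQ z x = 0.
    move=> x1; rewrite gquoE.
    rewrite (eq_bigl (mem [set g | coset Q g == x])) => [|g]; last by rewrite !inE.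
    apply: (sum_pgroup_act0 pQ).
    - apply/subsetP=> q Qq; rewrite !inE /=; apply/subsetP=> g; rewrite !inE => /eqP<-.
      by rewrite morphJ //= [coset Q q]coset_id // conjg1.
    - by move=> q g _ _; apply: central_class.
    apply/setP=> g; rewrite afixJ in_set0; apply/negP=> /setIP[].
    rewrite inE => /eqP cgx cQg.
    have := subsetP (p_solvable_cent_pcore solG O1) g.
    rewrite in_setI cQg inE => /(_ isT)/coset_id cg1.
    by rewrite -cgx cg1 eqxx in x1.
  have : gaug (gquo F nQ z) = 1 by rewrite gaug_quo.
  rewrite gaugE (bigD1 1%g) //= big1 ?addr0 => [q1|x /qz0//].
  apply/ffunP=> x; rewrite galg1; case: eqP => [->|/eqP/qz0]; [exact: q1 | by []].
have : 1 - z \in gJ F Q.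
  by apply: (gquo_ker (nN := nQ)); rewrite linearB /= qz ahom1 subrr.
have [_ _ [n Jn]] := gJ_nilp charFp nQ pQ.
move=> /(memv_exp n); rewrite Jn memv0.
have idem k : (1 - z) ^+ k.+1 = 1 - z.
  elim: k => // k IHk; rewrite exprS IHk mulrBl mul1r mulrBr mulr1 zz subrr.
  by rewrite subr0.
case: n {Jn} => [|n]; first by rewrite expr0 oner_eq0.
by rewrite idem subr_eq0 => /eqP.
Qed.

(** For a normal p'-subgroup [N], this is the central idempotent that cuts out of [F[G]] the factor
    [F[G / N]]. *)
Definition gidem gT (N : {group gT}) : GA F gT :=
  #|N|%:R^-1 *: \sum_(n in N) ginj F n.

Section Idempotent.
Variables (gT : finGroupType) (N : {group gT}).
Hypotheses (nN : N <| [set: gT]) (p'N : p^'.-group N).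
Local Notation e := (gidem N).

Let N0 : #|N|%:R != 0 :> F.
Proof. by rewrite (pchar_natr_neq0 charFp) -p'natE ?(pcharf_prime charFp). Qed.

Lemma gidem_mul n : n \in N -> e * ginj F n = e.
Proof.
move=> Nn; rewrite /gidem -scalerAl mulr_suml; congr (_ *: _).
rewrite [RHS](reindex_inj (mulIg n)) /=; apply: eq_big => m; first by rewrite groupMr.
by rewrite ginjM.
Qed.

Lemma gidem_central a : e * a = a * e.
Proof.
suff /subvP/(_ a (memvf a))/cent1vP-> : (fullv <= 'C[e])%VS by [].
rewrite -gspanT; apply: gspan_ind => g _; apply/cent1vP.
rewrite /gidem -scalerAl -scalerAr mulr_suml mulr_sumr; congr (_ *: _).
rewrite (reindex_inj (conjg_inj g)) /=; apply: eq_big => n.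
  by rewrite memJ_norm // (subsetP (normal_norm nN)) ?inE.
by move=> _; rewrite -!ginjM conjgE mulKVg.
Qed.

Lemma gidem_quo : gquo F nN e = 1.
Proof.
rewrite /gidem linearZ /= linear_sum /= (eq_bigr (fun=> 1)) => [|n Nn].
  by rewrite sumr_const -scaler_nat scalerA mulVf ?scale1r.
by rewrite gquo_inj coset_id // ginj1.
Qed.

Lemma gidem_aug : gaug e = 1.
Proof. by rewrite -(gaug_quo nN) gidem_quo gaug1. Qed.

Lemma gidem_ker a : gquo F nN a = 0 -> e * a = 0.
Proof.
move=> /gquo_ker aN; suff : (augv F N * fullv <= lker (amull e))%VS.
  by move/subvP/(_ a aN); rewrite memv_ker lfunE => /eqP.
apply/prodvP=> b c bN _; rewrite memv_ker lfunE /= mulrA.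
suff /subvP/(_ b bN) : (augv F N <= lker (amull e))%VS.
  by rewrite memv_ker lfunE /= => /eqP->; rewrite mul0r.
apply: augv_sub => n Nn; rewrite memv_ker lfunE /= mulrBr mulr1 gidem_mul //.
by rewrite subrr.
Qed.

Lemma gidem_idem : e * e = e.
Proof.
apply/eqP; rewrite -subr_eq0 -[X in _ - X]mulr1 -mulrBr gidem_ker //.
by rewrite linearB /= gidem_quo ahom1 subrr.
Qed.

End Idempotent.

Section Reduction.
Variables gT hT : finGroupType.
Hypotheses (solG : p_solvable p [set: gT]) (solH : p_solvable p [set: hT]).
Let N := 'O_p^'([set: gT])%G.
Let M := 'O_p^'([set: hT])%G.
Let nN : N <| [set: gT]. Proof. exact: pcore_normal. Qed.
Let nM : M <| [set: hT]. Proof. exact: pcore_normal. Qed.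

(** The image of [z] modulo [K] is 1 by [central_idempotent_eq1]. Thus [gidem K] is the least
    central idempotent of augmentation 1, a property that augmented isomorphisms respect. *)
Lemma central_idempotent_pcore kT (z : GA F kT) (K := 'O_p^'([set: kT])%G)
    (nK : K <| [set: kT]) :
  p_solvable p [set: kT] -> (forall a, z * a = a * z) -> z * z = z -> gaug z = 1 ->
  gidem K * z = gidem K.
Proof.
move=> solK cz zz z1; apply/eqP; rewrite -subr_eq0 -[X in _ - X]mulr1 -mulrBr.
apply/eqP/(gidem_ker (nN := nK)); rewrite linearB /= ahom1; apply/eqP; rewrite subr_eq0.
apply/eqP/central_idempotent_eq1.
- by rewrite setT_quotient //; apply: p_solvable_quotient.
- by rewrite setT_quotient //; apply: trivg_pcore_quotient.
- by move=> b; rewrite -(gsecK nK b) -!ahomM cz.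
- by rewrite -ahomM zz.
- by rewrite gaug_quo.
Qed.

Lemma principal_block_iso (f : 'AHom(GA F gT, GA F hT)) f' : ahom_iso f f' ->
  exists phi : 'AHom(GA F (coset_of N), GA F (coset_of M)), exists psi, ahom_iso phi psi.
Proof.
case/ahom_iso_augmented=> {f'}f [f' [[fK f'K] augf]].
have augf' b : gaug (f' b) = gaug b by rewrite -augf f'K.
have p'N : p^'.-group N := pcore_pgroup _ _; have p'M : p^'.-group M := pcore_pgroup _ _.
have fe : f (gidem N) = gidem M.
  have e1 : gidem M * f (gidem N) = gidem M.
    apply: (central_idempotent_pcore nM solH).
    - by move=> b; rewrite -(f'K b) -!ahomM (gidem_central nN).
    - by rewrite -ahomM (gidem_idem nN).
    - by rewrite augf (gidem_aug nN).
  have e2 : gidem N * f' (gidem M) = gidem N.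
    apply: (central_idempotent_pcore nN solG).
    - by move=> a; rewrite -(fK a) -!ahomM (gidem_central nM).
    - by rewrite -ahomM (gidem_idem nM).
    - by rewrite augf' (gidem_aug nM).
  by rewrite -e1 -{1}e2 ahomM f'K (gidem_central nM).
have fe' : f' (gidem M) = gidem N by rewrite -fe fK.
(* The kernel of the projection is killed by the idempotent of [N], which [f] carries to that of
   [M], and the latter projects to 1. *)
have quof a : gquo F nN a = 0 -> gquo F nM (f a) = 0.
  move=> qa0; rewrite -[LHS]mul1r -(gidem_quo nM p'M) -ahomM -fe -ahomM.
  by rewrite (gidem_ker qa0) !linear0.
have quof' b : gquo F nM b = 0 -> gquo F nN (f' b) = 0.
  move=> qb0; rewrite -[LHS]mul1r -(gidem_quo nN p'N) -ahomM -fe' -ahomM.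
  by rewrite (gidem_ker qb0) !linear0.
have lift (kT lT : finGroupType) (K : {group kT}) (L : {group lT})
    (nK : K <| [set: kT]) (nL : L <| [set: lT]) (g : 'AHom(GA F kT, GA F lT)) :
    (forall a, gquo F nK a = 0 -> gquo F nL (g a) = 0) ->
    {phi : 'AHom(GA F (coset_of K), GA F (coset_of L)) |
       forall a, phi (gquo F nK a) = gquo F nL (g a)}.
  move=> gker.
  have eqg a b : gquo F nK a = gquo F nK b -> gquo F nL (g a) = gquo F nL (g b).
    move=> eqab; apply/eqP; rewrite -subr_eq0 -linearB -linearB /= gker //.
    by rewrite linearB /= eqab subrr.
  pose h (b : GA F (coset_of K)) := gquo F nL (g (gsec b)).
  have [phi phiE] : {phi : 'AHom(GA F (coset_of K), GA F (coset_of L)) | phi =1 h}.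
    apply: ahom_of_fun => [k a b|].
      rewrite /h -[in RHS]linearP -[in RHS]linearP /=; apply: eqg.
      by rewrite linearP /= !gsecK.
    split=> [|a b]; rewrite /h.
      rewrite -(ahom1 (gquo F nL)) -(ahom1 g); apply: eqg.
      by rewrite gsecK ahom1.
    by rewrite -!ahomM; apply: eqg; rewrite ahomM !gsecK.
  by exists phi => a; rewrite phiE; apply: eqg; rewrite gsecK.
have [phi phiE] := lift _ _ _ _ nN nM f quof.
have [psi psiE] := lift _ _ _ _ nM nN f' quof'.
exists phi, psi; split=> a.
  by rewrite -(gsecK nN a) phiE psiE fK.
by rewrite -(gsecK nM a) psiE phiE f'K.
Qed.

End Reduction.

End PrincipalBlock.

(** * The filtration by powers of the augmentation ideal *)

Section Restriction.
Variables (F : fieldType) (gT : finGroupType) (P : {group gT}).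
Local Notation A := (GA F gT).
Implicit Types a b : A.

Definition gres a : A := [ffun x => if x \in P then a x else 0].

Lemma gresE a x : gres a x = if x \in P then a x else 0.
Proof. by rewrite ffunE. Qed.

Fact gres_is_linear : linear gres.
Proof.
move=> k a b; apply/ffunP=> x; rewrite !(gresE, galgZE, ffunE).
by case: ifP => _; rewrite ?mulr0 ?addr0 // galgZE gresE ffunE galgZE.
Qed.
HB.instance Definition _ := GRing.isSemilinear.Build F A A _ gres
  (GRing.semilinear_linear gres_is_linear).

Lemma gres_gspan a : gres a \in gspan F P.
Proof. by apply/gspanP=> x; rewrite gresE => /negPf->. Qed.

Lemma gres_id a : a \in gspan F P -> gres a = a.
Proof.
move=> /gspanP a0; apply/ffunP=> x; rewrite gresE.
by case: ifPn => // /a0.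
Qed.

Lemma gresMl b a : b \in gspan F P -> gres (b * a) = b * gres a.
Proof.
move=> Pb; apply/ffunP=> x; rewrite gresE !galgM.
case: ifP => Px; last rewrite big1 // => y _.
  apply: eq_bigr => y _; have [Py|/(gspanP _ _ Pb)->] := boolP (y \in P); last by rewrite !mul0r.
  by rewrite gresE groupM ?groupV.
have [Py|/(gspanP _ _ Pb)->] := boolP (y \in P); last by rewrite mul0r.
by rewrite gresE groupMl ?groupV // Px mulr0.
Qed.

Lemma gresJ g a : P <| [set: gT] -> gres (ginj F g^-1%g * a * ginj F g) =
  ginj F g^-1%g * gres a * ginj F g.
Proof.
move=> nP; apply/ffunP=> x; rewrite gresE !mul_ginjE !ginj_mulE invgK gresE.
have -> : ((g * (x * g^-1))%g \in P) = (x \in P); last by [].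
have := memJ_norm x (subsetP (normal_norm nP) g^-1%g (in_setT _)).
by rewrite conjgE invgK.
Qed.

Variable K : {group gT}.
Hypotheses (defG : (P * K)%g = [set: gT]) (tiPK : (P :&: K = 1)%g).

Lemma coset_factor x : exists k, [/\ k \in K, (x * k^-1)%g \in P &
  forall l, l \in K -> (x * l^-1)%g \in P -> l = k].
Proof.
have : x \in (P * K)%g by rewrite defG inE.
case/mulsgP=> u k Pu Kk ->; exists k; split=> // [|l Kl]; first by rewrite mulgK.
rewrite -mulgA groupMl // => Pkl; apply/esym/eqP; rewrite eq_mulgV1 -in_set1.
have : (k * l^-1)%g \in P :&: K by rewrite inE Pkl groupM ?groupV.
by rewrite tiPK.
Qed.

Lemma gres_decomp a : a = \sum_(k in K) gres (a * ginj F k^-1%g) * ginj F k.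
Proof.
apply/ffunP=> x; rewrite sum_ffunE; have [k [Kk Pxk uk]] := coset_factor x.
rewrite (bigD1 k) //= big1 => [|l /andP[Kl lk]].
  by rewrite addr0 mul_ginjE gresE Pxk mul_ginjE invgK mulgKV.
rewrite mul_ginjE gresE; case: ifP => // Pxl.
by rewrite (uk l Kl Pxl) eqxx in lk.
Qed.

End Restriction.

Section AugmentationFiltration.
Variables (F : fieldType) (gT : finGroupType) (P : {group gT}).
Local Notation A := (GA F gT).
Implicit Types a b : A.

(** The factor [gspan F P] only matters for [n = 0], where it gives [F[P]] instead of the
    scalars. *)
Definition Iaug n : {vspace A} := (augv F P ^+ n * gspan F P)%VS.
Definition Jaug n : {vspace A} := (augv F P ^+ n * fullv)%VS.

Lemma Iaug0 : Iaug 0 = gspan F P.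
Proof. by rewrite /Iaug expv0 prod1v. Qed.

Lemma Iaug_S n : Iaug n.+1 = (augv F P ^+ n.+1)%VS.
Proof.
apply: subv_anti; apply/andP; split.
  by rewrite /Iaug expvSr -prodvA prodvSr // augvMr.
apply/subvP=> a Ia; rewrite -[a]mulr1 memv_mul ?gspan1 //.
Qed.

Lemma Iaug1 : Iaug 1 = augv F P. Proof. by rewrite Iaug_S expv1. Qed.

Lemma gspanIaug n : (gspan F P * Iaug n <= Iaug n)%VS.
Proof.
rewrite /Iaug prodvA (subv_trans (prodvSl _ (expv_normal n (augv_normal F (normG P))))) //.
by rewrite -prodvA gspan_id.
Qed.

Lemma Iaug_prod m n : (Iaug m * Iaug n <= Iaug (m + n))%VS.
Proof.
by rewrite /Iaug expvD -!prodvA prodvSr // gspanIaug.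
Qed.

Lemma mem_IaugM m n a b : a \in Iaug m -> b \in Iaug n -> a * b \in Iaug (m + n).
Proof. by move=> Ia Ib; apply: subvP (Iaug_prod m n) _ _; rewrite memv_mul. Qed.

Lemma Iaug_gspan n : (Iaug n <= gspan F P)%VS.
Proof.
case: n => [|n]; first by rewrite Iaug0.
rewrite Iaug_S; elim: n => [|n IHn]; first by rewrite expv1 augv_gspan.
by rewrite expvSl -[gspan F P]gspan_id prodvS // augv_gspan.
Qed.

Lemma Iaug_le n : (Iaug n.+1 <= Iaug n)%VS.
Proof.
rewrite {1}/Iaug expvSr -prodvA prodvSr // (subv_trans (augvMr F P)) //.
exact: augv_gspan.
Qed.

Lemma Iaug_mono m n : (m <= n)%N -> (Iaug n <= Iaug m)%VS.
Proof.
move=> /subnK <-; elim: (n - m)%N => [|k IHk]; first exact: subvv.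
by rewrite addSn (subv_trans (Iaug_le _)).
Qed.

Lemma Jaug0 : Jaug 0 = fullv. Proof. by rewrite /Jaug expv0 prod1v. Qed.

Lemma Jaug1 : Jaug 1 = gJ F P. Proof. by rewrite /Jaug expv1. Qed.

Lemma mem_IaugJ n a b : a \in Iaug n -> a * b \in Jaug n.
Proof.
move=> Ia; have : a * b \in (Iaug n * fullv)%VS by rewrite memv_mul ?memvf.
by apply: subvP; rewrite /Iaug -prodvA prodvSr // subvf.
Qed.

Lemma Iaug_Jaug n a : a \in Iaug n -> a \in Jaug n.
Proof. by move=> Ia; rewrite -[a]mulr1 mem_IaugJ. Qed.

Lemma mem_JaugMr n a b : a \in Jaug n -> a * b \in Jaug n.
Proof.
move=> Ja; have : a * b \in (Jaug n * fullv)%VS by rewrite memv_mul ?memvf.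
by apply: subvP; rewrite /Jaug -prodvA prodvSr // subvf.
Qed.

Lemma Jaug_gres n a : a \in Jaug n -> gres P a \in Iaug n.
Proof.
move=> Ja; suff : (Jaug n <= linfun (gres P) @^-1: Iaug n)%VS.
  by move/subvP/(_ a Ja); rewrite -memv_preim lfunE.
apply/prodvP=> b c Ib _; rewrite -memv_preim lfunE /= gresMl.
  by rewrite memv_mul ?gres_gspan.
apply: subvP (Iaug_gspan n) _ _; rewrite -[b]mulr1.
by rewrite memv_mul ?gspan1.
Qed.

Section Normal.
Hypothesis nP : P <| [set: gT].

Lemma mem_JaugMl n a b : a \in Jaug n -> b * a \in Jaug n.
Proof.
move=> Ja; have : b * a \in (fullv * Jaug n)%VS by rewrite memv_mul ?memvf.
apply: subvP; rewrite /Jaug prodvA (subv_trans (prodvSl _ (expv_normal n (fullv_augv F nP)))) //.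
by rewrite -prodvA prodvSr // subvf.
Qed.

Lemma Jaug_exp n : Jaug n.+1 = (gJ F P ^+ n.+1)%VS.
Proof. by rewrite gJ_exp. Qed.

End Normal.

(** By [gres_decomp], [Jaug n] is the direct sum of the translates of [Iaug n] by the elements of
    [K], which are units. *)
Lemma dim_Jaug (K : {group gT}) n : (P * K)%g = [set: gT] -> (P :&: K = 1)%g ->
  \dim (Jaug n) = (#|K| * \dim (Iaug n))%N.
Proof.
move=> defG tiPK.
have uK k : ginj F k \is a GRing.unit.
  by apply/unitrP; exists (ginj F k^-1%g); rewrite -!ginjM mulgV mulVg ginj1.
have -> : Jaug n = (\sum_(k in K) Iaug n * <[ginj F k]>%VS)%VS.
  apply: subv_anti; apply/andP; split.
    apply/subvP=> a Ja; rewrite [a](gres_decomp defG tiPK) memv_sumr // => k Kk.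
    by rewrite memv_mul ?memv_line // Jaug_gres // mem_JaugMr.
  apply/subv_sumP=> k Kk; apply/prodvP=> a b Ia _; exact: mem_IaugJ.
have dxJ : directv (\sum_(k in K) Iaug n * <[ginj F k]>%VS).
  apply/directv_sum_independent=> us Uus us0 k Kk; apply/ffunP=> x; rewrite [RHS]ffunE.
  have us_coset l : l \in K -> (x * l^-1)%g \notin P -> us l x = 0.
    move=> Kl Pxl; have [a Ia ->] : exists2 a, a \in Iaug n & us l = a * ginj F l.
      have := Uus l Kl; rewrite -limg_amulr => /memv_imgP[a Ia ->].
      by exists a => //; rewrite lfunE.
    rewrite mul_ginjE; exact: (gspanP _ _ (subvP (Iaug_gspan n) _ Ia)).
  have [Pxk|/us_coset->//] := boolP ((x * k^-1)%g \in P).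
  have := us0 => /ffunP/(_ x); rewrite sum_ffunE (bigD1 k) //= big1 ?addr0 => [->|l /andP[Kl lk]].
    by rewrite ffunE.
  apply: us_coset => //; apply: contra lk => Pxl.
  by have [k' [_ _ uk]] := coset_factor defG tiPK x; rewrite (uk l Kl Pxl) (uk k Kk Pxk).
rewrite (directvP dxJ) /= (eq_bigr (fun=> \dim (Iaug n))) => [|k _].
  by rewrite sum_nat_const.
exact: dim_cosetv_unit (uK _ k).
Qed.

End AugmentationFiltration.

(** * Monomial basis of the group algebra of an abelian p-group *)

Section JenningsBasis.
Variables (F : fieldType) (p : nat) (gT : finGroupType).
Hypothesis charFp : p \in [pchar F].
Variables (P : {group gT}) (r : nat) (x : 'I_r -> gT).
Hypotheses (pP : p.-group P) (abP : abelian P).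
Hypothesis (defP : (\big[dprod/1]_(i < r) <[x i]> = P)%g).
Local Notation A := (GA F gT).
Local Notation expo := {ffun 'I_r -> 'I_(#|gT|.+1)}.
Implicit Types (a b : A) (m : expo).

Definition jvar i : A := ginj F (x i) - 1.
Definition jmon (e : 'I_r -> nat) : A := \prod_(i < r) jvar i ^+ e i.
(** The bound in [expo] only makes exponent vectors a finite type, with room to raise an admissible
    exponent by one; the meaningful bounds are the orders of the generators. *)
Definition jadm : {set expo} := [set m : expo | [forall i, m i < #[x i]%g]%N].
Definition jdeg (m : expo) : nat := (\sum_i m i)%N.

Lemma jgen_in i : x i \in P.
Proof.
by rewrite -(bigdprodWY defP) mem_gen //; apply/bigcupP; exists i; rewrite ?cycle_id.
Qed.

Let commX i j k l : GRing.comm (jvar i ^+ k) (jvar j ^+ l).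
Proof.
apply: commrX; apply/commr_sym/commrX; apply: commrB; last exact: commr1.
apply/commr_sym/commrB; last exact: commr1.
by rewrite /GRing.comm -!ginjM (centsP abP) ?jgen_in.
Qed.

Lemma jmonD (e f : 'I_r -> nat) : jmon e * jmon f = jmon (fun i => e i + f i)%N.
Proof.
rewrite -prodrM_comm => [|i j _ _]; last exact: commX.
by apply: eq_bigr => i _; rewrite exprD.
Qed.

Lemma jmon_var i : jvar i = jmon (fun j => (j == i)%N).
Proof.
rewrite /jmon (eq_bigr (fun j => if j == i then jvar j else 1)) => [|j _].
  by rewrite -big_mkcond big_pred1_eq.
by case: (j == i).
Qed.

Lemma jvar_order i k : (#[x i]%g <= k)%N -> jvar i ^+ k = 0.
Proof.
move=> /subnK <-; rewrite exprD; have : p.-nat #[x i]%g.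
  by rewrite -[#[_]%g]/#|<[x i]>%g| (pnat_dvd _ pP) // cardSg ?cycle_subG ?jgen_in.
case/p_natP=> c defq; suff defX : jvar i ^+ (p ^ c) = ginj F (x i ^+ (p ^ c) : gT)%g - 1.
  by rewrite defq defX -defq expg_order ginj1 subrr mulr0.
elim: c {defq} => [|c IHc]; first by rewrite expn0 expr1 expg1.
by rewrite expnSr exprM IHc (ginj_subX_pchar charFp) expgM.
Qed.

Lemma jmon_Iaug e : jmon e \in Iaug F P (\sum_i e i).
Proof.
rewrite /jmon; elim: (index_enum _) => [|i s IHs]; first by rewrite !big_nil Iaug0 gspan1.
rewrite !big_cons mem_IaugM //.
elim: (e i) => [|k IHk]; first by rewrite expr0 Iaug0 gspan1.
by rewrite exprS -addn1 addnC mem_IaugM // Iaug1 mem_augv ?jgen_in.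
Qed.

Lemma jmon0 e i : (#[x i]%g <= e i)%N -> jmon e = 0.
Proof.
move=> lt_e; pose e1 j := ((j != i) * e j)%N; pose e2 j := ((j == i) * e i)%N.
have -> : jmon e = jmon e1 * jmon e2.
  rewrite jmonD; apply: eq_bigr => j _; rewrite /e1 /e2.
  by case: eqP => [->|_]; rewrite ?mul1n ?addn0.
have -> : jmon e2 = jvar i ^+ e i.
  rewrite /jmon (eq_bigr (fun j => if j == i then jvar j ^+ e j else 1)) => [|j _].
    by rewrite -big_mkcond big_pred1_eq.
  by rewrite /e2; case: eqP => [->|_]; rewrite ?mul1n.
by rewrite jvar_order ?mulr0.
Qed.

Definition jspan n : {vspace A} :=
  <<[seq jmon (fun i => m i) | m : expo in [set m in jadm | n <= jdeg m]%N]>>%VS.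

Lemma jmon_jspan n (e : 'I_r -> nat) : (n <= \sum_i e i)%N -> jmon e \in jspan n.
Proof.
move=> len; have [/forallP lt_e|] := boolP [forall i, e i < #[x i]%g]%N; last first.
  by case/forallPn=> i; rewrite -leqNgt => /jmon0->; rewrite mem0v.
pose m : expo := [ffun i => inord (e i)].
have mE i : m i = e i :> nat.
  rewrite ffunE inordK // ltnS ltnW // (leq_trans (lt_e i)) //.
  by rewrite -[#[_]%g]/#|<[x i]>%g| max_card.
have -> : jmon e = jmon (fun i => m i) by apply: eq_bigr => i _; rewrite mE.
apply: memv_span; apply/imageP; exists m => //; rewrite !inE.
apply/andP; split; first by apply/forallP=> i; rewrite mE.
by rewrite /jdeg (eq_bigr e).
Qed.

Lemma jspan_var n i : (jspan n * <[jvar i]> <= jspan n.+1)%VS.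
Proof.
apply/prodvP=> a _ + /vlineP[k ->]; rewrite -scalerAr => Ta; apply: memvZ.
suff : (jspan n <= amulr (jvar i) @^-1: jspan n.+1)%VS.
  by move/subvP/(_ a Ta); rewrite -memv_preim lfunE.
apply/span_subvP=> _ /imageP[m Tm ->]; rewrite -memv_preim lfunE /= jmon_var jmonD.
apply: jmon_jspan; rewrite big_split /=.
have -> : (\sum_(j < r) (j == i) = 1)%N by rewrite (bigD1 i) //= eqxx big1 // => j /negPf->.
by rewrite addn1 ltnS; move: Tm; rewrite !inE => /andP[].
Qed.

Lemma jspan_le n : (jspan n.+1 <= jspan n)%VS.
Proof.
apply/span_subvP=> _ /imageP[m Tm ->]; apply: jmon_jspan.
by move: Tm; rewrite !inE => /andP[_ /ltnW].
Qed.

(* Both the elements of [P] that multiply every [jspan n] into itself, and those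
   [g] for which [g - 1] multiplies every [jspan n] into [jspan n.+1], form a
   subgroup; it contains the generators [x i]. *)
Lemma jspan_augv n : (jspan n * augv F P <= jspan n.+1)%VS.
Proof.
have comm_sub1 (g h : gT) : ginj F (g * h)%g - 1 =
    (ginj F g - 1) * (ginj F h - 1) + (ginj F g - 1) + (ginj F h - 1).
  by rewrite ginjM mulrBl mul1r mulrBr mulr1 addrAC subrK addrA subrK.
have ind (g : gT) : g \in P -> forall k a, a \in jspan k -> a * (ginj F g - 1) \in jspan k.+1.
  rewrite -(bigdprodW defP) => /prodsgP[c Cc ->].
  elim: (index_enum _) => [|i s IHs] k a Ta; first by rewrite big_nil ginj1 subrr mulr0 mem0v.
  rewrite big_cons; set h := (\prod_(j <- s) c j)%g.
  have xi l b : b \in jspan l -> b * (ginj F (c i) - 1) \in jspan l.+1.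
    move: l b; have /cycleP[e ->] := Cc i isT; elim: e => [|e IHe] l b Tb.
      by rewrite expg0 ginj1 subrr mulr0 mem0v.
    have Tb1 : b * jvar i \in jspan l.+1.
      by rewrite (subvP (jspan_var l i)) // memv_mul ?memv_line.
    rewrite expgS comm_sub1 2!mulrDr !memvD //; last exact: IHe.
    by rewrite mulrA (subvP (jspan_le _)) // IHe.
  rewrite comm_sub1 2!mulrDr !memvD ?IHs ?xi // mulrA (subvP (jspan_le _)) //.
  by rewrite IHs // xi.
apply/prodvP=> a b Ta Pb.
suff : (augv F P <= amull a @^-1: jspan n.+1)%VS.
  by move/subvP/(_ b Pb); rewrite -memv_preim lfunE.
by apply: augv_sub => g Pg; rewrite -memv_preim lfunE /= ind.
Qed.

Lemma Iaug_jspan n : Iaug F P n = jspan n.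
Proof.
apply: subv_anti; apply/andP; split; last first.
  apply/span_subvP=> _ /imageP[m Tm ->]; apply: subvP (jmon_Iaug _).
  by apply: Iaug_mono; move: Tm; rewrite !inE => /andP[].
have T0 : (1 : A) \in jspan 0.
  have -> : (1 : A) = jmon (fun=> 0%N) by rewrite /jmon big1.
  by apply: jmon_jspan.
elim: n => [|n IHn].
  rewrite Iaug0 gspan_augv subv_add -memvE T0 /= -[augv F P]prod1v.
  apply: subv_trans (jspan_le 0); apply: subv_trans (jspan_augv 0).
  by apply: prodvSl; rewrite -memvE.
apply: subv_trans (jspan_augv n).
apply: subv_trans (prodvSl _ IHn).
case: n {IHn} => [|n].
  by rewrite Iaug1 Iaug0 -{1}[augv F P]prod1v prodvSl // -memvE gspan1.
by rewrite Iaug_S expvSr -Iaug_S.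
Qed.

Lemma jdeg0 : [set m in jadm | 0 <= jdeg m]%N = jadm.
Proof. by apply/setP=> m; rewrite !inE andbT. Qed.

Lemma card_jadm : #|jadm| = #|P|.
Proof.
pose Q (i : 'I_r) := [pred k : 'I_(#|gT|.+1) | k < #[x i]%g]%N.
have -> : #|jadm| = #|(family Q : simpl_pred expo)|.
  apply: eq_card => m; rewrite !inE; apply: eq_forallb => i.
  by rewrite inE.
rewrite card_family foldrE big_map big_enum -(bigdprod_card defP) /=.
apply: eq_bigr => i _; rewrite -sum1_card.
rewrite -(big_ord_widen #|gT|.+1 (fun=> 1%N)); last first.
  by rewrite ltnW // ltnS max_card.
by rewrite sum1_card card_ord.
Qed.

Local Notation jbasis := [seq jmon (fun i => m i) | m : expo in jadm].

Lemma jspan0 : <<jbasis>>%VS = gspan F P.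
Proof. by rewrite -Iaug0 Iaug_jspan /jspan jdeg0. Qed.

Lemma jbasis_free : free jbasis.
Proof. by rewrite /free jspan0 dim_gspan size_image card_jadm. Qed.

(** Spanning gives one inequality. For the other, the admissible monomials of degree below [n]
    complete [Iaug F P n] to the whole of [F[P]], and the two counts add up to [#|P|]. *)
Lemma dim_Iaug n : \dim (Iaug F P n) = #|[set m in jadm | n <= jdeg m]%N|.
Proof.
set S := [set m in jadm | _]; pose S' := jadm :\: S.
have sS : S \subset jadm by apply/subsetP=> m; rewrite inE => /andP[].
apply/eqP; rewrite eqn_leq Iaug_jspan; apply/andP; split.
  by rewrite (leq_trans (dim_span _)) // size_image.
have cS : (#|S| + #|S'|)%N = #|jadm| by rewrite -(cardsID S jadm) (setIidPr sS).
rewrite -(leq_add2r #|S'|) cS card_jadm -(dim_gspan F) -jspan0.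
pose T' : {vspace A} := <<[seq jmon (fun i => m i) | m : expo in S']>>%VS.
have sT : (<<jbasis>> <= jspan n + T')%VS.
  apply/span_subvP=> _ /imageP[m jm ->]; have [Sm|S'm] := boolP (m \in S).
    by rewrite (subvP (addvSl _ _)) // memv_span //; apply/imageP; exists m.
  rewrite (subvP (addvSr _ _)) // memv_span //; apply/imageP; exists m => //.
  by rewrite inE S'm.
rewrite (leq_trans (dimvS sT)) // (leq_trans (dimv_add_leqif _ _)) // leq_add2l.
by rewrite (leq_trans (dim_span _)) // size_image.
Qed.

Lemma jdual m : m \in jadm -> exists f : {linear A -> F^o},
  forall m', m' \in jadm -> f (jmon (fun i => m' i)) = (m == m')%:R.
Proof.
move=> jm; pose B := image_tuple (fun m : expo => jmon (fun i => m i)) (mem jadm).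
exists (coord B (enum_rank_in jm m)) => m' jm'.
have -> : jmon (fun i => m' i) = B`_(enum_rank_in jm m').
  by rewrite nth_image enum_rankK_in.
rewrite /= coord_free ?jbasis_free // eq_sym; congr (nat_of_bool _)%:R.
apply/eqP/eqP=> [/(congr1 enum_val)|mm']; last by congr enum_rank_in.
by rewrite !enum_rankK_in.
Qed.

Lemma jspan_sum n a : a \in jspan n -> exists c : expo -> F,
  a = \sum_(m in [set m in jadm | n <= jdeg m]%N) c m *: jmon (fun i => m i).
Proof.
set S := [set m in jadm | _] => Ta.
have [S0|[m0 Sm0]] := set_0Vmem S.
  exists (fun=> 0); rewrite S0 big_set0.
  apply/eqP; rewrite -memv0; apply: subvP Ta; apply/span_subvP=> w /imageP[m].
  by rewrite -/S S0 inE.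
pose B := image_tuple (fun m : expo => jmon (fun i => m i)) (mem S).
exists (fun m => coord B (enum_rank_in Sm0 m) a).
rewrite big_enum_val /= {1}[a](coord_span (X := B) Ta); apply: eq_bigr => i _.
by rewrite enum_valK_in nth_image.
Qed.

(** Multiplication by [jvar i] sends a monomial either to zero or to an admissible monomial one
    degree higher, injectively in the second case. So the hypothesis forbids the second case for
    monomials of degree [n] in [a], and [z] is the part of degree [n] whose exponents at [S] are
    maximal. *)
Lemma jvar_socle (S : {set 'I_r}) n a : a \in Iaug F P n ->
  (forall i, i \in S -> a * jvar i \in Iaug F P n.+2) ->
  exists z, [/\ z \in Iaug F P n, forall i, i \in S -> z * jvar i = 0 &
                a - z \in Iaug F P n.+1].
Proof.
rewrite Iaug_jspan => /jspan_sum[c ->]; set D := [set m in jadm | _] => aX.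
have mulX m i : jmon (fun i => m i) * jvar i = jmon (fun j => m j + (j == i))%N.
  by rewrite jmon_var jmonD.
have c0 m i : m \in D -> jdeg m = n -> i \in S -> ((m i).+1 < #[x i]%g)%N -> c m = 0.
  move=> Dm dm Si lti.
  (* The functional dual to the monomial [sh m] reads [c m] off [a * jvar i], and vanishes on
     [Iaug F P n.+2] because [sh m] has degree [n.+1]. *)
  pose sh (m : expo) : expo := [ffun j => inord (m j + (j == i))%N].
  have shE (l : expo) j : l \in jadm -> sh l j = (l j + (j == i))%N :> nat.
    rewrite inE => /forallP/(_ j) lj; rewrite ffunE inordK // ltnS.
    have lej : (l j < #|gT|)%N by rewrite (leq_trans lj) // max_card.
    by case: (j == i); rewrite ?addn1 // addn0 ltnW.
  have [jm _] : m \in jadm /\ (n <= jdeg m)%N by move: Dm; rewrite inE => /andP.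
  have shm : sh m \in jadm.
    rewrite inE; apply/forallP=> j; rewrite shE //; case: eqP => [->|_].
      by rewrite addn1.
    by rewrite addn0; move: jm; rewrite inE => /forallP.
  have [f fE] := jdual shm.
  have := aX i Si; rewrite Iaug_jspan => /jspan_sum[d].
  move/(congr1 f); rewrite mulr_suml !linear_sum /=.
  rewrite (bigD1 m) //= [X in _ + X]big1 => [|l /andP[Dl lm]]; last first.
    rewrite -scalerAl mulX linearZ /=; apply/eqP; rewrite scaler_eq0; apply/orP; right.
    have jl : l \in jadm by move: Dl; rewrite inE => /andP[].
    have [lei|lti'] := leqP #[x i]%g (l i).+1.
      by rewrite (jmon0 (i := i)) ?linear0 // eqxx addn1.
    have shl : sh l \in jadm.
      rewrite inE; apply/forallP=> j; rewrite shE //; case: eqP => [->|_].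
        by rewrite addn1.
      by rewrite addn0; move: jl; rewrite inE => /forallP.
    have -> : jmon (fun j => l j + (j == i))%N = jmon (fun j => sh l j).
      by apply: eq_bigr => j _; rewrite shE.
    rewrite fE //; have [eqsh|_] := eqVneq (sh m) (sh l); last exact: eqxx.
    case/eqP: lm.
    apply/ffunP=> j; apply/val_inj => /=.
    by have /= := congr1 (fun h : expo => val (h j)) eqsh; rewrite !shE // => /addIn.
  rewrite [RHS]big1 => [|l]; last first.
    rewrite inE => /andP[jl dl]; rewrite linearZ /= fE //.
    have [shl|_] := eqVneq (sh m) l; last by rewrite scaler0.
    move: dl; rewrite -shl /jdeg (eq_bigr (fun j => m j + (j == i))%N) => [|j _]; last by rewrite shE.
    rewrite big_split /= -/(jdeg m) dm (bigD1 i) //= eqxx big1 => [|j /negPf->//].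
    by rewrite addn0 addn1 ltnn.
  rewrite -scalerAl mulX linearZ /= addr0.
  have -> : jmon (fun j => m j + (j == i))%N = jmon (fun j => sh m j).
    by apply: eq_bigr => j _; rewrite shE.
  by rewrite fE // eqxx [_ *: _]mulr1.
pose soc m := (jdeg m == n) && [forall i in S, (#[x i]%g <= (m i).+1)%N].
exists (\sum_(m in D | soc m) c m *: jmon (fun i => m i)); split.
- apply: memv_suml => m /andP[Dm _]; apply: memvZ; apply: jmon_jspan.
  by move: Dm; rewrite inE => /andP[].
- move=> i Si; rewrite mulr_suml big1 // => m /andP[_ /andP[_ /forall_inP lem]].
  by rewrite -scalerAl mulX (jmon0 (i := i)) ?scaler0 // eqxx addn1 lem.
rewrite [X in X - _](bigID soc) /= addrAC subrr add0r Iaug_jspan; apply: memv_suml => m /andP[Dm].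
rewrite negb_and => /orP[dm|].
  apply/memvZ/jmon_jspan; rewrite ltn_neqAle eq_sym dm /=.
  by move: Dm; rewrite inE => /andP[].
have [dm|dm _] := eqVneq (jdeg m) n; last first.
  apply/memvZ/jmon_jspan; rewrite ltn_neqAle eq_sym dm /=.
  by move: Dm; rewrite inE => /andP[].
case/forall_inPn=> i Si; rewrite -ltnNge => lti.
by rewrite (c0 m i) // scale0r mem0v.
Qed.

Lemma coef_jdeg n :
  (\prod_(i < r) \sum_(k < #[x i]%g) 'X^k : {poly int})`_n =
  (#|[set m in jadm | jdeg m == n]|)%:R.
Proof.
pose Q (i : 'I_r) := [pred k : 'I_(#|gT|.+1) | k < #[x i]%g]%N.
have -> : \prod_(i < r) \sum_(k < #[x i]%g) 'X^k =
    \prod_(i < r) \sum_(k : 'I_(#|gT|.+1) | Q i k) 'X^k :> {poly int}.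
  apply: eq_bigr => i _; rewrite (big_ord_widen #|gT|.+1 (fun k => 'X^k)) //.
  by rewrite ltnW // ltnS max_card.
rewrite bigA_distr_big_dep /= coef_sum -[X in _ = X%:R]sum1_card natr_sum.
rewrite [RHS]big_mkcond [LHS]big_mkcond /=; apply: eq_bigr => m _.
have -> : (m \in family Q) = (m \in jadm).
  by rewrite !inE; apply: eq_forallb => i; rewrite inE.
rewrite [in RHS]inE; case: (m \in jadm) => //=.
by rewrite prodrXr coefXn -/(jdeg m) eq_sym; case: (jdeg m == n).
Qed.

End JenningsBasis.

(** * Lifting central elements along the filtration *)

Lemma coprime_abelian_cent_dprod (gT : finGroupType) (A P : {group gT}) :
  A \subset 'N(P) -> coprime #|P| #|A| -> abelian P ->
  ([~: P, A] \x 'C_P(A) = P)%g.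
Proof.
move=> nPA coPA abP; have sDP : [~: P, A]%g \subset P by rewrite commg_subl.
have nDA : A \subset 'N([~: P, A]) by rewrite commg_normr.
have nDP : P \subset 'N([~: P, A]) by rewrite commg_norml.
rewrite dprodE.
- apply/eqP; rewrite eqEsubset mul_subG ?subsetIl //= -quotientSK //.
  rewrite (coprime_quotient_cent sDP nDA coPA (abelian_sol abP)).
  by rewrite subsetI subxx quotient_cents2r.
- by rewrite (subset_trans _ (subset_trans abP (centS sDP))) ?subsetIl.
- by rewrite setIA (setIidPl sDP) coprime_abel_cent_TI.
Qed.

Section LiftingCentralElements.
Variables (F : fieldType) (p : nat) (gT : finGroupType).
Hypothesis charFp : p \in [pchar F].
Variables (P K : {group gT}).
Hypotheses (nP : P <| [set: gT]) (pP : p.-group P) (p'K : p^'.-group K).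
Hypotheses (defG : (P * K)%g = [set: gT]) (tiPK : (P :&: K = 1)%g).
Local Notation A := (GA F gT).
Local Notation J := (Jaug F P).
Local Notation I := (Iaug F P).
Implicit Types (a b z : A).

(** The first condition lets one average over [K] without changing [a] modulo [J n.+1]; the second,
    one degree deeper, bears on the commutators with the augmentation ideal of [P]. *)
Definition lifts_center := forall n a, a \in J n ->
  (forall b, a * b - b * a \in J n.+1) ->
  (forall b, b \in J 1 -> a * b - b * a \in J n.+2) ->
  exists z, [/\ z \in J n, forall b, z * b = b * z & a - z \in J n.+1].

Let K0 : #|K|%:R != 0 :> F.
Proof.
by rewrite -(dvdn_pcharf charFp) -p'natE ?(pcharf_prime charFp).
Qed.

Lemma central_galg z : (forall g, g \in P -> z * ginj F g = ginj F g * z) ->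
  (forall k, k \in K -> z * ginj F k = ginj F k * z) -> forall b, z * b = b * z.
Proof.
move=> zP zK b; suff /subvP/(_ b (memvf b))/cent1vP-> : (fullv <= 'C[z])%VS by [].
rewrite -gspanT; apply: gspan_ind => g _; apply/cent1vP.
have : g \in (P * K)%g by rewrite defG inE.
by case/mulsgP=> u k Pu Kk ->; rewrite ginjM -mulrA -zK // mulrA -zP // mulrA.
Qed.

Section AbelianNormal.
Hypothesis abP : abelian P.

Lemma gres_mulr a b : b \in gspan F P -> gres P (a * b) = gres P a * b.
Proof.
move=> Pb; apply/ffunP=> x; rewrite gresE !galgM.
case: ifP => Px; last rewrite big1 // => y _.
  apply: eq_bigr => y _;
  have [Pyx|/(gspanP _ _ Pb)->] := boolP ((y^-1 * x)%g \in P); last by rewrite !mulr0.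
  by rewrite gresE; rewrite groupMr // groupV in Pyx; rewrite Pyx.
have [Pyx|/(gspanP _ _ Pb)->] := boolP ((y^-1 * x)%g \in P); last by rewrite mulr0.
rewrite gresE; case: ifP => Py; last by rewrite mul0r.
by rewrite groupMl ?groupV // Px in Pyx.
Qed.

Lemma gspan_comm a b : a \in gspan F P -> b \in gspan F P -> a * b = b * a.
Proof.
move=> Pa Pb; suff /subvP/(_ a Pa)/centvP : (gspan F P <= 'C(gspan F P))%VS by apply.
apply: gspan_ind => g Pg; rewrite -subv_cent1.
apply: gspan_ind => h Ph; apply/cent1vP.
by rewrite -!ginjM (centsP abP).
Qed.

Lemma subgroup_ann n a (X : {set gT}) : a \in gspan F P -> X \subset P ->
  (forall g, g \in X -> a * (ginj F g - 1) \in I n) ->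
  forall g, g \in <<X>>%g -> a * (ginj F g - 1) \in I n.
Proof.
move=> Pa sXP aX g; pose Q := [set g in P | a * (ginj F g - 1) \in I n].
have gQ : group_set Q.
  apply/group_setP; split; first by rewrite inE group1 ginj1 subrr mulr0 mem0v.
  move=> u v; rewrite !inE => /andP[Pu au] /andP[Pv av]; rewrite groupM //=.
  have -> : a * (ginj F (u * v)%g - 1) = a * (ginj F u - 1) * ginj F v + a * (ginj F v - 1).
    by rewrite -mulrA -mulrDr mulrBl mul1r ginjM addrA subrK.
  rewrite memvD // -[n]addn0 mem_IaugM // Iaug0 ginj_gspan //.
have : (<<X>> \subset Group gQ)%g.
  rewrite gen_subG; apply/subsetP=> h Xh.
  by rewrite !inE (subsetP sXP) // aX.
by move/subsetP=> sXQ /sXQ; rewrite !inE => /andP[].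
Qed.

(* Write [P = [~: P, <[k]>] \x 'C_P(<[k]>)]. The hypothesis says that [a] is
   killed modulo [I n.+2] by the augmentation ideal of the first factor, so that
   [jvar_socle] lifts it to an element [z] killed by this ideal. *)
Lemma twisted_socle n k a : k \in K -> a \in I n ->
  (forall g, g \in P -> a * (ginj F (g ^ k^-1)%g - ginj F g) \in I n.+2) ->
  exists z, [/\ z \in I n, forall g, g \in P -> z * ginj F (g ^ k^-1)%g = z * ginj F g &
    a - z \in I n.+1].
Proof.
move=> Kk Ia aPk; set L := <[k]>%g.
have nPK : K \subset 'N(P) by rewrite (subset_trans (subsetT _)) ?normal_norm.
have sLK : L \subset K by rewrite cycle_subG.
have nPL : L \subset 'N(P) := subset_trans sLK nPK.
have coPL : coprime #|P| #|L| := pnat_coprime pP (pgroupS sLK p'K).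
have defP := coprime_abelian_cent_dprod nPL coPL abP.
set D := [~: P, L]%G; have sDP : D \subset P by rewrite commg_subl.
have [bD defD _] := abelian_structure (abelianS sDP abP).
have [bC defC _] := abelian_structure (abelianS (subsetIl P 'C(L)) abP).
set s := bD ++ bC.
have defs : (\big[dprod/1]_(x <- s) <[x]> = P)%g.
  by rewrite big_cat /= defD defC.
pose x (i : 'I_(size s)) := nth 1%g s i.
have defx : (\big[dprod/1]_(i < size s) <[x i]> = P)%g.
  by rewrite -[RHS]defs (big_nth 1%g) big_mkord.
have aD d : d \in D -> a * (ginj F d - 1) \in I n.+2.
  have Pa := subvP (Iaug_gspan F P n) _ Ia.
  apply: (subgroup_ann Pa).
    apply/subsetP=> _ /imset2P[g l Pg Ll ->].
    by rewrite groupM ?groupV // memJ_norm ?(subsetP nPL).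
  move=> _ /imset2P[g l Pg Ll ->].
  (* Telescoping extends the hypothesis from [k] to its powers, hence to all commutators generating
     [D]. *)
  have aj h i : h \in P -> a * (ginj F (h ^ k ^- i)%g - ginj F h) \in I n.+2.
    move=> Ph; elim: i => [|i IHi]; first by rewrite invg1 conjg1 subrr mulr0 mem0v.
    have Phi : (h ^ k ^- i)%g \in P by rewrite memJ_norm // groupV groupX // (subsetP nPK).
    have -> : ginj F (h ^ k ^- i.+1)%g - ginj F h =
        (ginj F ((h ^ k ^- i) ^ k^-1)%g - ginj F (h ^ k ^- i)%g) + (ginj F (h ^ k ^- i)%g - ginj F h).
      by rewrite addrA subrK -conjgM -invMg -expgS.
    by rewrite mulrDr memvD // aPk.
  have /cycleP[i lE] : (l^-1)%g \in L by rewrite groupV.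
  rewrite -[l]invgK lE commgEl.
  have -> : a * (ginj F (g^-1 * g ^ k ^- i)%g - 1) =
      a * (ginj F (g ^ k ^- i)%g - ginj F g) * ginj F g^-1%g.
    have Pgi : (g ^ k ^- i)%g \in P by rewrite memJ_norm // groupV groupX // (subsetP nPK).
    rewrite -mulrA mulrBl -!ginjM mulgV ginj1; congr (_ * (ginj F _ - _)).
    by rewrite (centsP abP) ?groupV.
  by rewrite -[n.+2]addn0 mem_IaugM ?aj // Iaug0 ginj_gspan ?groupV.
(* The first [size bD] generators of [P] are those of [D]. *)
have [|z [Iz zS az]] := jvar_socle charFp pP abP defx (S := [set i : 'I_(size s) | i < size bD]%N) Ia.
  move=> i; rewrite inE => lti; apply: aD.
  rewrite /x nth_cat lti -(bigdprodWY defD) bigcup_seq mem_gen //.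
  by apply/bigcupP; exists (nth 1%g bD i); rewrite ?mem_nth ?cycle_id.
exists z; split=> // g Pg.
have Pz := subvP (Iaug_gspan F P n) _ Iz.
pose Q := [set d in P | z * (ginj F d - 1) == 0].
have gQ : group_set Q.
  apply/group_setP; split; first by rewrite inE group1 ginj1 subrr mulr0 eqxx.
  move=> u v; rewrite !inE => /andP[Pu /eqP au] /andP[Pv /eqP av]; rewrite groupM //=.
  have -> : z * (ginj F (u * v)%g - 1) = z * (ginj F u - 1) * ginj F v + z * (ginj F v - 1).
    by rewrite -mulrA -mulrDr mulrBl mul1r ginjM addrA subrK.
  by rewrite au av mul0r addr0.
have sDQ : D \subset Group gQ.
  rewrite -(bigdprodWY defD) bigcup_seq gen_subG; apply/bigcupsP=> d bDd.
  rewrite cycle_subG !inE; apply/andP; split.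
    rewrite (subsetP sDP) // -(bigdprodWY defD) bigcup_seq mem_gen //.
    by apply/bigcupP; exists d; rewrite ?cycle_id.
  have lti : (index d s < size s)%N by rewrite index_mem mem_cat bDd.
  have := zS (Ordinal lti); rewrite inE /= /jvar /x /= nth_index ?mem_cat ?bDd //.
  by rewrite index_cat bDd index_mem bDd => ->.
have : [~ g, k^-1]%g \in Group gQ.
  by rewrite (subsetP sDQ) // mem_commg // groupV cycle_id.
rewrite !inE => /andP[Pd /eqP zd].
rewrite -[(g ^ k^-1)%g](mulKVg g) -commgEl (centsP abP) // ginjM -[ginj F _](subrK 1).
by rewrite mulrDl mul1r mulrDr mulrA zd mul0r add0r.
Qed.

(* The condition on [a] holds separately for its components [a_k * k], [k] in
   [K], and on [a_k] it is the hypothesis of [twisted_socle]; the central element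
   is obtained by averaging over [K]. *)
Lemma abelian_lifts_center : lifts_center.
Proof.
move=> n a Ja aA aJ.
have nPK k : k \in K -> k \in 'N(P) by move=> _; rewrite (subsetP (normal_norm nP)) ?inE.
pose Pz k z := k \in K -> [/\ z \in I n,
    forall g, g \in P -> z * ginj F (g ^ k^-1)%g = z * ginj F g &
    gres P (a * ginj F k^-1%g) - z \in I n.+1].
have [zf zfP] : exists zf : gT -> A, forall k, Pz k (zf k).
  apply: fin_all_exists => k; have [Kk|nKk] := boolP (k \in K); last by exists 0; rewrite /Pz (negPf nKk).
  have [z zP] : exists z, [/\ z \in I n, forall g, g \in P -> z * ginj F (g ^ k^-1)%g = z * ginj F g &
      gres P (a * ginj F k^-1%g) - z \in I n.+1].
    apply: twisted_socle => //; first by rewrite Jaug_gres // mem_JaugMr.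
    move=> g Pg; have Pgk : (g ^ k^-1)%g \in P by rewrite memJ_norm ?groupV ?nPK.
    have := aJ (ginj F g - 1); rewrite Jaug1 => /(_ _)/(mem_JaugMr (ginj F k^-1%g))/Jaug_gres.
    have -> : a * (ginj F g - 1) - (ginj F g - 1) * a = a * ginj F g - ginj F g * a.
      by rewrite mulrBr mulrBl mulr1 mul1r opprB addrA subrK.
    rewrite mulrBl linearB /= -mulrA -ginjM.
    (* With [a_k = gres P (a * ginj F k^-1)], the component of [a * g - g * a] at [k] is
       [a_k * (g ^ k^-1 - g)]. *)
    have -> : (g * k^-1)%g = (k^-1 * g ^ k^-1)%g by rewrite conjgC.
    have Fgk : ginj F (g ^ k^-1)%g \in gspan F P by rewrite ginj_gspan.
    rewrite ginjM mulrA (gres_mulr _ Fgk) -[ginj F g * a * _]mulrA gresMl ?ginj_gspan //.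
    rewrite -[ginj F g * _]gspan_comm ?gres_gspan ?ginj_gspan // -mulrBr; apply.
    by rewrite -[_ - _]mulr1 memv_mul ?memvf ?mem_augv.
  by exists z.
pose z0 := \sum_(k in K) zf k * ginj F k.
have Jz0 : z0 \in J n.
  by apply: memv_suml => k /zfP[Iz _ _]; apply: mem_IaugJ.
have az0 : a - z0 \in J n.+1.
  rewrite [X in X - _](gres_decomp defG tiPK a) -sumrB; apply: memv_suml => k Kk.
  by rewrite -mulrBl mem_IaugJ //; have [] := zfP k Kk.
have z0P g : g \in P -> z0 * ginj F g = ginj F g * z0.
  move=> Pg; rewrite mulr_suml mulr_sumr; apply: eq_bigr => k Kk.
  have [Iz zk _] := zfP k Kk.
  have Pzk := subvP (Iaug_gspan F P n) _ Iz.
  rewrite -mulrA -ginjM [(k * g)%g]conjgCV ginjM mulrA zk // mulrA.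
  by rewrite (gspan_comm Pzk) ?ginj_gspan.
pose z := #|K|%:R^-1 *: \sum_(l in K) ginj F l * z0 * ginj F l^-1%g.
have inK1 l : ginj F l * ginj F l^-1%g = 1 by rewrite -ginjM mulgV ginj1.
have inK2 l : ginj F l^-1%g * ginj F l = 1 by rewrite -ginjM mulVg ginj1.
have sumK b : b = #|K|%:R^-1 *: \sum_(l in K) b.
  by rewrite sumr_const -scaler_nat scalerA mulVf ?scale1r.
exists z; split.
- apply: memvZ; apply: memv_suml => l _.
  by rewrite mem_JaugMr // mem_JaugMl.
- apply: central_galg => [g Pg|k Kk].
    rewrite -scalerAl -scalerAr mulr_suml mulr_sumr; congr (_ *: _).
    apply: eq_bigr => l Kl; have Pgl : (g ^ l)%g \in P by rewrite memJ_norm ?nPK.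
    have zl : ginj F l * z0 * (ginj F l^-1%g * ginj F g) = ginj F g * ginj F l * z0 * ginj F l^-1%g.
      have -> : ginj F l^-1%g * ginj F g = ginj F (g ^ l)%g * ginj F l^-1%g.
        by rewrite -!ginjM conjgE !mulgA mulgK.
      rewrite mulrA -[ginj F l * z0 * _]mulrA z0P // mulrA -!ginjM.
      by congr (ginj F _ * _ * _); rewrite conjgE mulKVg.
    by rewrite -[LHS]mulrA zl -!mulrA.
  rewrite -scalerAl -scalerAr mulr_suml mulr_sumr; congr (_ *: _).
  rewrite [RHS](reindex_inj (mulgI k^-1%g)) /=; apply: eq_big => l.
    by rewrite groupMl ?groupV.
  move=> Kl; have zl : ginj F l * z0 * (ginj F l^-1%g * ginj F k) =
      ginj F k * ginj F (k^-1 * l)%g * z0 * ginj F (k^-1 * l)^-1%g.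
    by rewrite -!ginjM mulKVg invMg invgK.
  by rewrite -[LHS]mulrA zl -!mulrA.
rewrite [a]sumK -scalerBr -sumrB; apply/memvZ/memv_suml => l Kl.
have -> : a - ginj F l * z0 * ginj F l^-1%g =
    - ((ginj F l * a - a * ginj F l) * ginj F l^-1%g) + ginj F l * (a - z0) * ginj F l^-1%g.
  rewrite mulrBr !mulrBl -!mulrA inK1 mulr1 opprB addrA subrK.
  by [].
apply: memvD; last by apply/mem_JaugMr/mem_JaugMl.
by rewrite memvN; apply: mem_JaugMr; rewrite -opprB memvN.
Qed.

End AbelianNormal.

Section AbelianFromLifting.
Hypothesis comm3 : forall a b, a \in augv F P -> b \in augv F P -> a * b - b * a \in I 3.
Hypothesis liftJ : lifts_center.

(** Bracketing with [b] is a derivation which by [comm3] raises the degree of [augv F P] by two; the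
    Leibniz rule carries this to all powers, and scalars are killed. *)
Lemma Iaug_comm n a b : a \in I n -> b \in augv F P -> a * b - b * a \in I n.+2.
Proof.
move=> Ia Pb; have fE c : (amulr b - amull b) c = c * b - b * c.
  by rewrite add_lfunE opp_lfunE !lfunE.
have sub (U : {vspace A}) m : (forall c, c \in U -> c * b - b * c \in I m) ->
    (U <= (amulr b - amull b) @^-1: I m)%VS.
  by move=> Uc; apply/subvP=> c /Uc; rewrite -memv_preim fE.
case: n Ia => [|n] Ia.
  have /subvP/(_ a) : (I 0 <= (amulr b - amull b) @^-1: I 2)%VS.
    rewrite Iaug0 gspan_augv subv_add; apply/andP; split.
      by rewrite -memvE -memv_preim fE mul1r mulr1 subrr mem0v.
    apply: sub => c Pc; apply: subvP (Iaug_le F P 2) _ _; exact: comm3.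
  by rewrite -memv_preim fE; apply.
elim: n a Ia => [|n IHn] a; first by rewrite Iaug1 => Pa; apply: comm3.
rewrite Iaug_S expvSr => Ia.
have /subvP/(_ a Ia) : (augv F P ^+ n.+1 * augv F P <= (amulr b - amull b) @^-1: I n.+4)%VS.
  apply/prodvP=> c d Ic Pd; rewrite -memv_preim fE.
  have Ic' : c \in I n.+1 by rewrite Iaug_S.
  have -> : c * d * b - b * (c * d) = c * (d * b - b * d) + (c * b - b * c) * d.
    by rewrite mulrBr mulrBl !mulrA addrA subrK.
  rewrite memvD //.
    by have := mem_IaugM Ic' (comm3 Pd Pb); rewrite addn3.
  have Id : d \in I 1 by rewrite Iaug1.
  by have := mem_IaugM (IHn c Ic') Id; rewrite addn1.
by rewrite -memv_preim fE.
Qed.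

(* [liftJ] replaces [r] by a central element modulo [I n.+1]; the projection of
   that element to the group algebra of [P] is still central, and the difference
   is again fixed by [K], one step deeper in the filtration. *)
Lemma fixed_central n r : r \in I n ->
  (forall k, k \in K -> r * ginj F k = ginj F k * r) ->
  forall g, g \in P -> r * ginj F g = ginj F g * r.
Proof.
have [N IN] : exists N, I N = 0%VS.
  have [N PN] := augv_nilpotent charFp pP; exists N.+1.
  by rewrite Iaug_S expvSr PN prod0v.
have [m le_m] : exists m, (N <= n + m)%N by exists N; rewrite leq_addl.
elim: m n r le_m => [|m IHm] n r le_m Ir rK g Pg.
  have : r \in (0 : {vspace A})%VS.
    by rewrite -IN; apply: subvP Ir; apply: Iaug_mono; rewrite -[n]addn0.
  by rewrite memv0 => /eqP->; rewrite mulr0 mul0r.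
(* Since [r] commutes with [K], only the components of [b] in [F[P]] matter, and their scalar parts
   drop out. *)
have comm2 b : r * b - b * r \in J n.+2.
  rewrite [b](gres_decomp defG tiPK) mulr_sumr mulr_suml -sumrB.
  apply: memv_suml => k Kk; rewrite -[X in _ - X]mulrA -rK // !mulrA -mulrBl.
  apply: mem_IaugJ; set c := gres _ _.
  have /memv_addP[u /vlineP[t ->] [v Pv ->]] : c \in (1 + augv F P)%VS.
    by rewrite -gspan_augv gres_gspan.
  rewrite mulrDr mulrDl opprD addrACA -scalerAr -scalerAl mulr1 mul1r subrr add0r.
  exact: Iaug_comm.
have JS b i : b \in J i.+1 -> b \in J i.
  move=> Jb; suff : (J i.+1 <= J i)%VS by move/subvP; apply.
  by rewrite /Jaug expvSr -prodvA prodvSr // subvf.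
have [|z [Jz cz rz]] := liftJ (Iaug_Jaug Ir) _ (fun b _ => comm2 b).
  by move=> b; apply/JS/comm2.
have zg h : gres P z * ginj F h = ginj F h * gres P z.
  have inK1 l : ginj F l * ginj F l^-1%g = (1 : A) by rewrite -ginjM mulgV ginj1.
  have zh : ginj F h^-1%g * z * ginj F h = z.
    by rewrite -mulrA cz mulrA -ginjM mulVg ginj1 mul1r.
  by rewrite -[in RHS]zh gresJ // !mulrA inK1 mul1r.
have Pr := subvP (Iaug_gspan F P n) _ Ir.
have -> : r = gres P z + (r - gres P z) by rewrite addrC subrK.
rewrite mulrDl mulrDr zg; congr (_ + _).
apply: (IHm n.+1) => //; first by rewrite addSnnS.
  by have := Jaug_gres rz; rewrite linearB /= gres_id.
by move=> k Kk; rewrite mulrBl mulrBr zg rK.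
Qed.

(* By [fixed_central] the sum of a [K]-orbit in [P] commutes with [P], so [P]
   acts on the orbit by conjugation; the orbit has order prime to [p], hence a
   point fixed by [P], and all its elements are central in [P]. *)
Lemma abelian_of_lifts_center : abelian P.
Proof.
have nPK k : k \in 'N(P) by rewrite (subsetP (normal_norm nP)) ?inE.
have conjK u v : u \in P -> v \in P -> (u ^ v \in u ^: K)%g.
  move=> Pu Pv; pose r : A := \sum_(k in K) ginj F (u ^ k)%g.
  have Pr : r \in I 0.
    by rewrite Iaug0; apply: memv_suml => k _; rewrite ginj_gspan // memJ_norm.
  have rK k : k \in K -> r * ginj F k = ginj F k * r.
    move=> Kk; rewrite mulr_suml mulr_sumr [RHS](reindex_inj (mulIg k)) /=.
    apply: eq_big => l; first by rewrite groupMr.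
    by move=> _; rewrite -!ginjM [(u ^ (l * k))%g]conjgM -conjgC.
  have rE w : r w = (\sum_(k in K) (w == u ^ k)%g)%:R.
    by rewrite sum_ffunE natr_sum; apply: eq_bigr => k _; rewrite ginjE.
  have ruv : r (u ^ v)%g = r u.
    have /ffunP/(_ (v * u ^ v)%g) := fixed_central Pr rK Pv.
    by rewrite mul_ginjE ginj_mulE mulKg -conjgC mulgK => ->.
  (* This coefficient is [#|'C_K[u]|], which is prime to [p]. *)
  have ru : r u != 0.
    rewrite rE -(dvdn_pcharf charFp).
    have cu k : (u == u ^ k)%g = (k \in 'C[u]%g).
      by rewrite eq_sym (sameP eqP conjg_fixP) (sameP commgP cent1P) cent1C.
    rewrite (eq_bigr (fun k => if k \in 'C[u]%g then 1%N else 0%N)) => [|k _]; last first.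
      by rewrite cu; case: (_ \in _).
    rewrite -big_mkcondr /=.
    rewrite sum1_card -p'natE ?(pcharf_prime charFp) //.
    rewrite (eq_card (B := mem ('C_K[u])%g)) => [|k]; last by rewrite unfold_in /= [RHS]in_setI.
    exact: pgroupS (subsetIl _ _) p'K.
  move: ru; rewrite -ruv rE; apply: contraR => nuv.
  rewrite big1 // => k Kk; case: eqP => // uvk.
  by rewrite uvk memJ_class in nuv.
apply/centsP=> u Pu v Pv.
have actP : [acts P, on (u ^: K)%g | 'J].
  apply/subsetP=> w Pw; rewrite !inE /=; apply/subsetP=> c Kc; rewrite inE /=.
  have /imsetP[k Kk defc] := Kc; rewrite -(class_eqP Kc).
  by apply: conjK => //; rewrite defc memJ_norm.
have : (0 < #|'Fix_((u ^: K)%g | 'J)(P)|)%N.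
  rewrite lt0n; apply/eqP=> fix0; have := pgroup_fix_mod pP actP.
  rewrite fix0 mod0n => /eqP; rewrite -/(dvdn p _) => p_cl.
  have : (p^').-nat #|(u ^: K)%g|.
    by rewrite -index_cent1 (pnat_dvd _ p'K) // dvdn_indexg.
  by rewrite p'natE ?p_cl // (pcharf_prime charFp).
case/card_gt0P=> c /setIP[/imsetP[k Kk ->]]; rewrite afixJ => cPuk.
have : u \in 'C(P)%g by rewrite -(memJ_norm u (subsetP (cent_norm P) k _)).
by move/centP/(_ v Pv).
Qed.

End AbelianFromLifting.

End LiftingCentralElements.

(** * Commuting families of matrices and Weyl relations *)

Section RestrictedMatrix.
Variables (F : fieldType) (N : nat) (W : 'M[F]_N).
Implicit Types X Y : 'M[F]_N.

Lemma restrictmx_mul X : stablemx W X ->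
  restrictmx W X *m row_base W = row_base W *m X.
Proof. by move=> sX; rewrite mulmxKpV ?stablemx_row_base. Qed.

Lemma restrictmxB X Y : restrictmx W (X - Y) = restrictmx W X - restrictmx W Y.
Proof. by rewrite /conjmx mulmxBr mulmxBl. Qed.

Lemma restrictmxM X Y : stablemx W X -> stablemx W Y ->
  restrictmx W (X *m Y) = restrictmx W X *m restrictmx W Y.
Proof. by move=> sX sY; rewrite conjmxM // inE stablemx_row_base. Qed.

Lemma restrictmx1 : restrictmx W 1%:M = 1%:M.
Proof. by rewrite /conjmx mulmx1 mulmxVp ?row_base_free. Qed.

End RestrictedMatrix.

Section CommutingMatrices.
Variable F : closedFieldType.

Lemma common_eigenvector_closed n (Rs : seq 'M[F]_n) : (0 < n)%N ->
  {in Rs &, forall A B, comm_mx A B} ->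
  exists2 v : 'rV_n, v != 0 & forall A, A \in Rs -> exists a, v *m A = a *: v.
Proof.
have [m] := ubnP (size Rs); elim: m => // m IHm in n Rs *.
case: Rs => [|R Rs] /=.
  move=> _ n0 _; exists (const_mx 1) => //.
  by apply/negP => /eqP/rowP/(_ (Ordinal n0)); rewrite !mxE => /eqP; rewrite oner_eq0.
rewrite ltnS => sRs n0 cRs; have [a eiga] := eigenvalue_closedField R n0.
set W := eigenspace R a; have sW A : A \in Rs -> stablemx W A.
  move=> RsA; apply: comm_mx_stable_eigenspace.
  by apply: cRs; rewrite inE ?eqxx // RsA orbT.
have [|||v v0 vP] := IHm _ [seq restrictmx W A | A <- Rs].
- by rewrite size_map.
- by rewrite lt0n mxrank_eq0.
- move=> _ _ /mapP[A RsA ->] /mapP[B RsB ->]; rewrite /comm_mx -!restrictmxM ?sW //.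
  by congr (conjmx _ _); apply: cRs; rewrite inE ?RsA ?RsB orbT.
exists (v *m row_base W); first by rewrite mulmx_free_eq0 ?row_base_free.
move=> A; rewrite inE => /predU1P[->|RsA].
  exists a; apply/eigenspaceP.
  by rewrite -/W (submx_trans (submxMl _ _)) ?eq_row_base.
have [|b vb] := vP (restrictmx W A); first by apply: map_f.
by exists b; rewrite -mulmxA -restrictmx_mul ?sW // mulmxA vb scalemxAl.
Qed.

(* Let [v] and [u] be a row and a column weight vector with [v *m u != 0]; they
   have the same weight, so [u *m v] commutes with every [R i], and averaging
   it over [K] gives a scalar matrix [c%:M] by Schur's lemma, of trace
   [c * n = #|K| * (v *m u)]. *)
Lemma irreducible_dim_neq0 n (I : finType) (R : I -> 'M[F]_n) (gT : finGroupType)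
    (K : {group gT}) (S : gT -> 'M[F]_n) (act : gT -> I -> I) :
  (0 < n)%N -> (forall i j, comm_mx (R i) (R j)) -> S 1%g = 1%:M ->
  {in K &, forall k l, S (k * l)%g = S k *m S l} ->
  (forall k i, k \in K -> S k *m R i = R (act k i) *m S k) ->
  (forall W : 'M[F]_n, (forall i, stablemx W (R i)) ->
     (forall k, k \in K -> stablemx W (S k)) -> W != 0 -> row_full W) ->
  #|K|%:R != 0 :> F -> n%:R != 0 :> F.
Proof.
move=> n0 cR S1 SM SR irr K0.
have [v0 v00 v0P] : exists2 v : 'rV_n, v != 0 & forall i, exists a, v *m R i = a *: v.
  have [|v v0 vP] := @common_eigenvector_closed n [seq R i | i : I] n0.
    by move=> _ _ /imageP[i _ ->] /imageP[j _ ->]; apply: cR.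
  by exists v => // i; apply: vP; apply/imageP; exists i.
have [u u0 uP] : exists2 u : 'cV_n, u != 0 & forall i, exists a, R i *m u = a *: u.
  have [|v v1 vP] := @common_eigenvector_closed n [seq (R i)^T | i : I] n0.
    by move=> _ _ /imageP[i _ ->] /imageP[j _ ->]; rewrite /comm_mx -!trmx_mul cR.
  exists v^T; first by rewrite trmx_eq0.
  move=> i; have [|a va] := vP (R i)^T; first by apply/imageP; exists i.
  by exists a; rewrite -[R i]trmxK -trmx_mul va linearZ.
(* The translates of [v0] under [K] span a stable subspace, hence everything, so [u] cannot
   annihilate them all. *)
have [k0 Kk0 vu] : exists2 k, k \in K & v0 *m S k *m u != 0.
  pose W : 'M[F]_n := (\sum_(k in K) <<v0 *m S k>>)%MS.
  have fullW : row_full W.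
    apply: irr => [i|k Kk|].
    - rewrite sumsmxMr; apply/sumsmx_subP=> k Kk.
      rewrite (sumsmx_sup k) // (eqmxMr _ (genmxE _)) genmxE -mulmxA SR //.
      by have [a va] := v0P (act k i); rewrite mulmxA va -scalemxAl scalemx_sub.
    - rewrite /W sumsmxMr; apply/sumsmx_subP=> l Kl.
      rewrite (sumsmx_sup (l * k)%g) ?groupM // (eqmxMr _ (genmxE _)) genmxE.
      by rewrite -mulmxA SM.
    apply: contraNneq v00 => W0; have : (v0 <= W)%MS.
      by rewrite (sumsmx_sup 1%g) // genmxE S1 mulmx1.
    by rewrite W0 submx0.
  apply/exists_inP; apply: contraNT u0 => /exists_inPn vu0.
  have : (W *m u == 0).
    rewrite -submx0 /W sumsmxMr_gen; apply/sumsmx_subP=> k Kk.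
    rewrite genmxE (eqmxMr _ (genmxE _)) submx0.
    by have := vu0 k Kk; rewrite negbK.
  have [Wi WiW] := row_fullP fullW; move=> /eqP Wu0.
  by rewrite -[u]mul1mx -WiW -mulmxA Wu0 mulmx0.
set v := v0 *m S k0 in vu.
have vP i : exists a, v *m R i = a *: v.
  have [a va] := v0P (act k0 i); exists a.
  by rewrite /v -mulmxA SR // mulmxA va scalemxAl.
pose E := u *m v.
have cE i : comm_mx E (R i).
  have [a va] := vP i; have [b ub] := uP i.
  suff ab : a = b by rewrite /comm_mx /E mulmxA ub -mulmxA va ab -scalemxAl -scalemxAr.
  have : (a - b) *: (v *m u) = 0.
    by rewrite scalerBl scalemxAl -va [X in _ - X]scalemxAr -ub mulmxA subrr.
  by move/eqP; rewrite scaler_eq0 (negPf vu) orbF subr_eq0 => /eqP.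
have KV k : k \in K -> S k *m S k^-1%g = 1%:M by move=> Kk; rewrite -SM ?groupV // mulgV.
have VK k : k \in K -> S k^-1%g *m S k = 1%:M by move=> Kk; rewrite -SM ?groupV // mulVg.
pose T := \sum_(k in K) S k *m E *m S k^-1%g.
have cTS k : k \in K -> comm_mx T (S k).
  move=> Kk; rewrite /comm_mx mulmx_suml mulmx_sumr.
  rewrite [LHS](reindex_inj (mulgI k)) /=; apply: eq_big => l; first by rewrite groupMl.
  rewrite groupMl // => Kl.
  rewrite invgM !SM ?groupM ?groupV // -!mulmxA VK ?mulmx1 //.
have cTR i : comm_mx T (R i).
  rewrite /comm_mx mulmx_suml mulmx_sumr; apply: eq_bigr => k Kk.
  have Sk : R i *m S k = S k *m R (act k^-1%g i).
    by rewrite -[LHS]mul1mx -(KV k Kk) -mulmxA [X in _ *m X]mulmxA SR ?groupV // -mulmxA VK // mulmx1.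
  rewrite -mulmxA SR ?groupV // mulmxA -(mulmxA (S k) E) cE.
  by rewrite !mulmxA Sk.
have [c eigc] := eigenvalue_closedField T n0.
have Tc : T = c%:M.
  have : row_full (eigenspace T c).
    apply: irr => [i|k Kk|]; last exact: eigc.
      exact: comm_mx_stable_eigenspace.
    exact/comm_mx_stable_eigenspace/cTS.
  rewrite -sub1mx => /eigenspaceP; rewrite mul1mx => ->.
  by rewrite scalemx1.
have : \tr T = #|K|%:R * \tr E.
  rewrite /T raddf_sum /= (eq_bigr (fun=> \tr E)) => [|k Kk].
    by rewrite sumr_const mulr_natl.
  by rewrite mxtrace_mulC mulmxA VK // mul1mx.
rewrite Tc mxtrace_scalar /E mxtrace_mulC => trT.
apply: contraNneq vu => nF0; rewrite -[c *+ n]mulr_natr nF0 mulr0 in trT.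
move/esym/eqP: trT; rewrite mulf_eq0 (negPf K0) /= => /eqP trvu.
apply/eqP/matrixP=> i j; rewrite !ord1 [RHS]mxE -trvu.
by rewrite /mxtrace big_ord1.
Qed.

(* A minimal nonzero subspace stable under everything is irreducible. *)
Lemma stable_dim_neq0 n (I : finType) (R : I -> 'M[F]_n) (gT : finGroupType)
    (K : {group gT}) (S : gT -> 'M[F]_n) (act : gT -> I -> I) :
  (0 < n)%N -> (forall i j, comm_mx (R i) (R j)) -> S 1%g = 1%:M ->
  {in K &, forall k l, S (k * l)%g = S k *m S l} ->
  (forall k i, k \in K -> S k *m R i = R (act k i) *m S k) ->
  #|K|%:R != 0 :> F ->
  exists W : 'M[F]_n, [/\ forall i, stablemx W (R i),
    forall k, k \in K -> stablemx W (S k) & (\rank W)%:R != 0 :> F].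
Proof.
move=> n0 cR S1 SM SR K0.
pose stable (W : 'M[F]_n) := [forall i, stablemx W (R i)] && [forall k in K, stablemx W (S k)].
have stableP W : reflect ((forall i, stablemx W (R i)) /\
    (forall k, k \in K -> stablemx W (S k))) (stable W).
  by apply: (iffP andP) => -[/forallP sR /forall_inP sS].
have [W [sW W0 minW]] : exists W, [/\ stable W, W != 0 &
    forall V, stable V -> V != 0 -> (\rank W <= \rank V)%N].
  have [W0 [sW0 W00]] : exists W, stable W /\ W != 0.
    exists 1%:M; split; first by apply/stableP; split=> *; rewrite submx1.
    by rewrite -mxrank_eq0 mxrank1 -lt0n.
  have [m] := ubnP (\rank W0); elim: m => // m IHm in W0 sW0 W00 *.
  rewrite ltnS => rW0.
  have [[V [sV V0 ltV]]|minW0] :=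
    classic (exists V, [/\ stable V, V != 0 & (\rank V < \rank W0)%N]).
    by apply: (IHm V) => //; apply: leq_trans rW0.
  exists W0; split=> // V sV V0; rewrite leqNgt; apply/negP=> ltV.
  by case: minW0; exists V.
have [sR sS] := stableP _ sW.
exists W; split=> //.
apply: (@irreducible_dim_neq0 _ I (fun i => restrictmx W (R i)) _ K
  (fun k => restrictmx W (S k)) act).
- by rewrite lt0n mxrank_eq0.
- by move=> i j; rewrite /comm_mx -!restrictmxM // cR.
- by rewrite S1 restrictmx1.
- by move=> k l Kk Kl; rewrite SM // restrictmxM ?sS.
- by move=> k i Kk; rewrite -!restrictmxM ?sS // SR.
- move=> V sVR sVS V0; have sV : stable <<V *m row_base W>>%MS.
    apply/stableP; split=> [i|k Kk]; rewrite (eqmxMr _ (genmxE _)) genmxE.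
      by rewrite -stablemx_restrict.
    by rewrite -stablemx_restrict ?sS ?sVS.
  have := minW _ sV; rewrite genmxE mxrankMfree ?row_base_free // => leV.
  rewrite /row_full eqn_leq rank_leq_col leV // -mxrank_eq0 genmxE.
  by rewrite mxrankMfree ?row_base_free ?mxrank_eq0.
- exact: K0.
Qed.

End CommutingMatrices.

(* Shift and weighted shift on [F^p]: multiplication by [X] and differentiation
   on polynomials of degree less than [p]; the relation [[d/dX, X] = 1]
   survives the truncation because [p = 0] in [F]. *)
Lemma weyl_pair (F : fieldType) p : p \in [pchar F] ->
  exists T D S R : 'M[F]_p, [/\ T *m D - D *m T = 1%:M,
    T *m T = S + S & D *m D = R + R].
Proof.
move=> charFp; have [p_pr /eqP p0] := andP charFp.
pose T : 'M[F]_p := \matrix_(i, j) (i.+1 == j)%:R.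
pose D : 'M[F]_p := \matrix_(i, j) ((i == j.+1 :> nat)%:R * i%:R).
have TD : T *m D - D *m T = 1%:M.
  apply/matrixP=> i j; rewrite !mxE.
  have -> : \sum_k T i k * D k j = (i == j)%:R * i.+1%:R.
    have [ip|ip] := ltnP i.+1 p.
      rewrite (bigD1 (Ordinal ip)) //= big1 ?addr0 => [|k]; rewrite !mxE.
        by rewrite eqxx mul1r eqSS.
      rewrite -val_eqE /= eq_sym => /negPf ->; by rewrite mul0r.
    (* In the last row the term lost to truncation has coefficient [p], which is zero in [F]. *)
    have -> : i.+1 = p by apply/eqP; rewrite eqn_leq ltn_ord.
    rewrite p0 mulr0 big1 // => k _; rewrite !mxE.
    by rewrite gtn_eqF ?mul0r //; apply: leq_trans (ltn_ord k) ip.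
  have -> : \sum_k D i k * T k j = (i == j)%:R * i%:R.
    case def_i: (i : nat) => [|m].
      by rewrite mulr0 big1 // => k _; rewrite !mxE def_i mulr0 mul0r.
    have mp : (m < p)%N by apply: ltnW; rewrite -def_i.
    rewrite (bigD1 (Ordinal mp)) //= big1 ?addr0 => [|k]; rewrite !mxE /= def_i.
      by rewrite eqxx mul1r mulrC -val_eqE /= def_i.
    by rewrite eqSS -val_eqE /= eq_sym => /negPf ->; rewrite !mul0r.
  by rewrite -mulrBr -natrB // subSnn mulr1.
(* For [p = 2] halving is impossible, but the matrices are 2 by 2 and both squares vanish. *)
have half (M : 'M[F]_p) : (p = 2 -> M *m M = 0) -> exists S, M *m M = S + S.
  move=> M2; have [p2|p2] := eqVneq p 2.
    by exists 0; rewrite addr0 M2.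
  exists (2%:R^-1 *: (M *m M)); rewrite -scalerDl -[X in _ + X]mul1r -{1}[_^-1]mul1r -mulrDl.
  rewrite -[1 + 1]/(2%:R) mulfV ?scale1r //.
  rewrite -(dvdn_pcharf charFp); apply: contra p2 => /dvdn_leq/= => /(_ isT) p2.
  by rewrite eqn_leq p2 prime_gt1.
have [S TS] : exists S, T *m T = S + S.
  apply: half => p2; apply/matrixP=> i j; rewrite !mxE big1 // => k _; rewrite !mxE.
  have [ik|] := eqVneq i.+1 k; last by rewrite mul0r.
  by rewrite mul1r gtn_eqF //; rewrite -ik; apply: leq_trans (ltn_ord j) (leq_trans (eq_leq p2) _).
have [R DR] : exists R, D *m D = R + R.
  apply: half => p2; apply/matrixP=> i j; rewrite !mxE big1 // => k _; rewrite !mxE.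
  have [kj|] := eqVneq (k : nat) j.+1; last by rewrite !(mul0r, mulr0).
  by rewrite kj ltn_eqF ?mul0r //; apply: leq_trans (ltn_ord i) (leq_trans (eq_leq p2) _).
by exists T, D, S, R.
Qed.

Section Tensor.
Variables (F : fieldType) (m n : nat).
Implicit Types (A : 'M[F]_m) (B : 'M[F]_n).

Lemma tensmx1 : (1%:M : 'M[F]_m) *t (1%:M : 'M[F]_n) = 1%:M.
Proof.
apply/matrixP=> i j; case: (mxtens_indexP i) => i1 i2; case: (mxtens_indexP j) => j1 j2.
rewrite tensmxE !mxE -natrM mulnb (inj_eq (can_inj (@mxtens_indexK m n))).
by rewrite xpair_eqE.
Qed.

Lemma tensmxDl A A' B : (A + A') *t B = A *t B + A' *t B.
Proof. by apply/matrixP=> i j; rewrite !mxE mulrDl. Qed.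
Lemma tensmxBl A A' B : (A - A') *t B = A *t B - A' *t B.
Proof. by apply/matrixP=> i j; rewrite !mxE mulrBl. Qed.
Lemma tensmxDr A B B' : A *t (B + B') = A *t B + A *t B'.
Proof. by apply/matrixP=> i j; rewrite !mxE mulrDr. Qed.
Lemma tensmxBr A B B' : A *t (B - B') = A *t B - A *t B'.
Proof. by apply/matrixP=> i j; rewrite !mxE mulrBr. Qed.
End Tensor.

(* The last two conditions replace a division by 2 in [square_cocycle]. *)
Lemma weyl_family (F : fieldType) p n : p \in [pchar F] ->
  exists d, exists t D s r : 'I_n -> 'M[F]_d, [/\ (0 < d)%N,
    [/\ forall i j, comm_mx (t i) (t j), forall i j, comm_mx (D i) (D j) &
      forall i j, D i *m t j - t j *m D i = (i == j)%:R%:M],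
    forall i, t i *m t i = s i + s i & forall i, D i *m D i = r i + r i].
Proof.
move=> charFp; have p_pr := pcharf_prime charFp.
have [T1 [D1 [S1 [R1 [T1D1 T1T1 D1D1]]]]] := weyl_pair charFp.
elim: n => [|n [d [t [D [s [r [d0 [ct cD Dt] ts Dr]]]]]]].
  by exists 1%N, (fun=> 0), (fun=> 0), (fun=> 0), (fun=> 0); split=> [||[]|[]] //; split=> -[].
pose ext X Y (i : 'I_n.+1) : 'M[F]_(p * d) :=
  if unlift ord0 i is Some j then 1%:M *t Y j else X *t 1%:M.
have ext_comm X1 Y1 X2 Y2 i j : (comm_mx X1 X2) ->
    (forall i j, comm_mx (Y1 i) (Y2 j)) -> comm_mx (ext X1 Y1 i) (ext X2 Y2 j).
  move=> cX cY; rewrite /comm_mx /ext.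
  by case: unliftP => [i1|] _; case: unliftP => [j1|] _; rewrite !tensmx_mul ?mul1mx ?mulmx1 ?cX ?cY.
have ext_sq X1 Y1 X2 Y2 i : X1 *m X1 = X2 + X2 -> (forall j, Y1 j *m Y1 j = Y2 j + Y2 j) ->
    ext X1 Y1 i *m ext X1 Y1 i = ext X2 Y2 i + ext X2 Y2 i.
  move=> XX YY; rewrite /ext.
  case: unliftP => [i1|] _; rewrite tensmx_mul mul1mx.
    by rewrite YY tensmxDr.
  by rewrite XX tensmxDl.
(* Since [T1 *m D1 - D1 *m T1 = 1], it is [D1] that serves as the new variable and [T1] as the new
   derivation. *)
exists (p * d)%N, (ext D1 t), (ext T1 D), (ext R1 s), (ext S1 r); split.
- by rewrite muln_gt0 prime_gt0.
- split=> i j; try exact: ext_comm; rewrite /ext.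
  case: unliftP => [i1|] ->; case: unliftP => [j1|] ->; rewrite !tensmx_mul !mul1mx ?mulmx1.
  + rewrite -tensmxBr Dt (inj_eq lift_inj); case: eqP => _.
      by rewrite tensmx1.
    by rewrite !raddf0 tensmx0.
  + by rewrite subrr eq_sym (negPf (neq_lift _ _)) raddf0.
  + by rewrite subrr (negPf (neq_lift _ _)) raddf0.
  + by rewrite -tensmxBl T1D1 tensmx1.
- by move=> i; apply: ext_sq.
- by move=> i; apply: ext_sq.
Qed.

(** * Cocycles for the truncated representation *)

Section Cocycles.
Variables (F : fieldType) (gT : finGroupType) (P : {group gT}).

Definition additive_on (V : zmodType) (a : gT -> V) :=
  {in P &, forall g h, a (g * h)%g = a g + a h}.

Lemma additive_sum (d n : nat) (a : 'I_n -> gT -> F) (t : 'I_n -> 'M[F]_d) :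
  (forall i, additive_on (a i)) -> additive_on (fun g => \sum_i a i g *: t i).
Proof.
move=> aD g h Pg Ph; rewrite -big_split /=.
by apply: eq_bigr => i _; rewrite aD // scalerDl.
Qed.

(** The natural choice is half the square of the sum. In its expansion the cross terms occur twice,
    and the diagonal squares are halved by [s], so no division is required. *)
Lemma square_cocycle d n (a : 'I_n -> gT -> F) (t s : 'I_n -> 'M[F]_d) :
  (forall i, additive_on (a i)) -> (forall i j, comm_mx (t i) (t j)) ->
  (forall i, t i *m t i = s i + s i) ->
  exists q : gT -> 'M[F]_d, {in P &, forall g h, q (g * h)%g =
    q g + q h + (\sum_i a i g *: t i) *m (\sum_i a i h *: t i)}.
Proof.
elim: n => [|n IHn] in a t s * => aD ct ts.
  by exists (fun=> 0) => g h _ _; rewrite !big_ord0 mulmx0 !addr0.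
have [|||q qD] := IHn (a \o lift ord0) (t \o lift ord0) (s \o lift ord0).
- by move=> i; apply: aD.
- by move=> i j; apply: ct.
- by move=> i; apply: ts.
pose m g := \sum_(i < n) a (lift ord0 i) g *: t (lift ord0 i).
have mD : additive_on m by apply: additive_sum => i; apply: aD.
have cm g : comm_mx (m g) (t ord0).
  rewrite /comm_mx mulmx_suml mulmx_sumr; apply: eq_bigr => i _.
  by rewrite -scalemxAl -scalemxAr ct.
exists (fun g => q g + a ord0 g *: (m g *m t ord0) + (a ord0 g ^+ 2) *: s ord0).
move=> g h Pg Ph; rewrite !big_ord_recl -/(m g) -/(m h) qD // mD // aD // -/(m g) -/(m h).
have -> : (a ord0 g *: t ord0 + m g) *m (a ord0 h *: t ord0 + m h) =
    (a ord0 g * a ord0 h) *: (s ord0 + s ord0) + a ord0 g *: (m h *m t ord0) +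
    a ord0 h *: (m g *m t ord0) + m g *m m h.
  by rewrite mulmxDl !mulmxDr !linearZ /= -!scalemxAl scalerA -ts -cm mulrC !addrA.
rewrite mulmxDl; move: (m g *m _) (m h *m _) (m g *m _) => X Y Z.
by apply/matrixP=> i j; rewrite !mxE; ring.
Qed.

(** The Gram matrix of [b] satisfies [B *m pinvmx B *m B = B]. Grouping the first two factors
    expresses [b] through combinations of its own partial values, which are additive. *)
Lemma biadditive_factor (b : gT -> gT -> F) :
  (forall g, g \in P -> additive_on (b g)) ->
  (forall h, h \in P -> additive_on (b^~ h)) ->
  exists n, exists al be : 'I_n -> gT -> F,
    [/\ forall i, additive_on (al i), forall i, additive_on (be i) &
      {in P &, forall g h, b g h = \sum_i be i g * al i h}].
Proof.
move=> bDr bDl; pose B : 'M[F]_#|P| := \matrix_(i, j) b (enum_val i) (enum_val j).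
exists #|P|, (fun i h => b (enum_val i) h).
exists (fun i g => \sum_j b g (enum_val j) * pinvmx B j i); split.
- by move=> i g h Pg Ph; rewrite bDr ?enum_valP.
- move=> i g h Pg Ph; rewrite -big_split /=; apply: eq_bigr => j _.
  by rewrite bDl ?enum_valP // mulrDl.
move=> g h Pg Ph.
have := mulmxKpV (submx_refl B).
move/matrixP/(_ (enum_rank_in Pg g) (enum_rank_in Ph h)).
rewrite [RHS]mxE !enum_rankK_in // => <-; rewrite mxE; apply: eq_bigr => i _.
rewrite [B _ _]mxE enum_rankK_in // mxE; congr (_ * _); apply: eq_bigr => j _.
by rewrite [B _ _]mxE enum_rankK_in.
Qed.

(* With [m = \sum_i al i *: t i] and [D = \sum_i be i *: d/dt i], where
   [b = \sum_i be i * al i], the commutation relations give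
   [D g *m m h - m h *m D g = (b g h)%:M]. *)
Lemma weyl_cocycle p (b : gT -> gT -> F) (th : gT -> F) : p \in [pchar F] ->
  (forall g, g \in P -> additive_on (b g)) ->
  (forall h, h \in P -> additive_on (b^~ h)) ->
  {in P &, forall g h, th (g * h)%g = th g + th h + b g h} ->
  exists d, exists c psi : gT -> 'M[F]_d, [/\ (0 < d)%N, additive_on c,
    {in P &, forall g h, psi (g * h)%g = psi g + psi h + c g *m c h} &
    {in P &, forall g h, c g *m c h - c h *m c g = (b g h - b h g)%:M}].
Proof.
move=> charFp bDr bDl thD; have [n [al [be [alD beD bE]]]] := biadditive_factor bDr bDl.
have [d [t [D [s [r [d0 [ct cD Dt] ts Dr]]]]]] := weyl_family n charFp.
have [qt qtD] := square_cocycle alD ct ts; have [qD qDD] := square_cocycle beD cD Dr.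
pose m g := \sum_i al i g *: t i; pose e g := \sum_i be i g *: D i.
have mD : additive_on m by apply: additive_sum.
have eD : additive_on e by apply: additive_sum.
have em : {in P &, forall g h, e g *m m h - m h *m e g = (b g h)%:M}.
  move=> g h Pg Ph; rewrite mulmx_suml mulmx_sumr -sumrB bE // raddf_sum /=.
  apply: eq_bigr => i _; rewrite mulmx_suml mulmx_sumr -sumrB (bigD1 i) //= big1.
    rewrite addr0 -!scalemxAl -!scalemxAr !scalerA mulrC -scalerBr Dt eqxx.
    by rewrite scale_scalar_mx mulr1 mulrC.
  move=> j ji; rewrite -!scalemxAl -!scalemxAr !scalerA mulrC -scalerBr Dt.
  by rewrite eq_sym (negPf ji) raddf0 scaler0.
(* The coboundary of [m g *m e g] is [m g *m e h + m h *m e g], which misses the mixed terms of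
   [c g *m c h] by the scalar [b g h]; [th] supplies that scalar. *)
exists d, (fun g => m g + e g), (fun g => qt g + m g *m e g + qD g + (th g)%:M); split=> //.
- by move=> g h Pg Ph; rewrite mD // eD // addrACA.
- move=> g h Pg Ph; rewrite qtD // qDD // mD // eD // thD // -/(m g) -/(m h) -/(e g) -/(e h).
  rewrite !mulmxDl !mulmxDr 2!raddfD /= -em //.
  move: (m g *m _) (m g *m _) (e g *m _) (e g *m _) (m h *m _) (m h *m _) => ? ? ? ? ? ?.
  by apply/matrixP=> i j; rewrite !mxE; ring.
move=> g h Pg Ph; rewrite raddfB /= -!em // !mulmxDl !mulmxDr.
have cm : m g *m m h = m h *m m g.
  rewrite !mulmx_suml; under eq_bigr do rewrite mulmx_sumr.
  under [RHS]eq_bigr do rewrite mulmx_sumr.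
  rewrite exchange_big; apply: eq_bigr => i _; apply: eq_bigr => j _.
  by rewrite -!scalemxAl -!scalemxAr !scalerA mulrC ct.
have ce : e g *m e h = e h *m e g.
  rewrite !mulmx_suml; under eq_bigr do rewrite mulmx_sumr.
  under [RHS]eq_bigr do rewrite mulmx_sumr.
  rewrite exchange_big; apply: eq_bigr => i _; apply: eq_bigr => j _.
  by rewrite -!scalemxAl -!scalemxAr !scalerA mulrC cD.
rewrite cm ce; move: (m h *m m g) (m g *m _) (e g *m _) (e h *m _) (m h *m _) (e h *m _) => ? ? ? ? ? ?.
by apply/matrixP=> i j; rewrite !mxE; ring.
Qed.

End Cocycles.

(** * Traces of commutators and induced representations *)

Section CommutatorProducts.
Variables (F : fieldType) (I : eqType).

(** In the induced module each block has a pair with commutator 1, but not the same pair for all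
    blocks. The vanishing of this product replaces a global relation [[A, B] = 1]. *)
Definition comm_prod n (E : I -> 'M[F]_n) s := foldr (fun i Q => (1%:M - E i) *m Q) 1%:M s.

Lemma comm_prod_comm n (E : I -> 'M[F]_n) X s :
  {in s, forall i, comm_mx (E i) X} -> comm_mx (comm_prod E s) X.
Proof.
elim: s => [|i s IHs] cE; first by rewrite /comm_mx mul1mx mulmx1.
rewrite /comm_mx /= -mulmxA IHs => [|j sj]; last by apply: cE; rewrite inE sj orbT.
have c1 : comm_mx (1%:M - E i) X.
  by rewrite /comm_mx mulmxBl mulmxBr mul1mx mulmx1 (cE i (mem_head _ _)).
by rewrite !mulmxA c1.
Qed.

(* The commutators [E i] commute with the [A i], so removing one factor
   [1 - E i] from the product does not change its trace. *)
Lemma comm_prod_dim0 n (A B E : I -> 'M[F]_n) s :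
  (forall i, E i = A i *m B i - B i *m A i) ->
  (forall i j, comm_mx (E i) (A j)) -> comm_prod E s = 0 -> n%:R = 0 :> F.
Proof.
move=> EE cE; suff <- : \tr (comm_prod E s) = n%:R by move->; rewrite mxtrace0.
elim: s => [|i s IHs]; first by rewrite mxtrace1.
rewrite /= mulmxBl mul1mx raddfB /= IHs EE mulmxBl raddfB /=.
have cQ : comm_mx (comm_prod E s) (A i) by apply: comm_prod_comm.
by rewrite -mulmxA [\tr (A i *m _)]mxtrace_mulC -mulmxA cQ mulmxA subrr subr0.
Qed.

Lemma comm_prod_rank0 n (W : 'M[F]_n) (A B E : I -> 'M[F]_n) s :
  (forall i, E i = A i *m B i - B i *m A i) ->
  (forall i j, comm_mx (E i) (A j)) ->
  (forall i, stablemx W (A i)) -> (forall i, stablemx W (B i)) ->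
  comm_prod E s = 0 -> (\rank W)%:R = 0 :> F.
Proof.
move=> EE cE sA sB E0.
have sE i : stablemx W (E i).
  by rewrite EE stablemxD ?stablemxN ?stablemxM.
apply: (@comm_prod_dim0 _ (fun i => restrictmx W (A i)) (fun i => restrictmx W (B i))
  (fun i => restrictmx W (E i)) s).
- by move=> i; rewrite EE restrictmxB !restrictmxM ?stablemxM.
- by move=> i j; rewrite /comm_mx -!restrictmxM // cE.
have <- : restrictmx W (comm_prod E s) = comm_prod (fun i => restrictmx W (E i)) s.
  suff [] : stablemx W (comm_prod E s) /\
    restrictmx W (comm_prod E s) = comm_prod (fun i => restrictmx W (E i)) s by [].
  elim: s {E0} => [|i s [sQ IHs]] /=; first by rewrite mulmx1 submx_refl restrictmx1.
  have s1E : stablemx W (1%:M - E i) by rewrite stablemxD ?stablemxN // mulmx1.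
  by rewrite stablemxM // restrictmxM // restrictmxB restrictmx1 IHs.
by rewrite E0 /conjmx mulmx0 mul0mx.
Qed.

End CommutatorProducts.

Section Induction.
Variables (F : fieldType) (gT : finGroupType) (P K : {group gT}) (d : nat).
Hypotheses (nP : P <| [set: gT]) (defG : (P * K)%g = [set: gT]) (tiPK : (P :&: K = 1)%g).
Implicit Types (X Y Z : gT -> 'M[F]_d) (g h : gT) (i j l : 'I_#|K|).
Local Notation kap := (@enum_val _ (mem K)).

Definition ext0 X g : 'M[F]_d := if g \in P then X g else 0.

(** The matrix of an induced representation for the transversal [K], applied to arbitrary functions
    on [P] so that each coefficient of a truncated representation can be induced separately. *)
Definition ind X g := \mxblock_(i < #|K|, j < #|K|) ext0 X ((kap i)^-1 * g * kap j)%g.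

(** Row [i] of an induced matrix at [g] has a single block that can be nonzero, the one for which
    [kap l] is the inverse of the [K]-part of [(kap i)^-1 * g]. *)
Lemma ext0_mul i j g h :
  exists u v, [/\ u * v = (kap i)^-1 * (g * h) * kap j, u \in P &
    forall X Y, \sum_l ext0 X ((kap i)^-1 * g * kap l)%g *m ext0 Y ((kap l)^-1 * h * kap j)%g =
      X u *m ext0 Y v]%g.
Proof.
have /mulsgP[u k Pu Kk uk] : ((kap i)^-1 * g)%g \in (P * K)%g by rewrite defG inE.
have Kk' : (k^-1)%g \in K by rewrite groupV.
pose l0 := enum_rank_in Kk' k^-1%g.
have l0E : kap l0 = k^-1%g by rewrite enum_rankK_in.
exists u, (k * h * kap j)%g; split=> //.
  by rewrite !mulgA uk -!mulgA; congr (_ * _)%g; rewrite !mulgA.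
move=> X Y; rewrite (bigD1 l0) //= big1 ?addr0 => [|l ll0].
  by rewrite l0E invgK uk mulgK /ext0 Pu.
rewrite /ext0 uk; case: ifP => [|_]; last by rewrite mul0mx.
rewrite -mulgA groupMl // => Pkl; case/negP: ll0; rewrite -(inj_eq enum_val_inj) l0E.
have : (k * kap l)%g \in P :&: K by rewrite inE Pkl groupM // enum_valP.
by rewrite tiPK => /set1P kl; rewrite eq_sym eq_invg_mul kl.
Qed.

Lemma ind_mul (I : finType) (X Y : I -> gT -> 'M[F]_d) Z g h :
  {in P &, forall u v, Z (u * v)%g = \sum_s X s u *m Y s v} ->
  ind Z (g * h)%g = \sum_s ind (X s) g *m ind (Y s) h.
Proof.
move=> ZM; have XY s : ind (X s) g *m ind (Y s) h = \mxblock_(j < #|K|, k < #|K|)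
    \sum_l ext0 (X s) ((kap j)^-1 * g * kap l)%g *m ext0 (Y s) ((kap l)^-1 * h * kap k)%g.
  exact: mul_mxblock.
rewrite (eq_bigr _ (fun s _ => XY s)); apply: etrans (mxblock_sum _ _).
apply: eq_mxblock => i j.
have [u [v [uv Pu uvE]]] := ext0_mul i j g h.
under [RHS]eq_bigr do rewrite uvE; rewrite -uv /ext0 groupMl //.
by case: ifP => Pv; [rewrite ZM | rewrite big1 // => l _; rewrite mulmx0].
Qed.

Definition bdiag (x : 'I_#|K| -> 'M[F]_d) := \mxdiag_(i < #|K|) x i.

Lemma bdiagE x : bdiag x = \mxblock_(i < #|K|, j < #|K|) (if i == j then x i else 0).
Proof. by apply: eq_mxblock => i j; rewrite conform_mx_id. Qed.

Lemma bdiagM x y : bdiag x *m bdiag y = bdiag (fun i => x i *m y i).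
Proof.
rewrite [bdiag y]bdiagE mul_mxdiag_mxblock bdiagE; apply: eq_mxblock => i j.
by case: eqP; rewrite ?mulmx0.
Qed.

Lemma ind_bdiag X u : u \in P -> ind X u = bdiag (fun i => X (u ^ kap i)%g).
Proof.
move=> Pu; apply: eq_mxblock => i j; have nPK k : k \in 'N(P) by rewrite (subsetP (normal_norm nP)) ?inE.
rewrite conform_mx_id /ext0; have [->|ij] := eqVneq i j; first by rewrite -mulgA -conjgE memJ_norm ?Pu.
case: ifP => // Pij; case/eqP: ij.
apply: enum_val_inj; apply/eqP; rewrite eq_mulVg1.
have : ((kap i)^-1 * kap j)%g \in P :&: K.
  rewrite inE [_ \in K]groupM ?groupV ?enum_valP // andbT.
  have -> : ((kap i)^-1 * kap j)%g = ((u ^ kap i)^-1 * ((kap i)^-1 * u * kap j))%g.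
    by rewrite conjgE !invgM invgK -!mulgA mulKVg mulKg.
  by rewrite groupM // groupV memJ_norm.
by rewrite tiPK => /set1P ->.
Qed.

Lemma bdiag_comm_prod (I : eqType) (e : I -> 'I_#|K| -> F) (s : seq I) :
  comm_prod (fun m => bdiag (fun j => (e m j)%:M)) s =
  bdiag (fun j => (\prod_(m <- s) (1 - e m j))%:M).
Proof.
have bdiag1 : bdiag (fun=> 1%:M) = 1%:M by apply: mxdiagZ.
elim: s => [|m s IHs] /=.
  by rewrite -bdiag1; apply: eq_mxdiag => j; rewrite big_nil.
rewrite IHs -bdiag1 -mxdiagB bdiagM; apply: eq_mxdiag => j.
by rewrite big_cons -raddfB -scalar_mxM.
Qed.

Variables (c : gT -> 'M[F]_d) (b : gT -> gT -> F) (x y : gT).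
Hypotheses (cD : additive_on P c) (Px : x \in P) (Py : y \in P) (bxy : b x y != b y x).
Hypothesis cc : {in P &, forall g h, c g *m c h - c h *m c g = (b g h - b h g)%:M}.

Lemma ind_bdiag_aug u : u \in P ->
  gext (ind c) (ginj F u - 1) = bdiag (fun i => c (u ^ kap i)%g).
Proof.
move=> Pu; rewrite linearB /= gext1 gext_inj !ind_bdiag //.
rewrite -mxdiagB; apply: eq_mxdiag => i; rewrite conj1g.
have /(congr1 (fun z => z - c 1%g)) := cD (group1 P) (group1 P).
by rewrite mulg1 addrK subrr => <-; rewrite subr0.
Qed.

(* On the [i]-th block the commutator of the translates of [x] and [y] by the
   [i]-th element of [K] is a nonzero scalar. *)
Lemma ind_stable_rank0 (W : 'M[F]_(\sum_(i < #|K|) d)) :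
  (forall u, u \in P -> stablemx W (gext (ind c) (ginj F u - 1))) ->
  (\rank W)%:R = 0 :> F.
Proof.
move=> sW; have PJ u k : u \in P -> (u ^ k)%g \in P.
  by move=> Pu; rewrite memJ_norm // (subsetP (normal_norm nP)) ?inE.
pose X i j u := ((u ^ (kap i)^-1) ^ kap j)%g.
pose lam := (b x y - b y x)^-1.
(* For [j = i] the two conjugations in [X] cancel, and [lam] normalizes the scalar to
   [e i i = 1]. *)
pose e i j := lam * (b (X i j x) (X i j y) - b (X i j y) (X i j x)).
have XP i j u : u \in P -> X i j u \in P by move=> Pu; rewrite !PJ.
apply: (@comm_prod_rank0 _ _ _ W (fun i => bdiag (fun j => c (X i j x)))
  (fun i => lam *: bdiag (fun j => c (X i j y))) (fun i => bdiag (fun j => (e i j)%:M))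
  (enum 'I_#|K|)).
- move=> i; rewrite -scalemxAl -scalemxAr -scalerBr !bdiagM -mxdiagB.
  have lamE : bdiag (fun=> lam%:M) = lam%:M by apply: mxdiagZ.
  rewrite -mul_scalar_mx -lamE bdiagM; apply: eq_mxdiag => j.
  by rewrite cc ?XP // mul_scalar_mx scale_scalar_mx.
- move=> i j; rewrite /comm_mx !bdiagM; apply: eq_mxdiag => l.
  by rewrite scalar_mxC.
- by move=> i; rewrite -ind_bdiag_aug ?PJ //; apply: sW; rewrite PJ.
- move=> i; rewrite -ind_bdiag_aug ?PJ // -scalemxAr scalemx_sub //.
  by apply: sW; rewrite PJ.
rewrite bdiag_comm_prod /bdiag -[RHS]mxdiag0; apply: eq_mxdiag => j.
rewrite (bigD1_seq j) ?mem_enum ?enum_uniq //= /e /X !conjgKV.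
by rewrite mulVf ?subr_eq0 // subrr mul0r raddf0.
Qed.

End Induction.

Lemma separating_functional (F : fieldType) (gT : finGroupType) (U : {vspace GA F gT}) z :
  z \notin U -> exists f : {linear GA F gT -> F^o}, (forall u, u \in U -> f u = 0) /\ f z != 0.
Proof.
move=> Uz; pose w := z - projv U z.
have w0 : w != 0 by apply: contra Uz; rewrite subr_eq0 => /eqP ->; apply: memv_proj.
have [g wg] : exists g, w g != 0.
  apply/existsP; apply: contraNT w0 => /existsPn w0; apply/eqP/ffunP=> g.
  by rewrite [RHS]ffunE; apply/eqP; move: (w0 g); rewrite negbK.
pose f (a : GA F gT) : F^o := (a - projv U a) g.
have fl : linear f.
  move=> k a b; rewrite /f linearP opprD addrACA -scalerBr ffunE galgZE.
  by [].
pose fm := GRing.isSemilinear.Build F (GA F gT) F^o _ f (GRing.semilinear_linear fl).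
pose fL : {linear GA F gT -> F^o} := HB.pack f fm.
by exists fL; split=> // u Uu /=; rewrite /f projv_id // subrr ffunE.
Qed.

Section Representation.
Variables (F : fieldType) (p : nat) (gT : finGroupType) (P K : {group gT}).
Hypotheses (charFp : p \in [pchar F]) (nP : P <| [set: gT]).
Hypotheses (defG : (P * K)%g = [set: gT]) (tiPK : (P :&: K = 1)%g).
Local Notation A := (GA F gT).

(* [sg + rh e + ps e^2] is a representation over [F[e]/(e^3)] induced from the
   representation [1 + c e + psi e^2] of [P]. *)
Lemma noncommutative_rep x y : x \in P -> y \in P ->
  (ginj F x - 1) * (ginj F y - 1) - (ginj F y - 1) * (ginj F x - 1) \notin Iaug F P 3 ->
  exists N, exists sg rh ps : {linear A -> 'M[F]_N}, [/\ (0 < N)%N /\ sg 1 = 1%:M,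
    [/\ forall a b, sg (a * b) = sg a *m sg b,
        forall a b, rh (a * b) = sg a *m rh b + rh a *m sg b &
        forall a b, ps (a * b) = sg a *m ps b + rh a *m rh b + ps a *m sg b],
    forall u, u \in P -> sg (ginj F u - 1) = 0 &
    forall W : 'M[F]_N, (forall u, u \in P -> stablemx W (rh (ginj F u - 1))) ->
      (\rank W)%:R = 0 :> F].
Proof.
move=> Px Py /separating_functional[f [f0 fxy]].
(* As [f] kills [Iaug F P 3], [b] is biadditive on [P]; and [gh - 1 = (g - 1) + (h - 1) + (g - 1)(h
   - 1)] makes [f (g - 1)] the function [th] of [weyl_cocycle]. *)
pose b g h : F := f ((ginj F g - 1) * (ginj F h - 1)).
have Iu u : u \in P -> ginj F u - 1 \in Iaug F P 1 by move=> Pu; rewrite Iaug1 mem_augv.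
have f3 u v w : u \in P -> v \in P -> w \in P ->
    f ((ginj F u - 1) * (ginj F v - 1) * (ginj F w - 1)) = 0.
  by move=> Pu Pv Pw; apply: f0; rewrite (mem_IaugM (m := 2) (n := 1)) ?(mem_IaugM (m := 1) (n := 1)) ?Iu.
have ginj1B u v : ginj F (u * v)%g - 1 =
    (ginj F u - 1) + (ginj F v - 1) + (ginj F u - 1) * (ginj F v - 1).
  rewrite [_ * (_ - 1)]mulrBl mul1r -addrA [X in _ = _ + X]addrC subrK mulrBr mulr1.
  by rewrite [RHS]addrC addrA subrK ginjM.
have bDr g : g \in P -> additive_on P (b g).
  move=> Pg u v Pu Pv; rewrite /b ginj1B.
  move: (ginj F u - 1) (ginj F v - 1) (ginj F g - 1) (f3 _ _ _ Pg Pu Pv) => U V W W0.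
  by rewrite !mulrDr mulrA !linearD /= W0 addr0.
have bDl h : h \in P -> additive_on P (b^~ h).
  move=> Ph u v Pu Pv; rewrite /b ginj1B.
  move: (ginj F u - 1) (ginj F v - 1) (ginj F h - 1) (f3 _ _ _ Pu Pv Ph) => U V W W0.
  by rewrite !mulrDl !linearD /= W0 addr0.
have thD : {in P &, forall g h, (f (ginj F (g * h)%g - 1) : F) =
    f (ginj F g - 1) + f (ginj F h - 1) + b g h}.
  move=> u v _ _; rewrite /b ginj1B; move: (ginj F u - 1) (ginj F v - 1) => U V.
  by rewrite !linearD.
have [d [c [psi [d0 cD psiD cc]]]] := weyl_cocycle charFp bDr bDl thD.
have bxy : b x y != b y x by rewrite -subr_eq0 /b -linearB.
pose one (g : gT) : 'M[F]_d := 1%:M.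
(* Listing the coefficients by degree in e turns the three product rules into one Cauchy product. *)
pose T : seq (gT -> 'M[F]_d) := [:: one; c; psi].
have indM n : (n < 3)%N -> forall g h, ind P K (nth one T n) (g * h)%g =
    \sum_(i < n.+1) ind P K (nth one T i) g *m ind P K (nth one T (n - i)) h.
  move=> n3 g h; apply: (ind_mul defG tiPK (X := fun i : 'I_n.+1 => nth one T i)
    (Y := fun i : 'I_n.+1 => nth one T (n - i))) => u v Pu Pv.
  case: n n3 => [|[|[|]]] // _; rewrite ?big_ord_recl big_ord0 /= /one ?mul1mx ?mulmx1 ?addr0 //.
    by rewrite cD // addrC.
  by rewrite psiD // [psi u + _]addrC -addrA [psi u + _]addrC.
have indA n : (n < 3)%N -> forall a e, gext (ind P K (nth one T n)) (a * e : A) =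
    \sum_(i < n.+1) gext (ind P K (nth one T i)) a *m gext (ind P K (nth one T (n - i))) e.
  move=> n3; apply: bilinear_galg_eq => [a k e h|e k a h|a k e h|e k a h|g h].
  - by rewrite mulrDr -scalerAr linearP.
  - by rewrite mulrDl -scalerAl linearP.
  - rewrite scaler_sumr -big_split /=; apply: eq_bigr => i _.
    by rewrite linearP mulmxDr scalemxAr.
  - rewrite scaler_sumr -big_split /=; apply: eq_bigr => i _.
    by rewrite linearP mulmxDl scalemxAl.
  - by rewrite -ginjM gext_inj indM //; apply: eq_bigr => i _; rewrite !gext_inj.
exists (\sum_(i < #|K|) d)%N, (gext (ind P K one)), (gext (ind P K c)), (gext (ind P K psi)).
have ind_one u : u \in P -> ind P K one u = 1%:M.
  by move=> Pu; rewrite ind_bdiag //; apply: mxdiagZ.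
split.
- split; first by rewrite sum_nat_const card_ord muln_gt0 cardG_gt0.
  by rewrite /= gext1 ind_one.
- split=> a e.
  + by have /= := indA 0%N isT a e; rewrite big_ord1.
  + by have /= := indA 1%N isT a e; rewrite !big_ord_recl big_ord0 addr0.
  + by have /= := indA 2%N isT a e; rewrite !big_ord_recl big_ord0 addr0 addrA.
- by move=> u Pu; rewrite linearB /= gext1 gext_inj !ind_one // subrr.
- by move=> W; apply: (ind_stable_rank0 nP tiPK cD Px Py bxy cc).
Qed.

End Representation.

(* Pull back the representation of [noncommutative_rep] to the group algebra of
   [P * K]. The matrices [rh (f (u - 1))], [u] in [P], commute because [P] is
   abelian and [sg] kills the radical, hence [stable_dim_neq0] provides a stable
   subspace whose dimension is nonzero in [F]. *)
Lemma augv_comm_Iaug3 (F : closedFieldType) (p : nat) (gT hT : finGroupType)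
    (P K : {group gT}) (Q L : {group hT}) (f : 'AHom(GA F gT, GA F hT)) :
  p \in [pchar F] -> P <| [set: gT] -> abelian P -> (P * K)%g = [set: gT] -> p^'.-group K ->
  Q <| [set: hT] -> (Q * L)%g = [set: hT] -> (Q :&: L = 1)%g ->
  (f @: gJ F P)%VS = gJ F Q ->
  forall a b, a \in augv F Q -> b \in augv F Q -> a * b - b * a \in Iaug F Q 3.
Proof.
move=> charFp nP abP defG p'K nQ defH tiQL fJ a b Qa Qb.
suff IQ x y : x \in Q -> y \in Q ->
    (ginj F x - 1) * (ginj F y - 1) - (ginj F y - 1) * (ginj F x - 1) \in Iaug F Q 3.
  have sub (c : GA F hT) (X : {set hT}) :
      (forall u, u \in X -> c * (ginj F u - 1) - (ginj F u - 1) * c \in Iaug F Q 3) ->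
      forall e, e \in augv F X -> c * e - e * c \in Iaug F Q 3.
    move=> cX e Xe; have fE i : (amull c - amulr c) i = c * i - i * c by rewrite !lfunE /= !lfunE /= lfunE.
    have : e \in ((amull c - amulr c) @^-1: Iaug F Q 3)%VS.
      by apply: subvP Xe; apply: augv_sub => u Xu; rewrite -memv_preim fE cX.
    by rewrite -memv_preim fE.
  apply: (sub) Qb => u Qu; rewrite -opprB memvN; apply: (sub) Qa => v Qv.
  exact: IQ.
move=> Qx Qy; apply: contraT => /(noncommutative_rep charFp nQ defH tiQL Qx Qy).
case=> N [sg [rh [ps [[N0 sg1] [sgM rhM psM] sgQ rank0]]]].
have sgJ c : c \in gJ F Q -> sg c = 0.
  move=> Jc; have : (gJ F Q <= lker (linfun sg))%VS.
    apply/prodvP=> a1 b1 Qa1 _; rewrite memv_ker lfunE /= sgM.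
    have : a1 \in lker (linfun sg).
      by apply: subvP Qa1; apply: augv_sub => u Qu; rewrite memv_ker lfunE /= sgQ.
    by rewrite memv_ker lfunE /= => /eqP ->; rewrite mul0mx.
  by move/subvP/(_ _ Jc); rewrite memv_ker lfunE /= => /eqP.
have PJ u : u \in P -> ginj F u - 1 \in gJ F P.
  by move=> Pu; rewrite -[_ - 1]mulr1 memv_mul ?memvf // mem_augv.
have sgfP u : u \in P -> sg (f (ginj F u - 1)) = 0.
  by move=> Pu; apply: sgJ; rewrite -fJ memv_img ?PJ.
have PK u k : u \in P -> (u ^ k)%g \in P.
  by move=> Pu; rewrite memJ_norm // (subsetP (normal_norm nP)) ?inE.
(* The value 0 outside [P] is harmless for commutation and for the action of [K], and makes [gT] the
   index type. *)
pose R u := if u \in P then rh (f (ginj F u - 1)) else 0.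
pose S k := sg (f (ginj F k)).
have SM k l : S (k * l)%g = S k *m S l by rewrite /S ginjM ahomM sgM.
have [|||||W [sWR sWS]] := @stable_dim_neq0 F N gT R gT K S (fun k u => (u ^ k^-1)%g) N0.
- move=> u v; rewrite /comm_mx /R.
  case: ifP => Pu; last by rewrite mul0mx mulmx0.
  case: ifP => Pv; last by rewrite mul0mx mulmx0.
  have psR u1 v1 : u1 \in P -> v1 \in P ->
     rh (f (ginj F u1 - 1)) *m rh (f (ginj F v1 - 1)) =
       ps (f ((ginj F u1 - 1) * (ginj F v1 - 1))).
     by move=> Pu1 Pv1; rewrite ahomM psM !sgfP // mul0mx mulmx0 addr0 add0r.
  rewrite !psR //; congr (ps (f _)); rewrite !mulrBr !mulrBl !mul1r !mulr1 -!ginjM.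
  by rewrite (centsP abP u Pu v Pv) !opprB addrACA [RHS]addrACA; congr (_ + _); rewrite addrC.
- by rewrite /S ginj1 ahom1.
- by move=> k l _ _; apply: SM.
- move=> k u Kk; have nPk : (k^-1)%g \in 'N(P) by rewrite (subsetP (normal_norm nP)) ?inE.
  rewrite /S /R (memJ_norm _ nPk); case: ifP => Pu; last by rewrite mulmx0 mul0mx.
  have -> : sg (f (ginj F k)) *m rh (f (ginj F u - 1)) = rh (f (ginj F k * (ginj F u - 1))).
    by rewrite ahomM rhM sgfP // mulmx0 addr0.
  have -> : ginj F k * (ginj F u - 1) = (ginj F (u ^ k^-1)%g - 1) * ginj F k.
    by rewrite mulrBr mulrBl mulr1 mul1r -!ginjM conjgE invgK -!mulgA mulVg mulg1.
  by rewrite ahomM rhM sgfP ?PK // mul0mx add0r.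
- by rewrite (pchar_natr_neq0 charFp) -p'natE ?(pcharf_prime charFp).
case/eqP; apply: rank0 => u Qu.
have : ginj F u - 1 \in (f @: gJ F P)%VS.
  by rewrite fJ -[_ - 1]mulr1 memv_mul ?memvf // mem_augv.
case/memv_imgP=> c Jc ->.
(* Stability of [W] becomes membership in the kernel of a linear map, so it suffices to check it on
   the spanning products [(v - 1) * g]. *)
pose T := linfun (mulmxr (cokermx W) \o (mulmx W \o (rh \o f))).
have TE d : (d \in lker T) = stablemx W (rh (f d)).
  by rewrite memv_ker lfunE /= submxE.
rewrite -TE; apply: subvP Jc; rewrite /gJ -gspanT.
apply: prodv_span => _ _ /imageP[v Pv ->] /imageP[g _ ->]; rewrite TE.
have /mulsgP[w k Pw Kk ->] : g \in (P * K)%g by rewrite defG inE.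
rewrite ahomM rhM sgfP // mul0mx add0r ginjM ahomM sgM.
have -> : sg (f (ginj F w)) = 1%:M.
  by rewrite -[ginj F w](subrK 1) 2!linearD /= sgfP // add0r ahom1.
rewrite mul1mx stablemxM ?sWS //.
by have := sWR v; rewrite /R Pv.
Qed.

(** * Hilbert series and the invariants of an abelian p-group *)

Section GeometricProducts.
Implicit Types (s t : seq nat) (q m n : nat).

Definition geom_prod s : {poly int} := \prod_(q <- s) \sum_(k < q) 'X^k.

Definition cyclo_prod s : {poly int} := \prod_(q <- s) (1 - 'X^q).

Lemma cyclo_geom_prod s : cyclo_prod s = (1 - 'X) ^+ size s * geom_prod s.
Proof.
rewrite /cyclo_prod /geom_prod; elim: s => [|q s IHs]; first by rewrite !big_nil expr0 mulr1.
rewrite !big_cons IHs exprS mulrACA; congr (_ * _).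
by rewrite -opprB subrX1 -mulNr opprB.
Qed.

Lemma geom_prod_coef s : all (fun q => 1 < q)%N s ->
  (geom_prod s)`_0 = 1 /\ (geom_prod s)`_1 = (size s)%:R.
Proof.
rewrite /geom_prod; elim: s => [|q s IHs] /=; first by rewrite big_nil !coef1.
case: q => [|[|q]] //= /IHs[s0 s1]; rewrite big_cons.
have -> : \sum_(k < q.+2) 'X^k = \poly_(k < q.+2) 1 :> {poly int}.
  by rewrite poly_def; apply: eq_bigr => k _; rewrite scale1r.
by rewrite !coefM !big_ord_recl !big_ord0 !coef_poly /= subn0 s0 s1 !mul1r !addr0 natr1.
Qed.

Lemma cyclo_prod_coef s m : (0 < m)%N -> all (fun q => m <= q)%N s ->
  (cyclo_prod s)`_0 = 1 /\ (cyclo_prod s)`_m = - (count_mem m s)%:R.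
Proof.
move=> m0; rewrite /cyclo_prod; elim: s => [|q s IHs] /=.
  by rewrite big_nil !coef1 (gtn_eqF m0) mulr0n oppr0.
case/andP=> mq /IHs[s0 sm]; have q0 : (0 < q)%N := leq_trans m0 mq.
rewrite big_cons mulrBl mul1r !coefB !coefXnM q0 s0 subr0; split=> //.
rewrite sm; have [->|qm] := eqVneq q m; last by rewrite ltn_neqAle eq_sym qm mq subr0.
by rewrite ltnn subnn s0 -opprD natrD addrC.
Qed.

(* The smallest [m] in [s] is the least positive degree occurring in
   [cyclo_prod s], and its multiplicity is read off the coefficient. *)
Lemma cyclo_prod_inj s t : all (fun q => 0 < q)%N s -> all (fun q => 0 < q)%N t ->
  cyclo_prod s = cyclo_prod t -> perm_eq s t.
Proof.
have [n] := ubnP (size s + size t); elim: n => // n IHn in s t *.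
move=> szn s0 t0 eqst; have [st0|stn] := eqVneq (s ++ t) [::].
  by case: s t st0 {s0 t0 eqst szn} => [|? ?] [|? ?].
have [m stm mP] : exists2 m, m \in s ++ t & forall q, q \in s ++ t -> (m <= q)%N.
  case: (s ++ t) stn => // a u _; elim: u a => [|c u IHu] a.
    by exists a; rewrite ?mem_head // => q; rewrite inE => /eqP ->.
  have [m um mP] := IHu c; have [am|ma] := leqP a m.
    exists a; first exact: mem_head.
    by move=> q; rewrite inE => /predU1P[->|/mP] //; apply: leq_trans.
  exists m; first by rewrite inE um orbT.
  by move=> q; rewrite inE => /predU1P[->|/mP] //; apply: ltnW.
have m0 : (0 < m)%N by move: stm; rewrite mem_cat => /orP[/(allP s0)|/(allP t0)].
have [|_ sm] := @cyclo_prod_coef s m m0.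
  by apply/allP=> q sq; rewrite mP // mem_cat sq.
have [|_ tm] := @cyclo_prod_coef t m m0.
  by apply/allP=> q tq; rewrite mP // mem_cat tq orbT.
have ct : count_mem m s = count_mem m t.
  by move: tm; rewrite -eqst sm => /oppr_inj/eqP; rewrite Num.Theory.eqr_nat => /eqP.
have sm' : m \in s by move: stm; rewrite mem_cat -!has_pred1 !has_count ct orbb.
have tm' : m \in t by rewrite -has_pred1 has_count -ct -has_count has_pred1.
have ps := perm_to_rem sm'; have pt := perm_to_rem tm'.
rewrite (perm_trans ps) // perm_sym (perm_trans pt) // perm_cons perm_sym.
apply: IHn.
- by move: szn; rewrite (perm_size ps) (perm_size pt) /= !addSn addnS ltnS; apply: ltnW.
- by move: s0; rewrite (perm_all _ ps) => /andP[].
- by move: t0; rewrite (perm_all _ pt) => /andP[].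
move: eqst; rewrite /cyclo_prod (perm_big _ ps) (perm_big _ pt) !big_cons => /mulfI; apply.
apply/eqP=> /polyP/(_ 0%N); rewrite coefB coef1 coefXn coef0 (ltn_eqF m0) subr0 => /eqP.
by rewrite oner_eq0.
Qed.

(** The linear coefficient gives the number of factors; multiplying by that power of [1 - 'X]
    reduces to [cyclo_prod]. *)
Lemma geom_prod_inj s t : all (fun q => 1 < q)%N s -> all (fun q => 1 < q)%N t ->
  geom_prod s = geom_prod t -> perm_eq s t.
Proof.
move=> s1 t1 eqst; have [_ sc] := geom_prod_coef s1; have [_ tc] := geom_prod_coef t1.
have szst : size s = size t.
  by apply/eqP; rewrite -(Num.Theory.eqr_nat int) -sc -tc eqst.
apply: cyclo_prod_inj.
- by apply: sub_all s1 => q; apply: ltnW.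
- by apply: sub_all t1 => q; apply: ltnW.
by rewrite !cyclo_geom_prod szst eqst.
Qed.

End GeometricProducts.

Section AbelianType.
Variables (F : fieldType) (p : nat).
Hypothesis charFp : p \in [pchar F].

(** Both sides count the admissible monomials of degree exactly [n]. *)
Lemma abelian_type_coef (gT : finGroupType) (P : {group gT}) n :
  p.-group P -> abelian P ->
  (geom_prod (abelian_type P))`_n = (\dim (Iaug F P n) - \dim (Iaug F P n.+1))%N%:R.
Proof.
move=> pP abP; have [b defP <-] := abelian_structure abP.
pose x := tnth (in_tuple b).
have defPx : (\big[dprod/1]_(i < size b) <[x i]> = P)%g by rewrite -defP [RHS]big_tnth.
rewrite /geom_prod big_map big_tnth -/x (coef_jdeg x) !(dim_Iaug charFp pP abP defPx).
congr (_%:R); apply/esym/eqP; rewrite -(eqn_add2r #|[set m in jadm x | n.+1 <= jdeg m]%N|).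
rewrite subnK; last by apply/subset_leq_card/subsetP=> m; rewrite !inE => /andP[-> /ltnW].
rewrite -cardsUI [X in (_ + X)%N](_ : _ = 0%N) ?addn0.
  apply/eqP/eq_card=> m; rewrite !inE -andb_orr; congr (_ && _).
  by rewrite leq_eqVlt eq_sym.
apply/eqP; rewrite cards_eq0 -subset0; apply/subsetP=> m; rewrite !inE.
by case/andP=> /andP[_ /eqP ->]; rewrite ltnn andbF.
Qed.

Lemma dim_Iaug_isog (gT hT : finGroupType) (P : {group gT}) (Q : {group hT}) :
  p.-group P -> abelian P -> p.-group Q -> abelian Q ->
  (forall n, \dim (Iaug F P n) = \dim (Iaug F Q n)) -> P \isog Q.
Proof.
move=> pP abP pQ abQ dimPQ; rewrite eq_abelian_type_isog //; apply/eqP.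
apply: sorted_eq (abelian_type_dvdn_sorted P) (abelian_type_dvdn_sorted Q) _.
- by move=> q m n mq qn; apply: dvdn_trans qn mq.
- by move=> m n /= /andP[nm mn]; apply/eqP; rewrite eqn_dvd mn.
apply: geom_prod_inj; try exact: abelian_type_gt1.
by apply/polyP=> n; rewrite !abelian_type_coef // !dimPQ.
Qed.

End AbelianType.

(** * Comparison of the two groups *)

Lemma normal_Sylow_complement p (gT : finGroupType) (G P K : {group gT}) :
  P <| G -> p.-Sylow(G) P -> p^'.-Hall(G) K -> (P * K = G)%g /\ (P :&: K = 1)%g.
Proof.
move=> nP sylP hallK; have coPK : coprime #|P| #|K|.
  exact: pnat_coprime (pHall_pgroup sylP) (pHall_pgroup hallK).
split; last exact: coprime_TIg.
apply/eqP; rewrite eqEcard mul_subG ?(pHall_sub sylP) ?(pHall_sub hallK) //=.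
by rewrite coprime_cardMg // (card_Hall sylP) (card_Hall hallK) partnC ?cardG_gt0.
Qed.

Lemma gspan_gJ (F : fieldType) (gT : finGroupType) (P K : {group gT}) :
  (P * K)%g = [set: gT] -> (gspan F K + gJ F P)%VS = fullv.
Proof.
move=> defG; apply/eqP; rewrite eqEsubv subvf -gspanT; apply: gspan_ind => g _.
have /mulsgP[u k Pu Kk ->] : g \in (P * K)%g by rewrite defG inE.
have -> : ginj F (u * k)%g = ginj F k + (ginj F u - 1) * ginj F k.
  by rewrite mulrBl mul1r -ginjM addrC subrK.
by rewrite memv_add ?ginj_gspan // memv_mul ?memvf ?mem_augv.
Qed.

Section Comparison.
Variables (F : closedFieldType) (p : nat).
Hypothesis charFp : p \in [pchar F].

Section NormalSylow.
Variables (gT hT : finGroupType) (P : {group gT}) (Q : {group hT}).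
Variables (f : 'AHom(GA F gT, GA F hT)) (f' : 'AHom(GA F hT, GA F gT)).
Hypothesis isof : ahom_iso f f'.
Hypotheses (sylP : p.-Sylow([set: gT]) P) (sylQ : p.-Sylow([set: hT]) Q).

Lemma ahom_iso_card : #|[set: gT]| = #|[set: hT]|.
Proof.
by rewrite !cardsT -!(dim_galg F) -(ahom_iso_dim fullv isof) (ahom_iso_limg isof).
Qed.

Lemma normal_Sylow_transfer : p_solvable p [set: hT] -> P <| [set: gT] ->
  forall K : {group gT}, p^'.-Hall([set: gT]) K -> Q <| [set: hT].
Proof.
move=> solH nP K hallK; have [L hallL] := p_solvable_Hall solH.
have pP := pHall_pgroup sylP; have p'L := pHall_pgroup hallL.
have nilU : nilp_ideal (f @: gJ F P).
  exact: nilp_ideal_img (ahom_iso_limg isof) (gJ_nilp charFp nP pP).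
apply: (normal_Sylow charFp solH p'L nilU _ sylQ).
have L0 : #|L|%:R != 0 :> F.
  by rewrite (pchar_natr_neq0 charFp) -p'natE ?(pcharf_prime charFp).
apply/eqP; rewrite eqEdim subvf (dimv_disjoint_sum (nilp_ideal_cap_gspan L0 nilU)).
rewrite (ahom_iso_dim _ isof) dim_gspan (card_Hall hallL) -ahom_iso_card -(card_Hall hallK).
have [defG _] := normal_Sylow_complement nP sylP hallK.
rewrite -(ahom_iso_limg isof) (ahom_iso_dim _ isof) -(gspan_gJ F defG).
by rewrite -(dim_gspan F K) dimv_add_leqif.
Qed.

Lemma ahom_iso_gJ : P <| [set: gT] -> Q <| [set: hT] -> (f @: gJ F P)%VS = gJ F Q.
Proof.
move=> nP nQ; have indexN kT (R : {group kT}) : p.-Sylow([set: kT]) R ->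
    ~~ (p %| #|[set: kT] : R|)%N.
  by case/and3P=> _ _; rewrite p'natE ?(pcharf_prime charFp).
have isof' := ahom_iso_sym isof; have [fK f'K] := isof.
apply: subv_anti; apply/andP; split.
  apply: (nilp_sub_gJ charFp nQ (indexN _ _ sylQ)).
  exact: nilp_ideal_img (ahom_iso_limg isof) (gJ_nilp charFp nP (pHall_pgroup sylP)).
have -> : gJ F Q = (f @: (f' @: gJ F Q))%VS.
  rewrite -limg_comp -[LHS]lim1g; congr (_ @: _)%VS; apply/lfunP=> a.
  by rewrite comp_lfunE id_lfunE f'K.
apply: limgS; apply: (nilp_sub_gJ charFp nP (indexN _ _ sylP)).
exact: nilp_ideal_img (ahom_iso_limg isof') (gJ_nilp charFp nQ (pHall_pgroup sylQ)).
Qed.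

End NormalSylow.

Lemma abelian_Sylow_transfer_trivg (gT hT : finGroupType) (P : {group gT}) (Q : {group hT})
    (f : 'AHom(GA F gT, GA F hT)) (f' : 'AHom(GA F hT, GA F gT)) :
  ahom_iso f f' -> p_solvable p [set: gT] -> p_solvable p [set: hT] ->
  ('O_p^'([set: gT]) = 1)%g -> p.-Sylow([set: gT]) P -> p.-Sylow([set: hT]) Q ->
  abelian P -> abelian Q /\ P \isog Q.
Proof.
move=> isof solG solH O1 sylP sylQ abP.
have nP := p_solvable_abelian_Sylow solG O1 sylP abP.
have [K hallK] := p_solvable_Hall solG; have [L hallL] := p_solvable_Hall solH.
have nQ := normal_Sylow_transfer isof sylP sylQ solH nP hallK.
have [defG tiPK] := normal_Sylow_complement nP sylP hallK.
have [defH tiQL] := normal_Sylow_complement nQ sylQ hallL.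
have pP := pHall_pgroup sylP; have pQ := pHall_pgroup sylQ.
have p'K := pHall_pgroup hallK; have p'L := pHall_pgroup hallL.
have fJ := ahom_iso_gJ isof sylP sylQ nP nQ.
have fJn n : (f @: Jaug F P n)%VS = Jaug F Q n.
  case: n => [|n]; first by rewrite !Jaug0 (ahom_iso_limg isof).
  by rewrite !Jaug_exp // aimgX fJ.
have comm3 := augv_comm_Iaug3 charFp nP abP defG p'K nQ defH tiQL fJ.
have [fK f'K] := isof.
have memJ n a : (f a \in Jaug F Q n) = (a \in Jaug F P n).
  rewrite -fJn; apply/idP/idP=> [/memv_imgP[c Jc]|]; last exact: memv_img.
  by move/(can_inj fK) ->.
(* The property mentions only the powers of J and the centre, which [f] matches, so it is pulled
   back to [F[G]] along [f']. *)
have liftQ : lifts_center F Q.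
  move=> n a Ja aJ1 aJ2; have := abelian_lifts_center charFp nP pP p'K defG tiPK abP.
  case/(_ n (f' a)) => [|b|b Jb|z [Jz cz az]].
  - by rewrite -memJ f'K.
  - by rewrite -memJ linearB /= !ahomM f'K.
  - by rewrite -memJ linearB /= !ahomM f'K aJ2 // memJ.
  exists (f z); split; first by rewrite memJ.
    by move=> b; rewrite -(f'K b) -!ahomM cz.
  by rewrite -[a]f'K -linearB memJ.
have abQ := abelian_of_lifts_center charFp nQ pQ p'L defH tiQL comm3 liftQ.
split=> //; apply: (dim_Iaug_isog charFp) => // n.
have KL : #|K| = #|L| by rewrite (card_Hall hallK) (card_Hall hallL) (ahom_iso_card isof).
apply/eqP; rewrite -(eqn_pmul2l (cardG_gt0 K)) -(dim_Jaug _ _ defG tiPK) KL.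
by rewrite -(dim_Jaug _ _ defH tiQL) -fJn (ahom_iso_dim _ isof).
Qed.

Lemma abelian_Sylow_transfer (gT hT : finGroupType) (P : {group gT}) (Q : {group hT})
    (f : 'AHom(GA F gT, GA F hT)) (f' : 'AHom(GA F hT, GA F gT)) :
  ahom_iso f f' -> p_solvable p [set: gT] -> p_solvable p [set: hT] ->
  p.-Sylow([set: gT]) P -> p.-Sylow([set: hT]) Q ->
  abelian P -> abelian Q /\ P \isog Q.
Proof.
move=> isof solG solH sylP sylQ abP.
have [phi [psi isophi]] := principal_block_iso charFp solG solH isof.
have nN : 'O_p^'([set: gT]) <| [set: gT] by apply: pcore_normal.
have nM : 'O_p^'([set: hT]) <| [set: hT] by apply: pcore_normal.
have PN : P \isog P / 'O_p^'([set: gT]).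
  apply: quotient_isog; first exact: subset_trans (subsetT _) (normal_norm nN).
  by rewrite setIC; apply: coprime_TIg (pnat_coprime (pHall_pgroup sylP) (pcore_pgroup _ _)).
have QM : Q \isog Q / 'O_p^'([set: hT]).
  apply: quotient_isog; first exact: subset_trans (subsetT _) (normal_norm nM).
  by rewrite setIC; apply: coprime_TIg (pnat_coprime (pHall_pgroup sylQ) (pcore_pgroup _ _)).
have [] := @abelian_Sylow_transfer_trivg _ _ (P / 'O_p^'([set: gT]))%G
  (Q / 'O_p^'([set: hT]))%G _ _ isophi.
- by rewrite setT_quotient //; apply: p_solvable_quotient.
- by rewrite setT_quotient //; apply: p_solvable_quotient.
- by rewrite setT_quotient //; apply: trivg_pcore_quotient.
- rewrite setT_quotient //; apply: quotient_pHall sylP.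
  exact: subset_trans (subsetT _) (normal_norm nN).
- rewrite setT_quotient //; apply: quotient_pHall sylQ.
  exact: subset_trans (subsetT _) (normal_norm nM).
- exact: quotient_abelian.
rewrite -(isog_abelian QM) => abQ PQ; split=> //.
exact: isog_trans PN (isog_trans PQ (isog_symr QM)).
Qed.

End Comparison.

Theorem theorem3p4 (F : closedFieldType) (p : nat) (gT hT : finGroupType)
  (P : {group gT}) (P' : {group hT}) :
  p \in [pchar F]%R ->
  p_solvable p [set: gT] -> p_solvable p [set: hT] ->
  P \in 'Syl_p([set: gT])%g -> P' \in 'Syl_p([set: hT])%g ->
  galg_isomorphic F gT hT ->
  ((abelian P <-> abelian P') /\ (abelian P -> P \isog P'))%g.
Proof.
move=> charFp solG solH; rewrite !inE => sylP sylP' [f /galg_iso_ahom[phi [psi isof]]].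
have transfer := abelian_Sylow_transfer charFp isof solG solH sylP sylP'.
split; last by case/transfer.
split; first by case/transfer.
by case/(abelian_Sylow_transfer charFp (ahom_iso_sym isof) solH solG sylP' sylP).
Qed.
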